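(* Let $(A,\Sigma)$ be an irreducible Artin--Tits system of spherical type with $A\neq A_1$, and let $\mathcal{S}_A$ be the Garside generating set of $A$. For every proper standard parabolic subgroup $A_X$ of $A$ ($X\subsetneq\Sigma$), one has $$\omega(A_X,\mathcal{S}_A^{\pm1})<\omega(A,\mathcal{S}_A^{\pm1})\quad\text{and}\quad \omega(A_X^+,\mathcal{S}_A)<\omega(A^+,\mathcal{S}_A).$$ Moreover, the sequences $\{\omega(A_n,\mathcal{S}_{A_n}^{\pm1})\}_{n=1}^\infty$, $\{\omega(B_n,\mathcal{S}_{B_n}^{\pm1})\}_{n=2}^\infty$, $\{\omega(D_n,\mathcal{S}_{D_n}^{\pm1})\}_{n=3}^\infty$, and the corresponding sequences for the submonoids of positive elements, $\{\omega(A_n^+,\mathcal{S}_{A_n})\}_{n=1}^\infty$, $\{\omega(B_n^+,\mathcal{S}_{B_n})\}_{n=2}^\infty$, $\{\omega(D_n^+,\mathcal{S}_{D_n})\}_{n=3}^\infty$, are increasing and unbounded.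
   Context: Given a finite set $\Sigma$ and a symmetric matrix $(m_{s,t})_{s,t\in\Sigma}$ with $m_{s,s}=1$ and $m_{s,t}\in\{2,3,\dots,\infty\}$ for $s\ne t$, the Artin--Tits group is $A=\langle \Sigma \mid sts\cdots=tst\cdots \ (m_{s,t}\text{ letters on each side}),\ s\neq t,\ m_{s,t}\neq\infty\rangle$; $(A,\Sigma)$ is an Artin--Tits system. It is of spherical type if the Coxeter group obtained by adding the relations $s^2=1$ ($s\in\Sigma$) is finite, and irreducible if $A$ is not a direct product of nontrivial Artin--Tits groups (equivalently the Coxeter graph is connected). $A_n$, $B_n$, $D_n$ denote the Artin--Tits groups whose Coxeter graphs are the usual graphs of types $A_n,B_n,D_n$ with $n$ vertices (so $A_n$ is the braid group on $n+1$ strands and $D_3=A_3$). $A^+$ is the submonoid of $A$ generated by $\Sigma$. Write $a\preccurlyeq b$ iff $a^{-1}b\in A^+$; in spherical type this is a lattice order on $A$, and $\Delta=\bigvee_{s\in\Sigma}s$ is the Garside element. The Garside generating set is $\mathcal{S}_A=\{s\in A : 1\preccurlyeq s\preccurlyeq\Delta\}$. For $X\subseteq\Sigma$, $A_X=\langle X\rangle$ is the standard parabolic subgroup generated by $X$ and $A_X^+$ is the submonoid generated by $X$. (Relative) exponential growth rate: if $M$ is a submonoid of a monoid $N$ and $S$ is a finite generating set of $N$ as a monoid, then $$\omega(M,S)=\lim_{n\to\infty}\left(\#\{g\in M : |g|_S\leq n\}\right)^{1/n},$$ where $|g|_S$ is the length of a shortest word in $S$ representing $g$. Above, $N=A$ with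 $S=\mathcal{S}_A^{\pm1}$ for the group statements, and $N=A^+$ with $S=\mathcal{S}_A$ for the positive monoid statements. *)

(* Defs.v *)
From HB Require Import structures.
From mathcomp Require Import all_boot all_order all_algebra.
From mathcomp Require Import finmap.
From mathcomp Require Import all_classical all_reals all_analysis.

Set Implicit Arguments.
Unset Strict Implicit.
Unset Printing Implicit Defensive.

Import Order.TTheory GRing.Theory Num.Theory.
Import numFieldNormedType.Exports.

Local Open Scope classical_set_scope.
Local Open Scope quotient_scope.
Local Open Scope group_scope.

(* In a signed word, (x, true) stands for x and (x, false) for its inverse. *)
Definition positive_word (T : Type) (w : seq T) : seq (T * bool) :=
  [seq (x, true) | x <- w].

Definition inverse_word (T : Type) (w : seq (T * bool)) : seq (T * bool) :=
  rev [seq (x.1, ~~ x.2) | x <- w].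

Inductive presentation_eq (T : Type) (rel : seq T -> seq T -> Prop) :
    seq (T * bool) -> seq (T * bool) -> Prop :=
| presentation_refl w : presentation_eq rel w w
| presentation_sym w w' :
    presentation_eq rel w w' -> presentation_eq rel w' w
| presentation_trans w1 w2 w3 : presentation_eq rel w1 w2 ->
    presentation_eq rel w2 w3 -> presentation_eq rel w1 w3
| presentation_cat u u' v v' : presentation_eq rel u u' ->
    presentation_eq rel v v' -> presentation_eq rel (u ++ v) (u' ++ v')
| presentation_cancel x b : presentation_eq rel [:: (x, b); (x, ~~ b)] [::]
| presentation_rel u v : rel u v ->
    presentation_eq rel (positive_word u) (positive_word v).

Section PresentedGroup.
Variables (T : choiceType) (rel : seq T -> seq T -> Prop).
Local Notation peq := (presentation_eq rel).

Let e (u v : seq (T * bool)) : bool := `[< peq u v >].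

Fact presentation_equiv_refl : reflexive e.
Proof. by move=> w; apply/asboolP; exact: presentation_refl. Qed.

Fact presentation_equiv_sym : symmetric e.
Proof.
by move=> u v; apply/idP/idP => /asboolP h; apply/asboolP;
  exact: presentation_sym.
Qed.

Fact presentation_equiv_trans : transitive e.
Proof.
move=> v u w /asboolP uv /asboolP vw; apply/asboolP.
exact: presentation_trans uv vw.
Qed.

Definition presentation_equiv : equiv_rel (seq (T * bool)) :=
  EquivRel e presentation_equiv_refl presentation_equiv_sym
    presentation_equiv_trans.

(* The group < T | u = v, for all u v such that rel u v >. *)
Definition presented_group : Type := {eq_quot presentation_equiv}.

HB.instance Definition _ := Choice.on presented_group.

Definition word_class (w : seq (T * bool)) : presented_group :=
  \pi_{eq_quot presentation_equiv}%qT w.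

Definition presented_mul (x y : presented_group) : presented_group :=
  word_class (repr x ++ repr y).

Definition presented_inv (x : presented_group) : presented_group :=
  word_class (inverse_word (repr x)).

Lemma word_classP u v : word_class u = word_class v <-> peq u v.
Proof.
split; first by move=> /eqmodP /asboolP.
by move=> h; apply/eqmodP/asboolP.
Qed.

Lemma word_class_repr x : word_class (repr x) = x.
Proof. exact: reprK. Qed.

Lemma repr_word_class w : peq (repr (word_class w)) w.
Proof. by apply/word_classP; rewrite word_class_repr. Qed.

Lemma presented_mulE u v :
  presented_mul (word_class u) (word_class v) = word_class (u ++ v).
Proof.
by apply/word_classP; apply: presentation_cat; exact: repr_word_class.
Qed.

Lemma cat_inverse_word w : peq (w ++ inverse_word w) [::].
Proof.
elim: w => [|[x b] w IH]; first exact: presentation_refl.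
have -> : ((x, b) :: w) ++ inverse_word ((x, b) :: w) =
    [:: (x, b)] ++ (w ++ inverse_word w) ++ [:: (x, ~~ b)].
  by rewrite /inverse_word /= rev_cons -cats1 catA.
apply: presentation_trans (presentation_cancel _ x b).
apply: presentation_cat (presentation_refl _ [:: (x, b)]) _.
exact: presentation_cat IH (presentation_refl _ _).
Qed.

Lemma inverse_wordK (w : seq (T * bool)) : inverse_word (inverse_word w) = w.
Proof.
rewrite /inverse_word map_rev revK -map_comp -[RHS]map_id.
by apply: eq_map => -[x b] /=; rewrite negbK.
Qed.

Lemma presented_mulA : associative presented_mul.
Proof.
move=> x y z.
rewrite -(word_class_repr x) -(word_class_repr y) -(word_class_repr z).
by rewrite !presented_mulE catA.
Qed.

Lemma presented_mul1 : left_id (word_class [::]) presented_mul.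
Proof. by move=> x; rewrite -(word_class_repr x) presented_mulE. Qed.

Lemma presented_mul1r : right_id (word_class [::]) presented_mul.
Proof. by move=> x; rewrite -(word_class_repr x) presented_mulE cats0. Qed.

Lemma presented_mulV :
  left_inverse (word_class [::]) presented_inv presented_mul.
Proof.
move=> x; rewrite -{2}(word_class_repr x) presented_mulE.
by apply/word_classP; rewrite -{2}[repr x]inverse_wordK; exact: cat_inverse_word.
Qed.

Lemma presented_mulVr :
  right_inverse (word_class [::]) presented_inv presented_mul.
Proof.
move=> x; rewrite -{1}(word_class_repr x) presented_mulE.
by apply/word_classP; exact: cat_inverse_word.
Qed.

HB.instance Definition _ := isGroup.Build presented_group
  presented_mulA presented_mul1 presented_mul1r presented_mulV presented_mulVr.

End PresentedGroup.

(* None encodes the entry infinity. *)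
Record coxeter_matrix (T : finType) := CoxeterMatrix {
  coxeter_entry :> T -> T -> option nat;
  coxeter_sym : forall s t, coxeter_entry s t = coxeter_entry t s;
  coxeter_diag : forall s, coxeter_entry s s = Some 1%N;
  coxeter_off_diag : forall s t k,
    s != t -> coxeter_entry s t = Some k -> (2 <= k)%N }.

(* The word s t s ... with k letters. *)
Fixpoint alternating_word (T : Type) (k : nat) (s t : T) : seq T :=
  if k is k'.+1 then s :: alternating_word k' t s else [::].

Definition artin_rel (T : finType) (m : coxeter_matrix T) (u v : seq T) : Prop :=
  exists s t k, [/\ s != t, m s t = Some k,
    u = alternating_word k s t & v = alternating_word k t s].

Definition coxeter_rel (T : finType) (m : coxeter_matrix T) (u v : seq T) : Prop :=
  artin_rel m u v \/ exists s, u = [:: s; s] /\ v = [::].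

Definition artin_group (T : finType) (m : coxeter_matrix T) : groupType :=
  presented_group (artin_rel m).

Definition coxeter_group (T : finType) (m : coxeter_matrix T) : groupType :=
  presented_group (coxeter_rel m).

Definition artin_gen (T : finType) (m : coxeter_matrix T) (s : T) : artin_group m :=
  word_class (artin_rel m) [:: (s, true)].

Definition isomorphic (G H : groupType) : Prop :=
  exists f : {multiplicative G -> H}, bijective f.

Definition nontrivial (G : groupType) : Prop := exists x : G, x <> 1.

Definition spherical (T : finType) (m : coxeter_matrix T) : Prop :=
  finite_set [set: coxeter_group m].

Definition irreducible (T : finType) (m : coxeter_matrix T) : Prop :=
  ~ exists (T1 T2 : finType) (m1 : coxeter_matrix T1) (m2 : coxeter_matrix T2),
      [/\ nontrivial (artin_group m1), nontrivial (artin_group m2) &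
          isomorphic (artin_group m) (artin_group m1 * artin_group m2)%type].

Definition is_submonoid (G : groupType) (P : set G) : Prop :=
  P 1 /\ forall x y, P x -> P y -> P (x * y).

Definition is_subgroup (G : groupType) (P : set G) : Prop :=
  is_submonoid P /\ forall x, P x -> P x^-1.

Section ArtinTits.
Variables (T : finType) (m : coxeter_matrix T).

Definition parabolic (X : set T) : set (artin_group m) :=
  smallest (@is_subgroup (artin_group m)) (artin_gen m @` X).

Definition positive_parabolic (X : set T) : set (artin_group m) :=
  smallest (@is_submonoid (artin_group m)) (artin_gen m @` X).

Definition positive_monoid : set (artin_group m) :=
  positive_parabolic [set: T].

Definition prefix_le (a b : artin_group m) : Prop := positive_monoid (a^-1 * b).

Definition is_garside_element (d : artin_group m) : Prop :=
  (forall s, prefix_le (artin_gen m s) d) /\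
  (forall b, (forall s, prefix_le (artin_gen m s) b) -> prefix_le d b).

Definition garside_set : set (artin_group m) :=
  [set a | exists2 d, is_garside_element d & prefix_le 1 a /\ prefix_le a d].

Definition garside_set_pm : set (artin_group m) :=
  garside_set `|` [set a^-1 | a in garside_set].

End ArtinTits.

Arguments parabolic {T} m X.
Arguments positive_parabolic {T} m X.
Arguments positive_monoid {T} m.
Arguments garside_set {T} m.
Arguments garside_set_pm {T} m.

Section Growth.
Local Open Scope ring_scope.
Variables (R : realType) (G : groupType).

(* The g in M such that |g|_S <= n. *)
Definition ball_in (M S : set G) (n : nat) : set G :=
  [set g | M g /\ exists w : seq G,
    [/\ (size w <= n)%N, (forall x, x \in w -> S x) & (\prod_(x <- w) x)%g = g]].

Definition growth_seq (M S : set G) (n : nat) : R :=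
  (#|` fset_set (ball_in M S n)|%fset%:R) `^ (n%:R^-1).

(* omega(M, S) = w: the limit exists and equals w. *)
Definition is_growth_rate (M S : set G) (w : R) : Prop :=
  growth_seq M S n @[n --> \oo] --> w.

End Growth.

(* The sequence of the omega(M n, S n), n >= k, is increasing and unbounded. *)
Definition growth_increasing_unbounded (R : realType) (k : nat)
    (G : nat -> groupType) (M S : forall n, set (G n)) : Prop :=
  exists w : nat -> R,
    [/\ forall n, (k <= n)%N -> is_growth_rate (M n) (S n) (w n),
        forall n n', (k <= n < n')%N -> (w n < w n')%R &
        forall b : R, exists2 n, (k <= n)%N & (b < w n)%R].

Section LabelledGraph.
Variables (n : nat) (lab : nat -> nat -> nat).
Hypothesis lab2 : forall i j, (2 <= lab i j)%N.

Let entry (i j : 'I_n) : option nat :=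
  Some (if i == j then 1%N else lab (minn i j) (maxn i j)).

Fact labelled_sym i j : entry i j = entry j i.
Proof. by rewrite /entry eq_sym minnC maxnC. Qed.

Fact labelled_diag i : entry i i = Some 1%N.
Proof. by rewrite /entry eqxx. Qed.

Fact labelled_off_diag i j k : i != j -> entry i j = Some k -> (2 <= k)%N.
Proof. by rewrite /entry => /negPf -> [<-]. Qed.

(* The Coxeter matrix on 'I_n whose (i, j) entry, for i < j, is lab i j. *)
Definition labelled_matrix : coxeter_matrix 'I_n :=
  CoxeterMatrix labelled_sym labelled_diag labelled_off_diag.

End LabelledGraph.

Definition label_A (i j : nat) : nat := if j == i.+1 then 3 else 2.

(* The edge labelled 4 joins the last two vertices. *)
Definition label_B (n i j : nat) : nat :=
  if j == i.+1 then (if j.+1 == n then 4 else 3) else 2.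

(* A path on 0, ..., n-2, with the vertex n-1 attached to n-3. *)
Definition label_D (n i j : nat) : nat :=
  if (j == i.+1) && (j.+1 < n) || (j == i.+2) && (j.+1 == n) then 3 else 2.

Fact label_A_ge2 i j : 2 <= label_A i j.
Proof. by rewrite /label_A; case: ifP. Qed.

Fact label_B_ge2 n i j : 2 <= label_B n i j.
Proof. by rewrite /label_B; case: ifP => // _; case: ifP. Qed.

Fact label_D_ge2 n i j : 2 <= label_D n i j.
Proof. by rewrite /label_D; case: ifP. Qed.

Definition coxeter_A (n : nat) : coxeter_matrix 'I_n :=
  labelled_matrix n label_A_ge2.
Definition coxeter_B (n : nat) : coxeter_matrix 'I_n :=
  labelled_matrix n (label_B_ge2 n).
Definition coxeter_D (n : nat) : coxeter_matrix 'I_n :=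
  labelled_matrix n (label_D_ge2 n).

(* Main.v *)
(** Let W be the finite Coxeter group of the system. An element of A^+ has a unique normal form
    x_1 ... x_n with simple factors x_i, indexed by elements of W, such that every left descent of
    x_(i+1) is a right descent of x_i. Uniqueness comes from the action of A^+ on streams of simple
    elements by left multiplication, in which w_0^2 acts centrally. Hence the elements of A_X^+ of
    length at most n are counted by the number a_n(X) of paths with n vertices in a finite graph on
    the parabolic subgroup W_X. Reduced left fractions show that the ball of radius n of A_X has
    between a_n(X) and (n + 1) a_n(X) elements, so that the group and the monoid have the same
    growth rate, which is the limit of the n-th roots of the submultiplicative sequence a_n(X).

    For X = S - {t} and a connected Coxeter graph, any path in W_X can be continued by a path of
    fixed length which leaves W_X and comes back to a state from which all paths of W_X can start.
    Blocks of paths of W_X of arbitrary lengths, separated by such connectors, satisfy a renewal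
    inequality whose solution grows strictly faster than a_n(X). A connector exists because w_I w_J
    leads from I to the set J of its neighbours in the other colour, for the colouring of the graph
    by the parity of the distance to a vertex, together with a duality z |-> z^-1 w_0.

    The three families are nested, and k disjoint commuting edges give a_n >= 2^(k n). *)

From HB Require Import structures.
Require Import Defs.
From mathcomp Require Import all_boot all_order all_algebra.
From mathcomp Require Import all_field zify ring lra finmap.
From mathcomp Require Import all_classical all_reals all_analysis.

Set Implicit Arguments.
Unset Strict Implicit.
Unset Printing Implicit Defensive.

Import Order.TTheory GRing.Theory Num.Theory.
Import numFieldNormedType.Exports.

Local Open Scope group_scope.

(** * Presented groups *)

(** Everything is computed in the finite group W, because A is only given by a presentation. An
    inverse letter does not act on streams. It acts there as s^-1 w_0^2, and since w_0^2 is central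
    the additional powers can be counted and removed at the end; so equality in A, and not only in a
    monoid, is detected by normal forms. Lengths are taken in the simple elements of A and not in
    those of A_X. This does no harm: the normal form of an element of A_X^+ does not leave W_X, and
    a reduced fraction of an element of A_X divides every other fraction of it in A. The obstacle to
    strictness is the return to a state from which all of W_X can start. The elements w_I w_J join
    disjoint sets I and J, so going back and forth between the colours never fills more than one
    colour class; duality supplies the other half of the way. The element 1 has no descents, so a
    path never leaves it again; paths through 1 are excluded from the blocks, which costs a factor n
    + 1. Irreducibility enters through its contrapositive, since a disconnected graph splits A.
    Finiteness of W for the three families is derived from the presentations. *)

Lemma word_class_cat (T : choiceType) (rel : seq T -> seq T -> Prop) u v :
  word_class rel (u ++ v) = (word_class rel u * word_class rel v)%g.
Proof. by rewrite -[RHS]/(presented_mul _ _) presented_mulE. Qed.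

Lemma word_class_inv (T : choiceType) (rel : seq T -> seq T -> Prop) w :
  word_class rel (inverse_word w) = (word_class rel w)^-1.
Proof.
apply: (mulgI (word_class rel w)); rewrite mulgV -word_class_cat.
by apply/word_classP; exact: cat_inverse_word.
Qed.

Lemma positive_word_cat (T : Type) (u v : seq T) :
  positive_word (u ++ v) = positive_word u ++ positive_word v.
Proof. exact: map_cat. Qed.

Section Lift.
Variables (T : choiceType) (rel : seq T -> seq T -> Prop) (H : groupType).
Variable f : T -> H.
Hypothesis f_rel : forall u v, rel u v -> \prod_(x <- u) f x = \prod_(x <- v) f x.

Let letter (x : T * bool) : H := if x.2 then f x.1 else (f x.1)^-1.
Let eval (w : seq (T * bool)) : H := \prod_(x <- w) letter x.

Let eval_eq u v : presentation_eq rel u v -> eval u = eval v.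
Proof.
rewrite /eval; elim=> {u v} //.
- by move=> u v w _ -> _ ->.
- by move=> u u' v v' _ IH1 _ IH2; rewrite !big_cat /= IH1 IH2.
- move=> x b; rewrite !big_cons big_nil /letter /=.
  by case: b; rewrite /= mulg1 ?mulgV ?mulVg.
- by move=> u v /f_rel uv; rewrite !big_map.
Qed.

Definition presented_lift (x : presented_group rel) : H := eval (repr x).

Lemma lift_word w : presented_lift (word_class rel w) = eval w.
Proof. by apply: eval_eq; exact: repr_word_class. Qed.

Lemma lift_positive w : presented_lift (word_class rel (positive_word w)) = \prod_(x <- w) f x.
Proof. by rewrite lift_word /eval big_map. Qed.

Lemma lift_gen x : presented_lift (word_class rel [:: (x, true)]) = f x.
Proof. by rewrite lift_word /eval big_seq1. Qed.

Lemma liftM : {morph presented_lift : x y / x * y}.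
Proof.
move=> x y; rewrite -(word_class_repr x) -(word_class_repr y) -word_class_cat.
by rewrite !lift_word /eval big_cat.
Qed.

End Lift.

Lemma presented_ind (T : choiceType) (rel : seq T -> seq T -> Prop)
    (P : presented_group rel -> Prop) :
  P 1 -> (forall x b y, P y -> P (word_class rel [:: (x, b)] * y)) ->
  forall y, P y.
Proof.
move=> P1 PM y; rewrite -(word_class_repr y).
elim: (repr y) => [|[x b] w IH]; first exact: P1.
by rewrite -cat1s word_class_cat; exact: PM.
Qed.

Lemma word_class_neg (T : choiceType) (rel : seq T -> seq T -> Prop) x :
  word_class rel [:: (x, false)] = (word_class rel [:: (x, true)])^-1.
Proof. by rewrite -word_class_inv. Qed.

Lemma hom_ext (T : choiceType) (rel : seq T -> seq T -> Prop) (H : groupType)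
    (f h : presented_group rel -> H) :
  {morph f : x y / x * y} -> {morph h : x y / x * y} ->
  (forall x, f (word_class rel [:: (x, true)]) = h (word_class rel [:: (x, true)])) ->
  f =1 h.
Proof.
have k1 (k : presented_group rel -> H) : {morph k : x y / x * y} -> k 1 = 1.
  by move=> kM; apply: (mulgI (k 1)); rewrite -kM !mulg1.
have kV (k : presented_group rel -> H) x : {morph k : x y / x * y} -> k x^-1 = (k x)^-1.
  by move=> kM; apply: (mulgI (k x)); rewrite -kM !mulgV k1.
move=> fM hM fh; apply: presented_ind => [|x b y IH]; first by rewrite !k1.
by rewrite fM hM IH; case: b; rewrite ?word_class_neg ?kV // fh.
Qed.

Lemma morph_one (G H : groupType) (f : G -> H) : {morph f : x y / x * y} -> f 1 = 1.
Proof. by move=> fM; apply: (mulgI (f 1)); rewrite -fM !mulg1. Qed.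

Lemma isomorphicI (G H : groupType) (f : G -> H) :
  {morph f : x y / x * y} -> bijective f -> isomorphic G H.
Proof.
move=> fM bf; pose F := isMultiplicative.Build G H f fM.
pose f' : {multiplicative G -> H} := HB.pack f F.
by exists f'.
Qed.

Section Alternating.
Variables (T : Type).
Implicit Types s t : T.

Lemma size_alternating k s t : size (alternating_word k s t) = k.
Proof. by elim: k s t => //= k IH s t; rewrite IH. Qed.

Lemma alternating_cat j k s t : (j <= k)%N ->
  exists s' t' : T, alternating_word k s t =
    alternating_word j s t ++ alternating_word (k - j) s' t'.
Proof.
elim: j k s t => [|j IH] k s t; first by exists s, t; rewrite subn0.
case: k => [//|k]; rewrite subSS /=.
by rewrite ltnS => /(IH _ t s) [s' [t' ->]]; exists s', t'.
Qed.

Lemma foldr_alternating (U : Type) (F : T -> U -> U) s t k :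
  (forall x, F s (F s x) = x) -> (forall x, F t (F t x) = x) ->
  (forall x, iter k (F s \o F t) x = x) ->
  forall x, foldr F x (alternating_word k s t) = foldr F x (alternating_word k t s).
Proof.
move=> Fs Ft.
have swap j (a b : T) x : (forall x, F a (F a x) = x) -> (forall x, F b (F b x) = x) ->
    foldr F x (alternating_word j a b) =
    iter j (F a \o F b) (foldr F x (alternating_word j b a)).
  move=> Fa Fb; elim: j a b x Fa Fb => [//|j IH] a b x Fa Fb.
  have -> : foldr F x (alternating_word j.+1 a b) =
    F a (foldr F x (alternating_word j b a)) by [].
  have -> : foldr F x (alternating_word j.+1 b a) =
    F b (foldr F x (alternating_word j a b)) by [].
  rewrite IH //; move: (foldr _ _ _) => y; rewrite iterS /=; congr (F a _).
  elim: j {IH} => [|j IHj] /=; first by rewrite Fb.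
  by rewrite IHj.
by move=> h x; rewrite swap // h.
Qed.

End Alternating.

Lemma alternating_map (T U : Type) (f : T -> U) k s t :
  map f (alternating_word k s t) = alternating_word k (f s) (f t).
Proof. by elim: k s t => //= k IH s t; rewrite IH. Qed.

Lemma alternating_sub (T : eqType) k (s t : T) x :
  x \in alternating_word k s t -> x \in [:: s; t].
Proof.
elim: k s t => //= k IH s t; rewrite !inE => /orP[/eqP->|/IH].
  by rewrite eqxx.
by rewrite !inE orbC.
Qed.

(** For involutions the two alternating words of length k differ by the factor (st)^k, so the braid
    relation amounts to (st)^k = 1. *)
Lemma prod_alternating (G : groupType) (T : Type) (f : T -> G) s t k :
  f s * f s = 1 -> f t * f t = 1 ->
  \prod_(x <- alternating_word k s t) f x =
  (f s * f t) ^+ k * \prod_(x <- alternating_word k t s) f x.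
Proof.
elim: k s t => [|k IH] s t ss tt; first by rewrite /= !big_nil mul1g.
rewrite /= !big_cons [in LHS](IH t s) // expgS.
have -> : (f s * f t * (f s * f t) ^+ k) = f s * ((f t * f s) ^+ k * f t).
  rewrite -mulgA; congr (_ * _).
  elim: (k) => [|j IHj]; first by rewrite !expg0 mulg1 mul1g.
  by rewrite !expgS -!mulgA -IHj.
by rewrite -!mulgA [f t * (f t * _)]mulgA tt mul1g.
Qed.

(** * Coxeter groups *)

Section Coxeter.
Variables (T : finType) (m : coxeter_matrix T).
Local Notation W := (coxeter_group m).

Definition cox_gen (s : T) : W := word_class (coxeter_rel m) [:: (s, true)].
Local Notation g := cox_gen.
Definition cox_prod (u : seq T) : W := \prod_(s <- u) g s.
Local Notation wp := cox_prod.

Lemma cox_prod_cat u v : wp (u ++ v) = wp u * wp v.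
Proof. exact: big_cat. Qed.

Lemma cox_prod_cons s u : wp (s :: u) = g s * wp u.
Proof. exact: big_cons. Qed.

Lemma cox_prod_rcons u s : wp (rcons u s) = wp u * g s.
Proof. by rewrite -cats1 cox_prod_cat /cox_prod big_seq1. Qed.

Lemma cox_prod1 s : wp [:: s] = g s.
Proof. exact: big_seq1. Qed.

Lemma cox_prod_nil : wp [::] = 1.
Proof. exact: big_nil. Qed.

Lemma cox_prodE u : wp u = word_class (coxeter_rel m) (positive_word u).
Proof.
elim: u => [|s u IH]; first by rewrite /cox_prod big_nil.
by rewrite cox_prod_cons IH -word_class_cat.
Qed.

Lemma cox_gen2 s : g s * g s = 1.
Proof.
rewrite -word_class_cat; apply/word_classP.
have := @presentation_rel _ (coxeter_rel m) [:: s; s] [::].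
by apply; right; exists s.
Qed.

Lemma cox_genK s x : g s * (g s * x) = x.
Proof. by rewrite mulgA cox_gen2 mul1g. Qed.

Lemma cox_genKr s x : x * g s * g s = x.
Proof. by rewrite -mulgA cox_gen2 mulg1. Qed.

Lemma cox_genV s : (g s)^-1 = g s.
Proof. by apply: mulg1_eq; exact: cox_gen2. Qed.

Lemma cox_prod_rev u : wp (rev u) = (wp u)^-1.
Proof.
elim: u => [|s u IH]; first by rewrite /cox_prod big_nil invg1.
by rewrite rev_cons cox_prod_rcons cox_prod_cons invgM IH cox_genV.
Qed.

Lemma cox_prod_surj (w : W) : exists u, wp u = w.
Proof.
elim/presented_ind: w => [|s b w [u <-]]; first by exists [::]; exact: big_nil.
exists (s :: u); rewrite cox_prod_cons; congr (_ * _).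
by case: b; rewrite // word_class_neg -/(g s) cox_genV.
Qed.

Lemma cox_alternating s t k : s != t -> m s t = Some k ->
  wp (alternating_word k s t) = wp (alternating_word k t s).
Proof.
move=> st mst; rewrite !cox_prodE; apply/word_classP.
by apply: presentation_rel; left; exists s, t, k.
Qed.

Lemma cox_order_dvd s t k : s != t -> m s t = Some k -> (g s * g t) ^+ k = 1.
Proof.
move=> st mst; have := cox_alternating st mst.
rewrite /cox_prod prod_alternating ?cox_gen2 // => h.
by apply: (mulIg (\prod_(x <- alternating_word k t s) g x)); rewrite h mul1g.
Qed.

Section Action.
Variables (U : Type) (F : T -> U -> U).
Hypothesis F_invol : forall s x, F s (F s x) = x.
Hypothesis F_order : forall s t k, s != t -> m s t = Some k ->
  forall x, iter k (F s \o F t) x = x.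

Lemma cox_action u v : wp u = wp v -> forall x, foldr F x u = foldr F x v.
Proof.
(* Signs are forgotten: [F s] is an involution, so a letter and its inverse act alike. *)
pose act (w : seq (T * bool)) x := foldr (fun a => F a.1) x w.
have act_eq w w' : presentation_eq (coxeter_rel m) w w' -> forall x, act w x = act w' x.
  rewrite /act; elim=> {w w'} //.
  - by move=> w1 w2 w3 _ IH1 _ IH2 x; rewrite IH1.
  - by move=> w1 w2 w3 w4 _ IH1 _ IH2 x; rewrite !foldr_cat IH1 IH2.
  - by move=> s b x /=; rewrite F_invol.
  - move=> w w' ww' x; rewrite !foldr_map.
    case: ww' => [[s [t [k [st mst -> ->]]]]|[s [-> ->]]] /=; last exact: F_invol.
    by apply: foldr_alternating => //; exact: F_order.
rewrite !cox_prodE => /word_classP h x.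
by have := act_eq _ _ h x; rewrite /act !foldr_map.
Qed.

End Action.

(** * The geometric representation *)

Section Reflection.
Local Open Scope ring_scope.
Local Notation C := algC.

(* 2 cos (pi / k) = e + e^-1 for e a primitive 2k-th root of unity; the entry infinity gives 2. *)
Definition dihedral_root (k : nat) : C := if k is k'.+1 then
  sval (C_prim_root_exists (isT : 0 < (2 * k'.+1)%N)%N) else 1.

Lemma dihedral_rootP k : (0 < k)%N -> (2 * k).-primitive_root (dihedral_root k).
Proof. by case: k => //= k _; case: (C_prim_root_exists _). Qed.

Definition cartan (s t : T) : C :=
  if m s t is Some k then dihedral_root k + (dihedral_root k)^-1 else 2.

(** The reflection in the simple root s, in coordinates with respect to the simple roots. *)
Definition reflect_fun (s : T) (v : T -> C) : T -> C := fun u =>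
  if u == s then - v s + \sum_(a | a != s) cartan s a * v a else v u.

Lemma reflect_invol s v : reflect_fun s (reflect_fun s v) = v.
Proof.
apply: funext => u; rewrite /reflect_fun; case: eqP => // ->; rewrite eqxx.
rewrite opprD opprK -addrA [X in _ + X](_ : _ = 0) ?addr0 //.
apply/eqP; rewrite addrC subr_eq0; apply/eqP; apply: eq_bigr => a.
by move=> /negPf ->.
Qed.

Lemma reflect_pair s t v : s != t ->
  let A := \sum_(a | (a != s) && (a != t)) cartan s a * v a in
  let B := \sum_(a | (a != t) && (a != s)) cartan t a * v a in
  let y := - v t + cartan s t * v s + B in
  reflect_fun s (reflect_fun t v) = fun u =>
    if u == s then - v s + cartan s t * y + A else if u == t then y else v u.
Proof.
move=> st A B y; have ts : t != s by rewrite eq_sym.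
apply: funext => u; rewrite /reflect_fun (negPf st).
have -> : \sum_(a | a != t) cartan t a * v a = cartan s t * v s + B.
  rewrite (bigD1 s) //= /B; congr (_ + _).
  by rewrite /cartan coxeter_sym.
rewrite addrA -/y; case: ifP => // _; rewrite -addrA; congr (_ + _).
rewrite (bigD1 t) //= eqxx; congr (_ + _).
by apply: eq_bigr => a /andP[_ /negPf ->].
Qed.

Lemma iter_reflect s t k (v : T -> C) : s != t -> m s t = Some k ->
  iter k (reflect_fun s \o reflect_fun t) v = v.
Proof.
move=> st mst; have k2 := coxeter_off_diag st mst.
have ts : t != s by rewrite eq_sym.
have prim := dihedral_rootP (ltnW k2).
set e := dihedral_root k in prim.
have ek : e ^+ (2 * k) = 1 by exact: prim_expr_order.
have e0 : e != 0.
  by apply/eqP => e0; move: ek; rewrite e0 expr0n -[_ == _]/(_ == 0%N) muln_eq0 /=;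
    case: (k) k2 => //= ? _ /eqP; rewrite eq_sym oner_eq0.
have ee2 : e * e - 1 != 0.
  by rewrite subr_eq0 -expr2 -(prim_order_dvd prim); apply/negP => /dvdn_leq; lia.
have ee : e - e^-1 != 0.
  apply: contraNN ee2 => /eqP h; have -> : e * e - 1 = (e - e^-1) * e by field.
  by rewrite h mul0r.
set A := \sum_(a | (a != s) && (a != t)) cartan s a * v a.
set B := \sum_(a | (a != t) && (a != s)) cartan t a * v a.
have cE : cartan s t = e + e^-1 by rewrite /cartan mst.
set c := cartan s t in cE *.
(* On the coordinates s and t the product acts by an affine map, since A and B stay constant. Its
   fixed point (p, q) solves 2p - cq = A and 2q - cp = B, of determinant 4 - c^2 = d, and around it
   the eigenvalues are e^2 and e^-2. [G] is the resulting closed form of the iterates, with [al] and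
   [be] fitted to v; it returns after k steps because e^(2k) = 1. *)
pose d := - (e - e^-1) ^+ 2.
pose p := (A *+ 2 + c * B) / d; pose q := (B *+ 2 + c * A) / d.
pose al := ((v s - p) - e^-1 * (v t - q)) / (e - e^-1).
pose be := (e * (v t - q) - (v s - p)) / (e - e^-1).
have d0 : d != 0 by rewrite oppr_eq0 sqrf_eq0.
pose G j u := if u == s then p + al * e ^+ (2 * j).+1 + be / e ^+ (2 * j).+1
  else if u == t then q + al * e ^+ (2 * j) + be / e ^+ (2 * j) else v u.
have GS j : reflect_fun s (reflect_fun t (G j)) = G j.+1.
  rewrite reflect_pair //=.
  have -> : \sum_(a | (a != s) && (a != t)) cartan s a * G j a = A.
    by apply: eq_bigr => a /andP[as_ at_]; rewrite /G (negPf as_) (negPf at_).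
  have -> : \sum_(a | (a != t) && (a != s)) cartan t a * G j a = B.
    by apply: eq_bigr => a /andP[as_ at_]; rewrite /G (negPf as_) (negPf at_).
  rewrite -/c cE; apply: funext => u; rewrite /G !eqxx (negPf ts).
  have -> : (2 * j.+1)%N = (2 * j).+2 by lia.
  rewrite !exprS; have := expf_neq0 (2 * j) e0; move: (e ^+ (2 * j)) => x x0.
  have AE : A = p *+ 2 - (e + e^-1) * q.
    by rewrite /p /q /d cE; field; rewrite e0.
  have BE : B = q *+ 2 - (e + e^-1) * p.
    by rewrite /p /q /d cE; field; rewrite e0.
  rewrite AE BE.
  case: (u == s); first by field; rewrite x0.
  by case: (u == t) => //; field; rewrite x0.
have G0 : G 0%N = v.
  apply: funext => u; rewrite /G muln0 expr0 expr1 /al /be.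
  case: eqP => [->|_]; first by field; rewrite e0.
  by case: eqP => [->|//]; field; rewrite e0.
have Giter j : iter j (reflect_fun s \o reflect_fun t) v = G j.
  by elim: j => [|j IH] //=; rewrite IH GS.
rewrite Giter -[RHS]G0; apply: funext => u; rewrite /G muln0 !exprS expr0 ek.
by [].
Qed.

End Reflection.
End Coxeter.

Section CoxeterOrder.
Variables (T : finType) (m : coxeter_matrix T).
Local Notation W := (coxeter_group m).
Local Notation g := (cox_gen m).
Local Notation wp := (cox_prod m).

Section Order.
Local Open Scope ring_scope.

Let pairv (s t : T) (a b : algC) : T -> algC :=
  fun u => if u == s then a else if u == t then b else 0.

Let reflect_pairv s t a b : s != t -> let y := cartan m s t * a - b in
  reflect_fun m s (reflect_fun m t (pairv s t a b)) =
  pairv s t (cartan m s t * y - a) y.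
Proof.
move=> st y; have ts : t != s by rewrite eq_sym.
rewrite reflect_pair //= /pairv !eqxx (negPf ts) !big1 ?addr0.
- rewrite [- b + _]addrC [- a + _]addrC -/y.
  by apply/funext => u; case: (u == s) => //; case: (u == t).
- by move=> a0 /andP[/negPf -> /negPf ->]; rewrite mulr0.
- by move=> a0 /andP[/negPf -> /negPf ->]; rewrite mulr0.
Qed.

(** The geometric representation separates the powers of st. An eigenvector for e^2 gives e^(2j) =
    1, so that 2k divides 2j; for an infinite entry st is unipotent and the coordinates 2i + 1, 2i
    of the iterates grow. *)
Lemma cox_order s t j : s != t -> (0 < j)%N -> ((g s * g t) ^+ j = 1)%g ->
  exists2 k, m s t = Some k & (k <= j)%N.
Proof.
move=> st j0 gj.
pose u := flatten (nseq j [:: s; t]).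
have wu : wp u = wp [::].
  rewrite cox_prod_nil -gj /u; elim: {j0 gj} j @u => [|j IH] u; first by rewrite expg0 cox_prod_nil.
  by rewrite /u /= !cox_prod_cons IH expgS mulgA.
have iterE v : iter j (reflect_fun m s \o reflect_fun m t) v = v.
  have it i : foldr (reflect_fun m) v (flatten (nseq i [:: s; t])) =
      iter i (reflect_fun m s \o reflect_fun m t) v by elim: i => //= i ->.
  rewrite -it; apply: (cox_action (@reflect_invol _ m) _ wu v).
  by move=> a b k ab mab x; exact: iter_reflect.
have step a b := reflect_pairv a b st.
case mst: (m s t) => [k|].
  exists k => //; have k2 := coxeter_off_diag st mst.
  have prim := dihedral_rootP (ltnW k2); set e := dihedral_root k in prim.
  have e0 : e != 0.
    apply/eqP => e0; have := prim_expr_order prim.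
    rewrite e0 expr0n -[_ == _]/(_ == 0%N) muln_eq0 /=.
    by case: (k) k2 => //= ? _ /eqP; rewrite eq_sym oner_eq0.
  have it i : iter i (reflect_fun m s \o reflect_fun m t) (pairv s t e 1) =
      pairv s t (e ^+ (2 * i).+1) (e ^+ (2 * i)).
    elim: i => [|i IH]; first by rewrite muln0 expr0 expr1.
    rewrite iterS IH /= step /cartan mst -/e (_ : 2 * i.+1 = (2 * i).+2)%N; last by lia.
    by congr (pairv s t _ _); rewrite !exprS; field; rewrite e0.
  have := iterE (pairv s t e 1); rewrite it => /(congr1 (@^~ t)).
  rewrite /pairv eqxx eq_sym (negPf st) => /eqP; rewrite -(prim_order_dvd prim).
  by move=> /dvdn_leq; lia.
have it i : iter i (reflect_fun m s \o reflect_fun m t) (pairv s t 1 0) =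
    pairv s t ((2 * i).+1)%:R (2 * i)%:R.
  elim: i => [|i IH]; first by rewrite muln0.
  rewrite iterS IH /= step /cartan mst (_ : 2 * i.+1 = (2 * i).+2)%N; last by lia.
  by congr (pairv s t _ _); rewrite -!natr1; ring.
have := iterE (pairv s t 1 0); rewrite it => /(congr1 (@^~ t)).
rewrite /pairv eqxx eq_sym (negPf st) => /eqP; rewrite Num.Theory.pnatr_eq0.
by move=> /eqP; lia.
Qed.

End Order.

(** * Length and the exchange condition *)

Fact len_ex (w : W) : exists n, `[< exists u, size u = n /\ wp u = w >].
Proof.
have [u uw] := cox_prod_surj w.
by exists (size u); apply/asboolP; exists u.
Qed.

Definition len (w : W) : nat := ex_minn (len_ex w).

Lemma len_le u : (len (wp u) <= size u)%N.
Proof.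
rewrite /len; case: ex_minnP => n _; apply.
by apply/asboolP; exists u.
Qed.

Lemma len_word w : exists u, size u = len w /\ wp u = w.
Proof. by rewrite /len; case: ex_minnP => n /asboolP. Qed.

Definition reduced u := len (wp u) == size u.

Lemma reduced_word w : exists2 u, reduced u & wp u = w.
Proof. by have [u [us uw]] := len_word w; exists u => //; rewrite /reduced uw us. Qed.

Lemma lenV w : len w^-1 = len w.
Proof.
have le x : (len x^-1 <= len x)%N.
  have [u [us uw]] := len_word x.
  by rewrite -us -uw -cox_prod_rev -(size_rev u) len_le.
by apply/eqP; rewrite eqn_leq le -{1}(invgK w) le.
Qed.

Lemma len1 : len 1 = 0.
Proof. by have := len_le [::]; rewrite cox_prod_nil leqn0 => /eqP. Qed.

Lemma len_eq0 w : len w = 0 -> w = 1.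
Proof.
by have [u [<- <-]] := len_word w => /size0nil ->; rewrite cox_prod_nil.
Qed.

Lemma lenM x y : (len (x * y) <= len x + len y)%N.
Proof.
have [u [<- ux]] := len_word x; have [v [<- vy]] := len_word y.
by rewrite -ux -vy -size_cat -cox_prod_cat len_le.
Qed.

Lemma len_gen_le s : (len (g s) <= 1)%N.
Proof. by rewrite -cox_prod1; exact: (len_le [:: s]). Qed.

(* The boolean records, modulo 2, how often an element occurs among the reflections attached to a
   word; this number only depends on the class of the word, whence the exchange condition. *)
Definition cocycle_fun (s : T) (x : W * bool) : W * bool :=
  (g s * x.1 * g s, x.2 (+) (x.1 == g s)).

Lemma cocycle_invol s x : cocycle_fun s (cocycle_fun s x) = x.
Proof.
case: x => x b; rewrite /cocycle_fun /=; congr (_, _).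
  by rewrite !mulgA cox_gen2 mul1g cox_genKr.
have -> : (g s * x * g s == g s) = (x == g s).
  apply/eqP/eqP => [h|->]; last by rewrite cox_gen2 mul1g.
  have := congr1 (fun y => g s * y * g s) h.
  by rewrite !mulgA cox_gen2 !mul1g cox_genKr.
by rewrite -addbA addbb addbF.
Qed.

Lemma iter_cocycle s t k : s != t -> m s t = Some k ->
  forall x, iter k (cocycle_fun s \o cocycle_fun t) x = x.
Proof.
move=> st mst [x b]; pose p := g s * g t.
have pV : p^-1 = g t * g s by rewrite invgM !cox_genV.
have tp1 : g t * p = p^-1 * g t by rewrite pV mulgA.
have tp j : g t * p ^+ j = p^-1 ^+ j * g t.
  elim: j => [|j IH]; first by rewrite !expg0 mulg1 mul1g.
  by rewrite expgS mulgA tp1 -mulgA IH expgS mulgA.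
have conj j z : (p ^+ j * x * p ^- j == z) = (x == p ^- j * z * p ^+ j).
  by apply/eqP/eqP => [<-|->]; rewrite !gnorm.
(* The reflections attached to (st)^j are p^-i t for i < 2j. For j = k they repeat with period k
   because p^k = 1, so each element is hit an even number of times. *)
pose hit i := x == p ^- i * g t.
have it j : iter j (cocycle_fun s \o cocycle_fun t) (x, b) =
    (p ^+ j * x * p ^- j, b (+) \big[addb/false]_(0 <= i < 2 * j) hit i).
  elim: j => [|j IH].
    by rewrite muln0 big_nil addbF expg0 invg1 mul1g mulg1.
  rewrite iterS IH /cocycle_fun /= -!addbA; congr (_, _).
    by rewrite expgS invgM pV !mulgA.
  congr (_ (+) _); rewrite (_ : 2 * j.+1 = (2 * j).+2)%N; last by lia.
  rewrite !big_nat_recr //= -addbA; congr (_ (+) (_ (+) _)).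
    by rewrite conj /hit -!expVgn -mulgA tp mulgA -expgnDr mul2n addnn.
  have -> : (g t * (p ^+ j * x * p ^- j) * g t == g s) =
      (p ^+ j * x * p ^- j == p^-1 * g t).
    rewrite pV; apply/eqP/eqP => [<-|->]; last by rewrite !mulgA cox_gen2 mul1g cox_genKr.
    by rewrite !mulgA cox_gen2 mul1g cox_genKr.
  rewrite conj /hit -!expVgn -!mulgA tp !mulgA -expgSr -expgnDr; congr (_ == _ ^+ _ * _).
  by lia.
rewrite it; congr (_, _).
  by rewrite cox_order_dvd // invg1 mul1g mulg1.
rewrite mul2n -addnn (@big_cat_nat _ _ _ k) ?leq_addr //=.
rewrite -{2}[k]add0n big_addn addnK.
have -> : \big[addb/false]_(0 <= i < k) hit (i + k)%N =
    \big[addb/false]_(0 <= i < k) hit i.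
  apply: eq_bigr => i _.
  by rewrite /hit -!expVgn expgnDr [_ ^+ k]expVgn cox_order_dvd // invg1 mulg1.
by rewrite addbb addbF.
Qed.

Let cocycle_word u (x : W) := (foldr cocycle_fun (x, false) u).2.

Let foldr_cocycle u x b : foldr cocycle_fun (x, b) u =
  (wp u * x * (wp u)^-1, b (+) cocycle_word u x).
Proof.
elim: u b => [|s u IH] b.
  by rewrite cox_prod_nil invg1 mul1g mulg1 addbF.
rewrite [in RHS]/cocycle_word /= (IH b) (IH false) /cocycle_fun /=.
by rewrite cox_prod_cons invgM cox_genV !mulgA addbA.
Qed.

Let cocycle_wordE u v x : wp u = wp v -> cocycle_word u x = cocycle_word v x.
Proof.
move=> uv; rewrite /cocycle_word (@cox_action _ m _ cocycle_fun _ _ u v) //.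
  exact: cocycle_invol.
exact: iter_cocycle.
Qed.

Let inversion (w x : W) : bool := cocycle_word (sval (cid (cox_prod_surj w))) x.

Let inversionE u x : inversion (wp u) x = cocycle_word u x.
Proof. by apply: cocycle_wordE; case: (cid _). Qed.

Let inversion_gen w s : inversion (w * g s) (g s) = ~~ inversion w (g s).
Proof.
have [u <-] := cox_prod_surj w.
rewrite -cox_prod_rcons !inversionE /cocycle_word -cats1 foldr_cat /=.
rewrite -[cocycle_fun s _]/(g s * g s * g s, false (+) (g s == g s)).
by rewrite cox_gen2 mul1g eqxx foldr_cocycle.
Qed.

Let inversion_exchange u x : inversion (wp u) x ->
  exists u1 r u2, u = u1 ++ r :: u2 /\ wp u * x = wp (u1 ++ u2).
Proof.
rewrite inversionE; elim: u => [//|s u IH].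
rewrite {1}/cocycle_word /= foldr_cocycle /=.
have [/IH [u1 [r [u2 [-> e]]]] _|_] := boolP (cocycle_word u x).
  by exists (s :: u1), r, u2; split => //; rewrite cox_prod_cons -mulgA e -cox_prod_cons.
move=> /eqP e; exists [::], s, u; split => //=.
rewrite cox_prod_cons -mulgA -[wp u * x](mulgVK (wp u)) e.
by rewrite mulgA cox_gen2 mul1g.
Qed.

Definition rdesc w s := (len (w * g s) < len w)%N.
Definition ldesc w s := (len (g s * w) < len w)%N.

(** If the parity is odd, exchange shortens w s. If it is even, it is odd for w s, so that w s s = w
    is shorter than w s. *)
Let rdesc_inversion w s : rdesc w s = inversion w (g s).
Proof.
have lt x : inversion x (g s) -> (len (x * g s) < len x)%N.
  have [u ru <-] := reduced_word x => /inversion_exchange [u1 [r [u2 [uE ->]]]].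
  rewrite (eqP ru) uE; apply: leq_ltn_trans (len_le _) _.
  by rewrite !size_cat /= addnS.
apply/idP/idP => [h|/lt //]; apply/negPn/negP.
rewrite -inversion_gen => /lt; rewrite cox_genKr => h'.
by have := ltn_trans h h'; rewrite ltnn.
Qed.

Lemma rdesc_exchange u s : rdesc (wp u) s ->
  exists u1 r u2, u = u1 ++ r :: u2 /\ wp u * g s = wp (u1 ++ u2).
Proof. by rewrite rdesc_inversion; exact: inversion_exchange. Qed.

Lemma rdesc_mul w s : rdesc (w * g s) s = ~~ rdesc w s.
Proof. by rewrite !rdesc_inversion inversion_gen. Qed.

Lemma len_mul_gen w s : len (w * g s) = if rdesc w s then (len w).-1 else (len w).+1.
Proof.
have le := lenM w (g s); have le' := lenM (w * g s) (g s); have ls := len_gen_le s.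
have := rdesc_mul w s; rewrite /rdesc cox_genKr in le' *.
move: (len (w * g s)) (len w) (len (g s)) le le' ls => a b c.
by case: (ltnP a b) => ab; case: (ltnP b a) => //= ba; lia.
Qed.

Lemma ldescV w s : ldesc w^-1 s = rdesc w s.
Proof. by rewrite /ldesc /rdesc -lenV invgM invgK cox_genV lenV. Qed.

Lemma rdescV w s : rdesc w^-1 s = ldesc w s.
Proof. by rewrite -ldescV invgK. Qed.

Lemma ldesc_mul w s : ldesc (g s * w) s = ~~ ldesc w s.
Proof. by rewrite -[_ * w]invgK ldescV invgM cox_genV rdesc_mul rdescV. Qed.

Lemma len_gen_mul w s : len (g s * w) = if ldesc w s then (len w).-1 else (len w).+1.
Proof. by rewrite -lenV invgM cox_genV len_mul_gen rdescV lenV. Qed.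

Lemma ldesc_len w s : ldesc w s -> len w = (len (g s * w)).+1.
Proof. by move=> h; rewrite len_gen_mul h prednK //; move: h; rewrite /ldesc; lia. Qed.

Lemma rdesc_len w s : rdesc w s -> len w = (len (w * g s)).+1.
Proof. by move=> h; rewrite len_mul_gen h prednK //; move: h; rewrite /rdesc; lia. Qed.

Lemma ldesc_exchange u s : ldesc (wp u) s ->
  exists u1 r u2, u = u1 ++ r :: u2 /\ g s * wp u = wp (u1 ++ u2).
Proof.
rewrite -rdescV -cox_prod_rev => /rdesc_exchange [u1 [r [u2 [uE e]]]].
exists (rev u2), r, (rev u1); split.
  by rewrite -[u]revK uE rev_cat rev_cons cat_rcons.
by rewrite -rev_cat cox_prod_rev -e invgM cox_prod_rev invgK cox_genV.
Qed.

Lemma len_gen s : len (g s) = 1%N.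
Proof. by rewrite -[g s]mulg1 len_gen_mul /ldesc mulg1 len1. Qed.

Lemma deletion u : exists u', [/\ subseq u' u, reduced u' & wp u' = wp u].
Proof.
elim/last_ind: u => [|u s [u' [uu' ru' eu]]].
  by exists [::]; rewrite /reduced cox_prod_nil len1.
have [d|nd] := boolP (rdesc (wp u') s); last first.
  exists (rcons u' s); split; first by rewrite -!cats1 cat_subseq.
    by rewrite /reduced cox_prod_rcons len_mul_gen (negPf nd) size_rcons (eqP ru').
  by rewrite !cox_prod_rcons eu.
have [u1 [r [u2 [u'E e]]]] := rdesc_exchange d.
exists (u1 ++ u2); split.
- apply: subseq_trans (subseq_rcons _ _); apply: subseq_trans uu'.
  by rewrite u'E cat_subseq // subseq_cons.
- rewrite /reduced -e; have := rdesc_len d; rewrite (eqP ru') u'E !size_cat /= addnS.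
  by move=> [->].
- by rewrite -e cox_prod_rcons eu.
Qed.

End CoxeterOrder.

Lemma cat_eq_split (U : Type) (u v u1 u2 : seq U) r : u ++ v = u1 ++ r :: u2 ->
  (exists u', u = u1 ++ r :: u' /\ u2 = u' ++ v) \/
  (exists v', v = v' ++ r :: u2 /\ u1 = u ++ v').
Proof.
elim: u u1 => [|a u IH] [|b u1] /=.
- by move=> ->; right; exists [::].
- by move=> ->; right; exists (b :: u1).
- by move=> [-> <-]; left; exists u.
by move=> [-> /IH [[u' [-> ->]]|[v' [-> ->]]]]; [left; exists u'|right; exists v'].
Qed.

(** * Parabolic subgroups and minimal coset representatives *)

Section Cosets.
Variables (T : finType) (m : coxeter_matrix T).
Local Notation W := (coxeter_group m).
Local Notation g := (cox_gen m).
Local Notation wp := (cox_prod m).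
Implicit Types (X : {set T}) (w x y : W) (s t : T) (u v : seq T).

Lemma reduced_cons s u : reduced m (s :: u) = reduced m u && ~~ ldesc (wp u) s.
Proof.
rewrite /reduced cox_prod_cons len_gen_mul /=; have := len_le m u.
case d: (ldesc _ _) => /=; last by rewrite eqSS andbT.
by rewrite andbF => h; apply/eqP; have := ldesc_len d; lia.
Qed.

Lemma reduced_nil : reduced m [::].
Proof. by rewrite /reduced cox_prod_nil len1. Qed.

(** Length-additive products are the ones that the lift [simple] to A preserves. *)
Definition add x y := len (x * y) == (len x + len y)%N.

Lemma addE x y : add x y -> len (x * y) = (len x + len y)%N.
Proof. by move/eqP. Qed.

Lemma add1l y : add 1 y.
Proof. by rewrite /add mul1g len1. Qed.

Lemma add1r y : add y 1.
Proof. by rewrite /add mulg1 len1 addn0. Qed.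

Lemma addV x y : add y^-1 x^-1 = add x y.
Proof. by rewrite /add -invgM !lenV addnC. Qed.

(** Both sides say that the length of xyz is the sum of the three lengths. *)
Lemma add_assoc x y z : add x y && add (x * y) z = add y z && add x (y * z).
Proof.
rewrite /add -mulgA; have := lenM x y; have := lenM y z.
have := lenM (x * y) z; have := lenM x (y * z); rewrite -mulgA.
move: (len x) (len y) (len z) (len (x * y)) (len (y * z)) (len (x * (y * z))) => a b c d e f.
by move=> *; apply/andP/andP => -[/eqP ? /eqP ?]; split; apply/eqP; lia.
Qed.

Lemma add_ldesc x y s : add x y -> ldesc x s -> ldesc (x * y) s.
Proof.
move=> /addE xy d; rewrite /ldesc mulgA xy; apply: leq_ltn_trans (lenM _ _) _.
by rewrite ltn_add2r.
Qed.

Lemma add_rdesc x y s : add x y -> rdesc y s -> rdesc (x * y) s.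
Proof. by rewrite -addV -!ldescV invgM; exact: add_ldesc. Qed.

Lemma add_gen_l s y : add (g s) y = ~~ ldesc y s.
Proof.
rewrite /add len_gen_mul len_gen; case d: (ldesc _ _) => /=; last by rewrite eqxx.
by rewrite (ldesc_len d) /=; apply/eqP; lia.
Qed.

Lemma add_gen_r s y : add y (g s) = ~~ rdesc y s.
Proof. by rewrite -addV cox_genV add_gen_l ldescV. Qed.

Definition par X w := exists2 u, all (mem X) u & wp u = w.

Lemma par1 X : par X 1.
Proof. by exists [::] => //; exact: cox_prod_nil. Qed.

Lemma par_gen X s : s \in X -> par X (g s).
Proof. by move=> sX; exists [:: s]; rewrite /= ?sX ?cox_prod1. Qed.

Lemma par_mul X x y : par X x -> par X y -> par X (x * y).
Proof.
move=> [u uX <-] [v vX <-]; exists (u ++ v); last exact: cox_prod_cat.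
by rewrite all_cat uX.
Qed.

Lemma par_inv X x : par X x -> par X x^-1.
Proof. by move=> [u uX <-]; exists (rev u); rewrite ?all_rev ?cox_prod_rev. Qed.

Lemma par_setT x : par [set: T] x.
Proof. by have [u <-] := cox_prod_surj x; exists u => //; apply/allP => a _; rewrite /= inE. Qed.

Lemma par_sub (X Y : {set T}) x : X \subset Y -> par X x -> par Y x.
Proof.
move=> /fintype.subsetP XY [u /allP uX <-]; exists u => //.
by apply/allP => a /uX /XY.
Qed.

Lemma par_reduced X w : par X w ->
  exists u, [/\ all (mem X) u, reduced m u & wp u = w].
Proof.
move=> [u uX <-]; have [v [vu rv e]] := deletion m u; exists v; split => //.
by apply/allP => a /(mem_subseq vu); exact: (allP uX).
Qed.

Lemma min_coset X w : exists y b, [/\ w = y * b, par X b &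
  forall b', par X b' -> add y b'].
Proof.
have ex : exists n, `[< exists b, par X b /\ len (w * b) = n >].
  by exists (len w); apply/asboolP; exists 1; rewrite mulg1; split => //; exact: par1.
pose n := ex_minn ex.
have [b [bX bn]] : exists b, par X b /\ len (w * b) = n.
  by rewrite /n; case: ex_minnP => k /asboolP.
have n_min b' : par X b' -> (n <= len (w * b'))%N.
  move=> b'X; rewrite /n; case: ex_minnP => k _; apply.
  by apply/asboolP; exists b'.
exists (w * b), b^-1; split; [by rewrite mulgK|exact: par_inv|].
move=> b' /par_reduced [v [vX rv <-]]; move: vX rv.
elim/last_ind: v => [|v s IH]; first by rewrite cox_prod_nil add1r.
rewrite all_rcons => /andP[sX vX] rvs.
have rv : add (wp v) (g s) && reduced m v.
  rewrite /add /reduced -cox_prod_rcons len_gen (eqP rvs) size_rcons.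
  have := len_le m v; have := lenM (wp v) (g s).
  by rewrite -cox_prod_rcons (eqP rvs) size_rcons len_gen; lia.
case/andP: rv => vs rv; have {}IH := IH vX rv.
rewrite cox_prod_rcons; suff : add (w * b) (wp v) && add (w * b * wp v) (g s).
  by rewrite add_assoc => /andP[].
rewrite IH add_gen_r; apply/negP => d.
have [u [ru e]] := reduced_word (w * b).
rewrite -e -cox_prod_cat in d.
have [u1 [r [u2 [uE e']]]] := rdesc_exchange d.
have vX' : par X (wp v) by exists v.
(* A letter deleted from u would give a shorter element of the coset of w; a letter deleted from v
   would give a shorter word for the reduced v s. *)
have [[u' [uE' u2E]]|[v' [vE u1E]]] := cat_eq_split uE.
  have := n_min (b * (wp v * g s * (wp v)^-1)).
  have -> : w * (b * (wp v * g s * (wp v)^-1)) = wp (u1 ++ u').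
    by rewrite !mulgA -e -cox_prod_cat e' u2E catA cox_prod_cat mulgK.
  rewrite leqNgt -bn -e (eqP ru) => /(_ _) /negP; apply.
    by do !apply: par_mul => //; [exact: par_gen|exact: par_inv].
  by apply: leq_ltn_trans (len_le _ _) _; rewrite uE' !size_cat /= addnS.
have : wp (v' ++ u2) = wp (rcons v s).
  apply: (mulgI (wp u)); rewrite -!cox_prod_cat catA -u1E -e' -cats1.
  by rewrite catA [RHS]cox_prod_cat cox_prod1.
move=> /(congr1 (@len _ m)); rewrite (eqP rvs) size_rcons => h.
by have := len_le m (v' ++ u2); rewrite h vE !size_cat /=; lia.
Qed.

Lemma add_par X y b : {in X, forall s, ~~ rdesc y s} -> par X b -> add y b.
Proof.
move=> yX; have [y0 [c [yE cX yadd]]] := min_coset X y.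
suff -> : y = y0 by exact: yadd.
have [u [uX ru cE]] := par_reduced cX.
rewrite yE -cE; case: (lastP u) uX ru cE => [|v s]; first by rewrite cox_prod_nil mulg1.
rewrite all_rcons => /andP[sX vX] rv cE.
have := yX s sX; rewrite yE add_rdesc //; first exact: yadd.
rewrite -cE /rdesc cox_prod_rcons cox_genKr -cox_prod_rcons (eqP rv) size_rcons ltnS.
exact: len_le.
Qed.

Lemma min_coset_l X w : exists b y, [/\ w = b * y, par X b &
  forall b', par X b' -> add b' y].
Proof.
have [y [b [e bX yadd]]] := min_coset X w^-1.
exists b^-1, y^-1; split; [by rewrite -invgM -e invgK|exact: par_inv|].
by move=> b' /par_inv /yadd; rewrite -{1}[y]invgK addV.
Qed.

Lemma reduced_alternating s t u : s != t -> all (mem [:: s; t]) (s :: u) ->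
  reduced m (s :: u) -> s :: u = alternating_word (size u).+1 s t.
Proof.
elim: u s t => [//|a u IH] s t st.
rewrite [all _ _]/= !inE eqxx /= => /andP[/orP[/eqP ->|/eqP ->] au].
  rewrite !reduced_cons => /andP[/andP[ru nd]].
  by rewrite cox_prod_cons ldesc_mul nd.
rewrite reduced_cons => /andP[ru _] /=; congr (_ :: _).
apply: IH => //; rewrite 1?eq_sym //= !inE eqxx /=.
by apply: sub_all au => z; rewrite !inE orbC.
Qed.

Lemma reduced_cat u v : reduced m (u ++ v) -> reduced m u /\ reduced m v.
Proof.
rewrite /reduced cox_prod_cat size_cat => /eqP h.
have := lenM (wp u) (wp v); have := len_le m u; have := len_le m v.
by move=> *; split; apply/eqP; lia.
Qed.

(** With k + 1 letters the braid relation makes the first two letters equal; they cancel, and k - 1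
    letters are left. *)
Lemma reduced_alternating_le s t j k : s != t -> m s t = Some k ->
  reduced m (alternating_word j s t) -> (j <= k)%N.
Proof.
move=> st mst r; rewrite leqNgt; apply/negP => kj.
have [s' [t' e]] := alternating_cat s t kj; rewrite e in r.
have [{}r _] := reduced_cat r.
have k2 := coxeter_off_diag st mst.
have : (len (wp (alternating_word k.+1 s t)) <= k.-1)%N.
  rewrite /= cox_prod_cons -cox_alternating //; case: (k) k2 => // k' _ /=.
  by rewrite cox_prod_cons cox_genK; apply: leq_trans (len_le _ _) _; rewrite size_alternating.
by rewrite (eqP r) size_alternating; lia.
Qed.

(** The component of w in the dihedral group of s and t has both descents, so it is the longest
    element there, that is the join of s and t. Matsumoto's theorem and the lattice arguments rest
    on this. *)
Lemma dihedral_prefix s t w : s != t -> ldesc w s -> ldesc w t ->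
  exists k y, [/\ m s t = Some k, w = wp (alternating_word k s t) * y &
    len w = (k + len y)%N].
Proof.
move=> st ds dt; pose X := [set s; t].
have [b [y [wE bX badd]]] := min_coset_l X w.
have bdesc a : a \in X -> ldesc w a -> ldesc b a.
  move=> aX; apply: contraTT; rewrite -add_gen_l wE => ab.
  rewrite -add_gen_l; have : add (g a * b) y by apply: badd; apply: par_mul => //; exact: par_gen.
  by move=> h; have := add_assoc (g a) b y; rewrite ab h => /esym /andP[].
have {ds} bs : ldesc b s by apply: bdesc ds; rewrite !inE eqxx.
have {dt} bt : ldesc b t by apply: bdesc dt; rewrite !inE eqxx orbT.
have alt a a' : [set a; a'] = X -> a != a' -> ldesc b a ->
    b = wp (alternating_word (len b) a a').
  move=> XE aa' da.
  have : par X (g a * b) by apply: par_mul => //; apply: par_gen; rewrite -XE !inE eqxx.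
  move=> /par_reduced [u [uX ru uE]].
  have bE : wp (a :: u) = b by rewrite cox_prod_cons uE cox_genK.
  have r : reduced m (a :: u).
    by rewrite /reduced bE (ldesc_len da) -uE (eqP ru).
  rewrite -{2}bE (eqP r) -reduced_alternating // ?bE //=.
  by rewrite !inE eqxx; apply: sub_all uX => z; rewrite -XE !inE.
have es := alt s t erefl st bs.
have et : b = wp (alternating_word (len b) t s).
  by apply: alt; rewrite 1?eq_sym // /X finset.setUC.
have b0 : (0 < len b)%N by rewrite (ldesc_len bs).
(* b is the alternating word of the same length both from s and from t, so (st)^(len b) = 1, and
   [cox_order] makes m s t finite and at most len b. *)
have gj : (g s * g t) ^+ (len b) = 1.
  apply: (mulIg (wp (alternating_word (len b) t s))); rewrite mul1g -[RHS]et.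
  by rewrite -prod_alternating ?cox_gen2.
have [k mst kb] := cox_order st b0 gj.
have bk : len b = k.
  apply/eqP; rewrite eqn_leq kb andbT; apply: (reduced_alternating_le st mst).
  by rewrite /reduced -es size_alternating.
by exists k, y; split => //; [rewrite -bk -es|rewrite wE -bk; apply/addE/badd].
Qed.

Lemma alternating_reduced s t k j : s != t -> m s t = Some k -> (j <= k)%N ->
  reduced m (alternating_word j s t).
Proof.
elim: j s t => [|j IH] s t st mst jk; first exact: reduced_nil.
rewrite /= reduced_cons IH ?(ltnW jk) 1?eq_sym 1?coxeter_sym //=.
apply/negP => ds; case: j IH jk ds => [|j] IH jk ds.
  by move: ds; rewrite /ldesc cox_prod_nil mulg1 len_gen len1.
have rt : reduced m (alternating_word j.+1 t s).
  by apply: IH; rewrite ?(ltnW jk) 1?eq_sym 1?coxeter_sym.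
have dt : ldesc (wp (alternating_word j.+1 t s)) t.
  by rewrite /= in rt *; move: rt; rewrite reduced_cons cox_prod_cons ldesc_mul => /andP[].
have [k' [y [mk _]]] := dihedral_prefix st ds dt.
rewrite (eqP rt) size_alternating; move: mk jk; rewrite mst => -[->] /=; lia.
Qed.

Lemma len_alternating s t k : s != t -> m s t = Some k ->
  len (wp (alternating_word k s t)) = k.
Proof.
by move=> st mst; rewrite (eqP (alternating_reduced st mst (leqnn k))) size_alternating.
Qed.

(** * Matsumoto's theorem *)

Inductive braid : seq T -> seq T -> Prop :=
| braid_refl u : braid u u
| braid_trans u u' v : braid u u' -> braid u' v -> braid u v
| braid_rel u v a b : artin_rel m a b -> braid (u ++ a ++ v) (u ++ b ++ v).

Lemma braid_cons s u v : braid u v -> braid (s :: u) (s :: v).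
Proof.
elim=> [{}u|{}u {}v w _ IH1 _ IH2|{}u {}v a b ab]; first exact: braid_refl.
  exact: braid_trans IH1 IH2.
by rewrite -!cat_cons; exact: braid_rel.
Qed.

Lemma matsumoto u v : reduced m u -> reduced m v -> wp u = wp v -> braid u v.
Proof.
move: {2}(size u) (leqnn (size u)) => n; elim: n u v => [|n IH] u v.
  rewrite leqn0 => /eqP /size0nil -> _ rv; rewrite cox_prod_nil => e.
  have : size v = 0 by rewrite -(eqP rv) -e len1.
  by move=> /size0nil ->; exact: braid_refl.
move=> un ru rv e; have suv : size u = size v by rewrite -(eqP ru) e (eqP rv).
case: u un ru e suv => [|s u] un ru e suv.
  by case: v suv {rv e} => // _; exact: braid_refl.
case: v rv e suv => [|t v] //= rv e [suv].
have [su tv] := (ru, rv); move: su tv; rewrite !reduced_cons => /andP[ru' nds] /andP[rv' ndt].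
have [st|st] := eqVneq s t.
  subst t; apply: braid_cons; apply: IH => //.
  by move: e; rewrite !cox_prod_cons => /mulgI.
have ds : ldesc (wp (s :: u)) s by rewrite cox_prod_cons ldesc_mul.
have dt : ldesc (wp (s :: u)) t by rewrite e cox_prod_cons ldesc_mul.
have [k [y [mst wE lw]]] := dihedral_prefix st ds dt.
have mts : m t s = Some k by rewrite coxeter_sym.
have [q rq qy] := reduced_word y.
have k0 : (0 < k)%N by apply: ltnW; exact: (coxeter_off_diag st mst).
have red a b : wp (alternating_word k a b) = wp (alternating_word k s t) ->
    reduced m (alternating_word k a b ++ q).
  move=> h; rewrite /reduced cox_prod_cat h qy -wE lw size_cat size_alternating.
  by rewrite -qy (eqP rq).
(* u and v are joined through two words of the same element that begin with the two alternating
   words. One shares its first letter with u and the other with v, so the induction hypothesis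
   applies to the tails. *)
apply: (@braid_trans _ (alternating_word k s t ++ q)).
  have := red s t erefl; have : wp (alternating_word k s t ++ q) = wp (s :: u).
    by rewrite cox_prod_cat qy.
  case: (k) k0 => //= k' _; rewrite !cox_prod_cons => /mulgI eu.
  rewrite reduced_cons => /andP[r _].
  by apply: braid_cons; apply: IH.
apply: (@braid_trans _ (alternating_word k t s ++ q)).
  by apply: (@braid_rel [::]); exists s, t, k.
have eq_alt := cox_alternating st mst.
have := red t s (esym eq_alt); have : wp (alternating_word k t s ++ q) = wp (t :: v).
  by rewrite cox_prod_cat qy -eq_alt -wE.
case: (k) k0 => //= k' _; rewrite !cox_prod_cons => /mulgI eu.
rewrite reduced_cons => /andP[r _].
apply: braid_cons; apply: IH => //.
by rewrite -(eqP r) eu (eqP rv') -suv.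
Qed.

Lemma braid_prod u v : braid u v -> wp u = wp v.
Proof.
elim=> [//|{}u {}v w _ -> _ -> //|{}u {}v a b [s [t [k [st mst -> ->]]]]].
by rewrite !cox_prod_cat (cox_alternating st mst).
Qed.

Lemma braid_size u v : braid u v -> size u = size v.
Proof.
elim=> [//|{}u {}v w _ -> _ -> //|{}u {}v a b [s [t [k [st mst -> ->]]]]].
by rewrite !size_cat !size_alternating.
Qed.

Lemma braid_mem u v : braid u v -> u =i v.
Proof.
have sub j (s t : T) : s != t -> m s t = Some j ->
    {subset alternating_word j s t <= alternating_word j t s}.
  move=> st /(coxeter_off_diag st); case: j => [|[|j]] // _ z /alternating_sub.
  by rewrite /= !inE => /orP[/eqP ->|/eqP ->]; rewrite eqxx ?orbT.
elim=> [//|{}u {}v w _ IH1 _ IH2 z|{}u {}v a b [s [t [k [st mst -> ->]]]] z].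
  by rewrite IH1 IH2.
rewrite !mem_cat; congr (_ || (_ || _)).
by apply/idP/idP; apply: sub; rewrite // 1?eq_sym // coxeter_sym.
Qed.

Lemma not_reduced_braid u : ~~ reduced m u ->
  exists u1 s u2, braid u (u1 ++ s :: s :: u2).
Proof.
elim: u => [|s u IH]; first by rewrite reduced_nil.
have [ru|/IH [u1 [a [u2 h]]] _] := boolP (reduced m u); last first.
  by exists (s :: u1), a, u2; exact: braid_cons.
rewrite reduced_cons ru negbK => ds.
have [q rq qE] := reduced_word (g s * wp u).
exists [::], s, q; apply/braid_cons/matsumoto => //.
  by rewrite reduced_cons rq qE ldesc_mul ds.
by rewrite cox_prod_cons qE cox_genK.
Qed.

End Cosets.

Section WeakOrder.
Variables (T : finType) (m : coxeter_matrix T).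
Local Notation W := (coxeter_group m).
Local Notation g := (cox_gen m).
Local Notation wp := (cox_prod m).
Implicit Types (X : {set T}) (w x y z p q : W)(s t : T).

(** * The weak order *)

Definition pre x y := add x (x^-1 * y).

Lemma preM x y : pre x (x * y) = add x y.
Proof. by rewrite /pre mulKg. Qed.

Lemma preP x z : reflect (exists2 y, z = x * y & add x y) (pre x z).
Proof.
apply: (iffP idP) => [h|[y -> h]]; last by rewrite preM.
by exists (x^-1 * z); rewrite ?mulVKg.
Qed.

Lemma pre1 x : pre 1 x.
Proof. by rewrite -[x]mul1g preM add1l. Qed.

Lemma pre_refl x : pre x x.
Proof. by rewrite -{2}[x]mulg1 preM add1r. Qed.

Lemma pre_len x y : pre x y -> (len x <= len y)%N.
Proof. by move=> /preP[z -> /addE ->]; rewrite leq_addr. Qed.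

Lemma pre_trans y x z : pre x y -> pre y z -> pre x z.
Proof.
move=> /preP[a -> xa] /preP[b -> ab]; rewrite -mulgA preM.
by have := add_assoc x a b; rewrite xa ab => /esym /andP[].
Qed.

Lemma pre_anti x y : pre x y -> pre y x -> x = y.
Proof.
move=> /[dup] /pre_len l1 /preP[z -> /addE e] /pre_len l2.
by rewrite (@len_eq0 _ _ z) ?mulg1 //; lia.
Qed.

Lemma pre_mul2l z x y : add z y -> pre x y -> pre (z * x) (z * y).
Proof.
move=> zy /preP[a e xa]; rewrite e mulgA preM.
by move: zy; rewrite e => zy; have := add_assoc z x a; rewrite xa zy => /andP[].
Qed.

Lemma add_pre u x y : add u y -> pre x y -> add u x.
Proof.
move=> uy /preP[a e xa]; rewrite e in uy.
by have := add_assoc u x a; rewrite xa uy => /andP[].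
Qed.

Lemma pre_gen s w : pre (g s) w = ldesc w s.
Proof. by rewrite /pre cox_genV add_gen_l ldesc_mul negbK. Qed.

Lemma ldesc_ex w : w <> 1 -> exists s, ldesc w s.
Proof.
have [[|s u] ru <-] := reduced_word w; first by rewrite cox_prod_nil.
exists s; move: ru; rewrite reduced_cons cox_prod_cons ldesc_mul.
by case/andP.
Qed.

Lemma pre_add_gen x z s : pre x z -> ldesc (x^-1 * z) s ->
  pre (x * g s) z /\ ~~ rdesc x s.
Proof.
move=> /preP[y -> xy]; rewrite mulKg -pre_gen => sy.
by rewrite pre_mul2l // -add_gen_r (add_pre xy).
Qed.

Lemma pre_add_genV x z s : ~~ rdesc x s -> pre (x * g s) z ->
  pre x z /\ ldesc (x^-1 * z) s.
Proof.
move=> xs /preP[y -> xy]; rewrite -!mulgA mulKg preM -pre_gen preM.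
by have := add_assoc x (g s) y; rewrite xy add_gen_r xs => /esym /andP[].
Qed.

Lemma par_support X u : reduced m u -> par X (wp u) -> all (mem X) u.
Proof.
move=> ru /par_reduced [v [/allP vX rv e]].
by apply/allP => a; rewrite -(braid_mem (matsumoto rv ru e)) => /vX.
Qed.

Lemma par_pre X x y : pre x y -> par X y -> par X x.
Proof.
have [u ru <-] := reduced_word x.
move=> /preP[z -> xz]; have [v rv e] := reduced_word z.
rewrite -e -cox_prod_cat => /par_support; rewrite all_cat => /(_ _)/andP[|uX _].
  by rewrite /reduced cox_prod_cat e addE // -e (eqP ru) (eqP rv) size_cat.
by exists u.
Qed.

Lemma par_gen_in X s : par X (g s) -> s \in X.
Proof.
rewrite -cox_prod1 => /par_support /=; rewrite andbT; apply.
by rewrite /reduced cox_prod1 len_gen.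
Qed.

Lemma par_ldesc X w s : par X w -> ldesc w s -> s \in X.
Proof. by move=> wX; rewrite -pre_gen => /par_pre /(_ wX) /par_gen_in. Qed.

Lemma par_rdesc X w s : par X w -> rdesc w s -> s \in X.
Proof. by move=> /par_inv wX; rewrite -ldescV; exact: par_ldesc. Qed.

Lemma add_alternating x s t k : s != t -> m s t = Some k ->
  ~~ rdesc x s -> ~~ rdesc x t -> add x (wp (alternating_word k s t)).
Proof.
move=> st mst xs xt; apply: (@add_par _ _ [set s; t]).
  by move=> a; rewrite !inE => /orP[/eqP ->|/eqP ->].
exists (alternating_word k s t) => //; apply/allP => a /alternating_sub.
by rewrite /= !inE.
Qed.

Lemma pre_alternating s t k : s != t -> m s t = Some k ->
  pre (g s) (wp (alternating_word k s t)).
Proof.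
move=> st mst; have := alternating_reduced st mst (leqnn k).
case: k mst => [|k] mst; first by have := coxeter_off_diag st mst.
rewrite reduced_cons cox_prod_cons pre_gen ldesc_mul /=.
by case/andP.
Qed.

(** Newman's diamond argument, by descending induction on the length: the greatest elements above
    two covers x s and x t agree, because both lie above the dihedral join. It produces [carry],
    meets and longest elements. *)
Lemma max_exists (E : W -> Prop) (N : nat) :
  E 1 -> (forall x y, pre x y -> E y -> E x) -> (forall x, E x -> (len x <= N)%N) ->
  (forall x s t, s != t -> ~~ rdesc x s -> ~~ rdesc x t ->
     E (x * g s) -> E (x * g t) ->
     exists2 k, m s t = Some k & E (x * wp (alternating_word k s t))) ->
  exists2 z, E z & forall x, E x -> pre x z.
Proof.
move=> E1 Epre EN Edia.
have claim n x : E x -> (N - len x <= n)%N ->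
    exists z, [/\ E z, pre x z & forall y, E y -> pre x y -> pre y z].
  elim: n x => [|n IH] x Ex Nx.
    exists x; split=> [//||y Ey /[dup] xy /preP[z yE xz]]; first exact: pre_refl.
    suff -> : y = x by exact: pre_refl.
    have := EN y Ey; rewrite yE addE // => h.
    by rewrite (@len_eq0 _ _ z) ?mulg1 //; lia.
  have [[s [xs Es]]|none] := pselect (exists s, ~~ rdesc x s /\ E (x * g s)); last first.
    exists x; split=> [//||y Ey xy]; first exact: pre_refl.
    have [e|ne] := pselect (x^-1 * y = 1).
      by rewrite -[y](mulVKg x) e mulg1; exact: pre_refl.
    have [s sd] := ldesc_ex ne; case: none; exists s.
    by have [h1 h2] := pre_add_gen xy sd; split => //; exact: Epre h1 Ey.
  have asc s' : ~~ rdesc x s' -> len (x * g s') = (len x).+1.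
    by rewrite len_mul_gen => /negPf ->.
  have pasc s' : ~~ rdesc x s' -> pre x (x * g s') by rewrite preM add_gen_r.
  have up s' : ~~ rdesc x s' -> E (x * g s') -> exists z,
      [/\ E z, pre (x * g s') z & forall y, E y -> pre (x * g s') y -> pre y z].
    by move=> xs' Es'; apply: IH => //; rewrite asc // subnS; move: Nx; lia.
  have [z [Ez xz zmax]] := up s xs Es.
  exists z; split=> //; first exact: pre_trans (pasc _ xs) xz.
  move=> y Ey xy; have [e|ne] := pselect (x^-1 * y = 1).
    have -> : y = x by rewrite -[y](mulVKg x) e mulg1.
    exact: pre_trans (pasc _ xs) xz.
  have [t td] := ldesc_ex ne.
  have [xty xt] := pre_add_gen xy td.
  have [st|st] := eqVneq s t; first by subst t; exact: zmax.
  have Et := Epre _ _ xty Ey.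
  have [z' [Ez' xz' zmax']] := up t xt Et.
  have [k mst Ek] := Edia _ _ _ st xs xt Es Et.
  have ts : t != s by rewrite eq_sym.
  have mts : m t s = Some k by rewrite coxeter_sym.
  have ps : pre (x * g s) (x * wp (alternating_word k s t)).
    by apply: pre_mul2l; [exact: add_alternating|exact: pre_alternating].
  have pt : pre (x * g t) (x * wp (alternating_word k s t)).
    rewrite (cox_alternating st mst).
    by apply: pre_mul2l; [exact: add_alternating|exact: pre_alternating].
  have h1 : pre z z' by apply: zmax' => //; apply: pre_trans pt _; exact: zmax.
  have h2 : pre z' z by apply: zmax => //; apply: pre_trans ps _; exact: zmax'.
  by rewrite (pre_anti h1 h2); exact: zmax'.
have [z [Ez _ zmax]] := claim N 1 E1 (leq_subr _ _).
by exists z => // x Ex; apply: zmax => //; exact: pre1.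
Qed.

Lemma pre_join x s t z : s != t -> ~~ rdesc x s -> ~~ rdesc x t ->
  pre (x * g s) z -> pre (x * g t) z ->
  exists2 k, m s t = Some k & pre (x * wp (alternating_word k s t)) z.
Proof.
move=> st xs xt /(pre_add_genV xs) [xz sz] /(pre_add_genV xt) [_ tz].
have [k [y [mst e ly]]] := dihedral_prefix st sz tz.
exists k => //; have zE : z = x * (wp (alternating_word k s t) * y).
  by rewrite -e mulVKg.
rewrite zE; apply: pre_mul2l; first by rewrite -e.
by rewrite preM /add -e ly len_alternating.
Qed.

Lemma carry_exists u v : exists z : W, [/\ pre z v, add u z &
  forall x, pre x v -> add u x -> pre x z].
Proof.
have [] := @max_exists (fun x => pre x v /\ add u x) (len v).
- by split; [exact: pre1|exact: add1r].
- by move=> x y xy [yv uy]; split; [exact: pre_trans yv|exact: add_pre xy].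
- by move=> x [/pre_len].
- move=> x s t st xs xt [sv us] [tv ut].
  have [k mst pk] := pre_join st xs xt sv tv; exists k => //; split => //.
  have ux a : ~~ rdesc x a -> add u (x * g a) -> add u x && ~~ rdesc (u * x) a.
    move=> xa ua; have := add_assoc u x (g a).
    by rewrite ua !add_gen_r xa => ->.
  have /andP[ux1 uxs] := ux s xs us; have /andP[_ uxt] := ux t xt ut.
  have := add_assoc u x (wp (alternating_word k s t)).
  by rewrite ux1 !add_alternating // => /esym /andP[].
by move=> z [zv uz] zmax; exists z; split=> // x xv ux; exact: zmax.
Qed.

(** For finite W this is the meet of v and u^-1 w_0: what u can absorb from v while the product
    remains simple. *)
Definition carry u v : W := sval (cid (carry_exists u v)).

Lemma carry_pre u v : pre (carry u v) v.
Proof. by have [] := svalP (cid (carry_exists u v)). Qed.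

Lemma carry_add u v : add u (carry u v).
Proof. by have [] := svalP (cid (carry_exists u v)). Qed.

Lemma carry_max u v x : pre x v -> add u x -> pre x (carry u v).
Proof. by have [_ _] := svalP (cid (carry_exists u v)); exact. Qed.

Lemma meet_exists p q : exists z : W, [/\ pre z p, pre z q &
  forall x, pre x p -> pre x q -> pre x z].
Proof.
have [] := @max_exists (fun x => pre x p /\ pre x q) (len p).
- by split; exact: pre1.
- by move=> x y xy [yp yq]; split; exact: pre_trans xy _.
- by move=> x [/pre_len].
- move=> x s t st xs xt [sp sq] [tp tq].
  have [k mst pk] := pre_join st xs xt sp tp.
  have [k' ] := pre_join st xs xt sq tq; rewrite mst => -[<-] qk.
  by exists k.
by move=> z [zp zq] zmax; exists z; split=> // x xp xq; exact: zmax.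
Qed.

End WeakOrder.

(** * Finite Coxeter groups and longest elements *)

Section FiniteCoxeter.
Variables (T : finType) (m : coxeter_matrix T).
Local Notation W := (coxeter_group m).
Local Notation g := (cox_gen m).
Local Notation wp := (cox_prod m).
Hypothesis finW : spherical m.
Implicit Types (X I J : {set T}) (w x y z : W) (s t : T).

Lemma cox_enum : exists e : seq W, uniq e /\ forall x, x \in e.
Proof.
have /finite_seqP [e eE] := finW; exists (undup e); split; first exact: undup_uniq.
move=> x; rewrite mem_undup.
by have : [set: W]%classic x by []; rewrite eE.
Qed.

Lemma len_bounded : exists N, forall w, (len w <= N)%N.
Proof.
have [e [_ eP]] := cox_enum; exists (\max_(x <- e) len x) => w.
exact: (leq_bigmax_seq _ (eP w)).
Qed.

(** Two powers of st agree by the pigeonhole principle, so st has finite order. *)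
Lemma spherical_some s t : s != t -> exists k, m s t = Some k.
Proof.
move=> st; have [e [ue eP]] := cox_enum.
have : ~~ uniq [seq (g s * g t) ^+ i | i <- iota 0 (size e).+1].
  apply/negP => u; have := uniq_leq_size u (fun x _ => eP x).
  by rewrite size_map size_iota ltnn.
case/(uniqPn 1) => i [j []]; rewrite size_map size_iota => ij jn.
rewrite !(nth_map 0) ?size_iota //; last exact: ltn_trans jn.
rewrite !nth_iota //; last exact: ltn_trans jn.
rewrite !add0n => e1; have [] := @cox_order _ m s t (j - i) st.
- by rewrite subn_gt0.
- by apply: (mulgI ((g s * g t) ^+ i)); rewrite -expgnDr subnKC ?(ltnW ij) // mulg1.
by move=> k mk _; exists k.
Qed.

Lemma longest_exists X : exists z, par X z /\ forall x, par X x -> pre x z.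
Proof.
have [N lN] := len_bounded.
have [] := @max_exists _ m (par X) N.
- exact: par1.
- by move=> x y; exact: par_pre.
- by move=> x _; exact: lN.
- move=> x s t st xs xt sX tX.
  have [k mst] := spherical_some st; exists k => //.
  have xX : par X x by apply: par_pre sX; rewrite preM add_gen_r.
  have inX a : ~~ rdesc x a -> par X (x * g a) -> a \in X.
    by move=> xa h; apply: (par_rdesc h); rewrite rdesc_mul.
  apply: par_mul => //; exists (alternating_word k s t) => //.
  apply/allP => a /alternating_sub; rewrite !inE => /orP[] /eqP -> /=.
    exact: inX.
  exact: inX.
by move=> z zX zmax; exists z.
Qed.

Definition longest X : W := sval (cid (longest_exists X)).
Local Notation w0 := (longest [set: T]).

Lemma longest_par X : par X (longest X).
Proof. by have [] := svalP (cid (longest_exists X)). Qed.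

Lemma pre_longest X x : par X x -> pre x (longest X).
Proof. by have [_] := svalP (cid (longest_exists X)); exact. Qed.

Lemma pre_w0 x : pre x w0.
Proof. by apply: pre_longest; exact: par_setT. Qed.

Lemma longestV X : (longest X)^-1 = longest X.
Proof.
have /preP[y e /addE h] := pre_longest (par_inv (longest_par X)).
have := congr1 (@len _ m) e; rewrite h lenV => /esym/eqP.
rewrite -{2}[len _]addn0 eqn_add2l => /eqP /len_eq0 y1.
by rewrite [RHS]e y1 mulg1.
Qed.

Lemma longest2 X : longest X * longest X = 1.
Proof. by rewrite -{1}longestV mulVg. Qed.

Lemma longest_suffix X x : par X x -> add (longest X * x^-1) x.
Proof.
move=> /par_inv /pre_longest; rewrite /pre invgK -addV invgM longestV invgK.
by [].
Qed.

Lemma ldesc_longest X s : ldesc (longest X) s = (s \in X).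
Proof.
apply/idP/idP; first exact/par_ldesc/longest_par.
by move=> sX; rewrite -pre_gen; exact/pre_longest/par_gen.
Qed.

Lemma rdesc_longest X s : rdesc (longest X) s = (s \in X).
Proof. by rewrite -ldescV longestV ldesc_longest. Qed.

Lemma len_w0l x : (len (w0 * x) + len x)%N = len w0.
Proof.
have := longest_suffix (par_setT x^-1); rewrite invgK /add => /eqP.
by rewrite mulgK lenV.
Qed.

Lemma len_w0r x : (len (x * w0) + len x)%N = len w0.
Proof. by rewrite -(len_w0l x^-1) lenV -[len (w0 * _)]lenV invgM invgK longestV. Qed.

Lemma rdesc_w0l x s : rdesc (w0 * x) s = ~~ rdesc x s.
Proof.
rewrite /rdesc -mulgA; have := len_w0l x; have := len_w0l (x * g s).
have := rdesc_mul x s; rewrite /rdesc cox_genKr.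
move: (len (x * g s)) (len x) (len (w0 * (x * g s))) (len (w0 * x)) => a b c d.
case: (ltnP b a) => ab /esym h1 h2 h3; apply/idP/idP; move: h1; case: ltnP => //; lia.
Qed.

Lemma ldesc_w0r x s : ldesc (x * w0) s = ~~ ldesc x s.
Proof. by rewrite -rdescV invgM longestV rdesc_w0l rdescV. Qed.

Lemma len1_gen x : len x = 1%N -> exists s, x = g s.
Proof.
move=> x1; have [u [us <-]] := len_word x; rewrite x1 in us.
by case: u us => [|s [|t u]] // _; exists s; rewrite cox_prod1.
Qed.

(** Conjugation by w_0 preserves the length, so it permutes the generators. *)
Lemma w0_conj s : exists t, w0 * g s = g t * w0.
Proof.
have [|t tE] := @len1_gen (w0 * g s * w0).
  by have := len_w0r (w0 * g s); have := len_w0l (g s); rewrite len_gen; lia.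
by exists t; rewrite -tE -mulgA longest2 mulg1.
Qed.

Lemma longest_disjoint_add I J : [disjoint I & J] -> add (longest I) (longest J).
Proof.
move=> dIJ; apply: (add_par _ (longest_par J)) => s sJ; rewrite rdesc_longest.
by apply/negP => sI; have := disjointFr dIJ sI; rewrite sJ.
Qed.

Lemma longest_mul_rdesc I J s : [disjoint I & J] -> s \in J ->
  rdesc (longest I * longest J) s.
Proof.
by move=> dIJ sJ; apply: add_rdesc; rewrite ?longest_disjoint_add ?rdesc_longest.
Qed.

(** Suppose that u outside I is a left descent. Exchange forces u w_I = w_I c with c in W_J; lengths
    make c a generator, and supports make it u itself. An element s of I that does not commute with
    u is then also a descent of u w_I, which thus begins with u s u. So u occurs in a reduced word
    of w_I, a contradiction. *)
Lemma longest_mul_ldesc I J : [disjoint I & J] ->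
  {in J, forall u, exists2 s, s \in I & m s u != Some 2} ->
  forall u, ldesc (longest I * longest J) u -> u \in I.
Proof.
move=> dIJ nc u; apply: contraTT => uI; apply/negP.
have [a ra ae] := reduced_word (longest I).
have [b rb be] := reduced_word (longest J).
have aI : all (mem I) a by apply: (par_support ra); rewrite ae; exact: longest_par.
have bJ : all (mem J) b by apply: (par_support rb); rewrite be; exact: longest_par.
rewrite -ae -be -cox_prod_cat => /ldesc_exchange [u1 [r [u2 [uE e]]]].
have [[a' [aE u2E]]|[b' [bE u1E]]] := cat_eq_split uE.
  move: e; rewrite u2E catA !cox_prod_cat mulgA => /mulIg; rewrite -cox_prod_cat => e.
  have : par I (g u).
    rewrite -[g u](mulgK (wp a)) e; apply: par_mul; last by apply: par_inv; exists a.
    exists (u1 ++ a') => //; move: aI; rewrite aE !all_cat /=.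
    by case/and3P => -> _ ->.
  by move=> /par_gen_in; exact/negP.
pose c := wp (b' ++ u2) * (wp b)^-1.
have cE : g u * wp a = wp a * c.
  apply: (mulIg (wp b)); rewrite -!mulgA mulVg mulg1 -!cox_prod_cat e u1E.
  by rewrite catA.
have cJ : par J c.
  apply: par_mul; last by apply: par_inv; exists b.
  exists (b' ++ u2) => //; move: bJ; rewrite bE !all_cat /=.
  by case/and3P => -> _ ->.
have una : ~~ ldesc (wp a) u by rewrite ae ldesc_longest.
have [|v vE] := @len1_gen c.
  have := congr1 (@len _ m) cE; rewrite len_gen_mul (negPf una) addE; first by lia.
  apply: (add_par _ cJ) => s sJ; rewrite ae rdesc_longest.
  by apply/negP => sI; have := disjointFr dIJ sI; rewrite sJ.
rewrite vE in cE cJ; have vJ := par_gen_in cJ.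
have uv : u = v.
  have : par (v |: I) (wp a * g v).
    apply: par_mul; last by apply: par_gen; rewrite !inE eqxx.
    by rewrite ae; apply: par_sub (longest_par I); exact: finset.subsetUr.
  rewrite -cE => /par_ldesc /(_ (_ : ldesc _ u)); rewrite ldesc_mul una => /(_ isT).
  by rewrite !inE (negPf uI) orbF => /eqP.
subst v; have [s sI msu] := nc u vJ.
have su : u != s by apply: contraNneq uI => ->.
pose q := g u * wp a.
have qu : ldesc q u by rewrite ldesc_mul.
have qs : ldesc q s.
  rewrite /q cE; apply: add_ldesc; last by rewrite ae ldesc_longest.
  rewrite add_gen_r -ldescV -cox_prod_rev ; rewrite cox_prod_rev ldescV.
  by rewrite ae rdesc_longest.
have [k [y [mus qE ql]]] := dihedral_prefix su qu qs.
have k3 : (2 < k)%N.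
  have := coxeter_off_diag su mus; rewrite leq_eqVlt => /orP[/eqP k2|//].
  by move: msu; rewrite coxeter_sym mus k2 eqxx.
have [d rd de] := reduced_word y.
case: k mus qE ql k3 => [|[|[|k]]] // mus qE ql _.
have aE : wp a = wp (s :: u :: alternating_word k s u ++ d).
  rewrite -[wp a](cox_genK u) -/q qE /= !cox_prod_cons cox_prod_cat de -!mulgA.
  by rewrite cox_genK.
have : all (mem I) (s :: u :: alternating_word k s u ++ d).
  apply: (@par_support _ m); last by rewrite -aE; exists a.
  rewrite /reduced -aE /= size_cat size_alternating.
  have := len_gen_mul (wp a) u; rewrite -/q (negPf una) ql -de (eqP rd).
  by rewrite !addSn => -[<-].
by rewrite /= (negPf uI) andbF.
Qed.

End FiniteCoxeter.

Section Streams.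
Variables (T : finType) (m : coxeter_matrix T).
Local Notation W := (coxeter_group m).
Local Notation g := (cox_gen m).
Local Notation wp := (cox_prod m).
Implicit Types (X : {set T}) (v w x y z : W) (s t : T) (p q : nat -> W) (l : seq W).

Definition link x y := [forall s, ldesc y s ==> rdesc x s].

Lemma linkP x y : reflect (carry x y = 1) (link x y).
Proof.
apply: (iffP forallP) => [h|h s]; last first.
  apply/implyP; rewrite -pre_gen => sy; apply/negPn; rewrite -add_gen_r.
  by apply/negP => /(carry_max sy); rewrite h => /pre_len; rewrite len_gen len1.
apply: contrapT => /ldesc_ex [s]; rewrite -pre_gen => sc.
have := implyP (h s); rewrite -pre_gen (pre_trans sc (carry_pre _ _)) => /(_ isT).
by apply/negP; rewrite -add_gen_r (add_pre (carry_add x y) sc).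
Qed.

Lemma carry1l x : carry 1 x = x.
Proof.
by apply: pre_anti; [exact: carry_pre|apply: carry_max; [exact: pre_refl|exact: add1l]].
Qed.

Lemma pre_1 x : pre x 1 -> x = 1.
Proof. by move=> h; apply: pre_anti h _; exact: pre1. Qed.

Lemma carry1r x : carry x 1 = 1.
Proof. exact/pre_1/carry_pre. Qed.

Lemma pre_cancel v x y : add v x -> pre (v * x) (v * y) -> pre x y.
Proof.
move=> vx /preP[c e xc]; have -> : y = x * c by apply: (mulgI v); rewrite e mulgA.
by have := add_assoc v x c; rewrite vx xc preM => /esym /andP[].
Qed.

(** This makes [lmul] an action: absorbing into v and then into u absorbs exactly as much as uv does
    at once. *)
Lemma carry_mul (u : W) v x : add u v -> carry u (v * carry v x) = v * carry (u * v) x.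
Proof.
move=> uv; set x' := carry v x; set z := carry (u * v) x.
have vx' : add v x' := carry_add v x.
have vz : add v z && add u (v * z) by rewrite -add_assoc uv carry_add.
case/andP: vz => vz uvz.
have zx' : pre z x' by apply: carry_max vz; exact: carry_pre.
apply: pre_anti; last by apply: carry_max uvz; exact: pre_mul2l.
have /preP[y e vy] : pre v (carry u (v * x')) by apply: carry_max => //; rewrite preM.
have yx' : pre y x' by apply: pre_cancel vy _; rewrite -e; exact: carry_pre.
rewrite e; apply: pre_mul2l => //; apply: carry_max.
  by apply: pre_trans yx' _; exact: carry_pre.
by have := add_assoc u v y; rewrite vy -e carry_add => /andP[].
Qed.

(** * Left multiplication on streams of simple elements *)

(* The largest prefix of p 0 which u can absorb is multiplied into u; the rest is carried on. *)
Fixpoint lmul (u : W) p (n : nat) {struct n} : W :=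
  if n is n'.+1 then lmul ((carry u (p 0))^-1 * p 0) (fun i => p i.+1) n'
  else u * carry u (p 0).

Lemma lmulM (u : W) v p : add u v -> lmul u (lmul v p) = lmul (u * v) p.
Proof.
move=> uv; apply/funext => n; elim: n u v p uv => [|n IH] u v p uv /=.
  by rewrite carry_mul // mulgA.
set x := p 0; rewrite carry_mul //; set x' := carry v x; set z := carry (u * v) x.
have vz : add v z && add u (v * z) by rewrite -add_assoc uv carry_add.
have zx' : pre z x' by apply: carry_max; [exact: carry_pre|case/andP: vz].
have -> : (v * z)^-1 * (v * x') = z^-1 * x' by rewrite invgM -mulgA mulKg.
have -> : z^-1 * x = (z^-1 * x') * (x'^-1 * x) by rewrite -mulgA mulVKg.
apply: (IH _ _ (fun i => p i.+1)).
have /preP[b xE x'b] : pre x' x := carry_pre v x.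
case/preP: zx' => a x'E za; rewrite xE mulKg x'E mulKg.
by have := add_assoc z a b; rewrite -x'E x'b za => /esym /andP[].
Qed.

Lemma lmul1 p : lmul 1 p = p.
Proof.
apply/funext => n; elim: n p => [|n IH] p /=; rewrite carry1l ?mul1g //.
by rewrite mulVg IH.
Qed.

Definition normal p := forall i, link (p i) (p i.+1).

Definition ones : nat -> W := fun=> 1.

Lemma link1r x : link x 1.
Proof. by apply/linkP; exact: carry1r. Qed.

Lemma ones_normal : normal ones.
Proof. by move=> i; exact: link1r. Qed.

Lemma lmul_normal (u : W) p : normal p -> normal (lmul u p).
Proof.
move=> np n; elim: n u p np => [|n IH] u p np; last first.
  by apply: IH => i; exact: np.
rewrite /=; set x := p 0; set y := p 1%N; set x' := carry u x.
set c := x'^-1 * x; set y' := carry c y.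
have xy : carry x y = 1 by exact/linkP/(np 0).
have /preP[c' xE x'c] : pre x' x := carry_pre u x.
have cE : c' = c by rewrite /c xE mulKg.
rewrite {}cE in xE x'c.
apply/forallP => s; apply/implyP; rewrite -pre_gen => sy; apply/negPn/negP.
rewrite -add_gen_r => ux's.
have /andP[x's ux's'] : add x' (g s) && add u (x' * g s).
  by rewrite -add_assoc ux's carry_add.
(* x = x' c is linked to y, so nothing of y can be absorbed behind x, and s is already a prefix of
   c. Then u could absorb x' s, against the maximality of x'. *)
have sc : pre (g s) c.
  have := carry_max sy x's; rewrite carry_mul // -xE xy mulg1.
  by [].
have : pre (x' * g s) x' by apply: carry_max => //; rewrite [X in pre _ X]xE; exact: pre_mul2l.
by move=> /pre_len; rewrite addE // len_gen; lia.
Qed.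

Lemma lmul_link (u : W) p : normal p -> link u (p 0) ->
  lmul u p = fun n => if n is n'.+1 then p n' else u.
Proof.
move=> np up; apply/funext => n; elim: n u p np up => [|n IH] u p np up /=.
  by rewrite (elimT (linkP _ _) up) mulg1.
rewrite (elimT (linkP _ _) up) invg1 mul1g (IH _ (fun i => p i.+1)).
- by case: n {IH}.
- by move=> i; exact: np.
- exact: (np 0).
Qed.

Definition stream l : nat -> W := foldr lmul ones l.

Lemma stream_normal l : normal (stream l).
Proof. by elim: l => [|u l IH]; [exact: ones_normal|exact: lmul_normal]. Qed.

Lemma lmul_word (u : seq T) p : reduced m u ->
  lmul (wp u) p = foldr (fun s => lmul (g s)) p u.
Proof.
elim: u => [|s u IH]; first by rewrite cox_prod_nil lmul1.
rewrite reduced_cons => /andP[ru su] /=; rewrite -IH // lmulM ?add_gen_l //.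
by rewrite cox_prod_cons.
Qed.

(** The stream of l, cut at the length of l. Only entries 1 are lost by the cut, and the result may
    itself end in 1s. *)
Fixpoint normal_form l : seq W := if l is u :: l' then
  mkseq (lmul u (nth 1 (normal_form l'))) (size l').+1 else [::].

Lemma normal_form_cons u l :
  normal_form (u :: l) = mkseq (lmul u (nth 1 (normal_form l))) (size l).+1.
Proof. by []. Qed.

Lemma size_normal_form l : size (normal_form l) = size l.
Proof. by case: l => [//|u l]; exact: size_mkseq. Qed.

Lemma lmul_end (u : W) l i : (size l < i)%N -> lmul u (nth 1 l) i = 1.
Proof.
elim: l u i => [|x l IH] u [|i] //= li; last exact: IH.
by rewrite carry1r invg1 mul1g (_ : (fun _ => 1) = ones) // lmul1.
Qed.

Lemma stream_normal_form l : stream l = nth 1 (normal_form l).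
Proof.
elim: l => [|u l IH]; first by apply/funext => i; rewrite nth_nil.
apply/funext => i; rewrite normal_form_cons -[stream _]/(lmul u (stream l)) IH.
have [il|il] := ltnP i (size l).+1; first by rewrite nth_mkseq.
by rewrite nth_default ?size_mkseq // lmul_end // size_normal_form.
Qed.

Definition normal_seq l := forall i, link (nth 1 l i) (nth 1 l i.+1).

Lemma stream_normal_seq l : normal_seq l -> stream l = nth 1 l.
Proof.
elim: l => [|u l IH] nl; first by apply/funext => i; rewrite nth_nil.
have nl' : normal_seq l by move=> i; exact: (nl i.+1).
rewrite /= IH // lmul_link //; last exact: (nl 0).
by apply/funext => -[].
Qed.

Lemma carry_par X (u : W) x : par X x -> par X (carry u x).
Proof. by apply: par_pre; exact: carry_pre. Qed.

Lemma lmul_par X (u : W) p : par X u -> (forall i, par X (p i)) -> forall i, par X (lmul u p i).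
Proof.
move=> uX pX i; elim: i u p uX pX => [|i IH] u p uX pX /=.
  by apply: par_mul => //; exact: carry_par.
apply: IH => //; apply: par_mul => //.
by apply: par_inv; exact: carry_par.
Qed.

Lemma stream_par X l : (forall x, x \in l -> par X x) -> forall i, par X (stream l i).
Proof.
elim: l => [|u l IH] lX i; first exact: par1.
apply: lmul_par; first by apply: lX; rewrite mem_head.
by apply: IH => x xl; apply: lX; rewrite inE xl orbT.
Qed.

Lemma mkseqS (U : Type) (f : nat -> U) n :
  mkseq f n.+1 = f 0 :: mkseq (fun i => f i.+1) n.
Proof. by rewrite /mkseq /= (iotaDl 1 0) -map_comp. Qed.

Definition total l := (\sum_(x <- l) len x)%N.

Lemma total_lmul (u : W) l : total (mkseq (lmul u (nth 1 l)) (size l).+1) = (len u + total l)%N.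
Proof.
rewrite /total; elim: l u => [|x l IH] u.
  by rewrite /= big_seq1 /= carry1r mulg1 big_nil addn0.
rewrite mkseqS big_cons [size _]/= (IH _) /= big_cons.
have : (len x = len (carry u x) + len ((carry u x)^-1 * x))%N.
  by have := carry_pre u x; rewrite /pre /add mulVKg => /eqP.
by rewrite (addE (carry_add _ _)) => ->; rewrite !addnA.
Qed.

Lemma total_normal_form l : total (normal_form l) = total l.
Proof.
elim: l => // u l IH; rewrite normal_form_cons -(size_normal_form l) total_lmul IH.
by rewrite /total big_cons.
Qed.

(* The induction on f replaces w by the meet of the first factors of the two products. *)
Lemma coprime_head (f : seq T) la lb w :
  (forall s, ldesc (stream la 0) s -> ~~ ldesc (stream lb 0) s) ->
  pre w (stream (map g f ++ la) 0) -> pre w (stream (map g f ++ lb) 0) ->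
  pre w (stream (map g f) 0).
Proof.
move=> cop; elim: f w => [|t f IH] w.
  move=> wa wb; have [->|/ldesc_ex [s]] := pselect (w = 1); first exact: pre1.
  rewrite -pre_gen => sw; have := cop s.
  by rewrite -!pre_gen (pre_trans sw wa) (pre_trans sw wb) => /(_ isT).
rewrite /=; set p := carry _ _; set q := carry _ _; set c := carry _ _.
move=> wp wq; have [z [zp zq zmax]] := meet_exists (g t * p) (g t * q).
have /preP[z' zE tz'] : pre (g t) z by apply: zmax; rewrite preM carry_add.
apply: (@pre_trans _ _ z); first exact: zmax.
rewrite zE in zp zq *; apply: pre_mul2l; first exact: carry_add.
apply: carry_max => //; apply: IH.
  by apply: pre_trans (pre_cancel tz' zp) _; exact: carry_pre.
by apply: pre_trans (pre_cancel tz' zq) _; exact: carry_pre.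
Qed.

End Streams.

Section Artin.
Variables (T : finType) (m : coxeter_matrix T).
Local Notation W := (coxeter_group m).
Local Notation A := (artin_group m).
Local Notation g := (cox_gen m).
Local Notation wp := (cox_prod m).
Implicit Types (X : {set T}) (x y z : W) (s t : T) (p q : nat -> W) (l : seq W).

(** * Simple elements of the Artin group *)

Definition artin_pos (u : seq T) : A := word_class (artin_rel m) (positive_word u).

Lemma artin_pos_cat u v : artin_pos (u ++ v) = artin_pos u * artin_pos v.
Proof. by rewrite /artin_pos positive_word_cat word_class_cat. Qed.

Lemma artin_pos_nil : artin_pos [::] = 1.
Proof. by []. Qed.

Lemma artin_pos_cons s u : artin_pos (s :: u) = artin_gen m s * artin_pos u.
Proof. by rewrite -cat1s artin_pos_cat. Qed.

Lemma artin_pos_braid u v : braid m u v -> artin_pos u = artin_pos v.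
Proof.
elim=> [//|{}u u' {}v _ -> _ -> //|{}u {}v a b ab].
rewrite !artin_pos_cat; congr (_ * (_ * _)).
by apply/word_classP; exact: presentation_rel.
Qed.

(** The choice of the reduced word does not matter, by Matsumoto's theorem. *)
Definition simple (w : W) : A := artin_pos (s2val (cid2 (reduced_word w))).

Lemma simple_reduced u : reduced m u -> simple (wp u) = artin_pos u.
Proof.
move=> ru; rewrite /simple; case: (cid2 _) => v rv e /=.
by apply/artin_pos_braid/matsumoto.
Qed.

Lemma simpleM x y : add x y -> simple (x * y) = simple x * simple y.
Proof.
have [u ru <-] := reduced_word x; have [v rv <-] := reduced_word y => xy.
rewrite -cox_prod_cat !simple_reduced ?artin_pos_cat //.
by rewrite /reduced cox_prod_cat (addE xy) (eqP ru) (eqP rv) size_cat.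
Qed.

Lemma simple1 : simple 1 = 1.
Proof. by rewrite -(cox_prod_nil m) simple_reduced ?reduced_nil. Qed.

Lemma simple_gen s : simple (g s) = artin_gen m s.
Proof. by rewrite -cox_prod1 simple_reduced // /reduced cox_prod1 len_gen. Qed.

Lemma simple_pre x y : pre x y -> simple y = simple x * simple (x^-1 * y).
Proof. by move=> /preP[z -> xz]; rewrite mulKg simpleM. Qed.

Definition simples l : A := \prod_(x <- l) simple x.

Lemma simples_cons x l : simples (x :: l) = simple x * simples l.
Proof. exact: big_cons. Qed.

Lemma simples_nil : simples [::] = 1.
Proof. exact: big_nil. Qed.

Lemma simples_cat l1 l2 : simples (l1 ++ l2) = simples l1 * simples l2.
Proof. exact: big_cat. Qed.

Lemma simples1 x : simples [:: x] = simple x.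
Proof. exact: big_seq1. Qed.

Lemma artin_pos_simples u : artin_pos u = simples (map g u).
Proof.
elim: u => [|s u IH]; first by rewrite simples_nil.
by rewrite artin_pos_cons simples_cons -IH simple_gen.
Qed.

Lemma simples_artin_pos l : exists2 u, simples l = artin_pos u &
  forall p, foldr (@lmul _ m) p l = foldr (fun s => lmul (g s)) p u.
Proof.
elim: l => [|x l [u lu fu]]; first by exists [::]; rewrite // simples_nil.
have [v rv <-] := reduced_word x; exists (v ++ u) => [|p].
  by rewrite simples_cons simple_reduced // artin_pos_cat lu.
by rewrite foldr_cat /= fu lmul_word.
Qed.

Lemma simples_lmul x l :
  simple x * simples l = simples (mkseq (lmul x (nth 1 l)) (size l).+1).
Proof.
elim: l x => [|y l IH] x.
  by rewrite simples_nil simples1 [lmul _ _ _]/= carry1r !mulg1.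
rewrite mkseqS [simples (y :: l)]simples_cons [RHS]simples_cons.
rewrite -[X in _ = _ * X]/(simples (mkseq (lmul ((carry x y)^-1 * y) (nth 1 l)) _)).
by rewrite -IH {1}(simple_pre (carry_pre x y)) !mulgA -simpleM // carry_add.
Qed.

Lemma simples_normal_form l : simples (normal_form l) = simples l.
Proof.
elim: l => // u l IH.
by rewrite normal_form_cons -(size_normal_form l) -simples_lmul IH simples_cons.
Qed.

Section Spherical.
Hypothesis finW : spherical m.
Local Notation w0 := (longest finW [set: T]).

Let D p := lmul w0 (lmul w0 p).

Let add_gen_w0 s : add (g s) (g s * w0).
Proof. by have := pre_w0 finW (g s); rewrite /pre cox_genV. Qed.

Let w0_gen s t : w0 * g s = g t * w0 -> w0 * g t = g s * w0.
Proof.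
move=> e; rewrite -[LHS](mulgK w0) longestV -[_ * g t * w0]mulgA -e.
by rewrite !mulgA longest2 mul1g.
Qed.

Let lmul_w0_gen s t p : w0 * g s = g t * w0 ->
  lmul w0 (lmul (g s) p) = lmul (g t) (lmul w0 p).
Proof.
move=> e; rewrite -[in LHS](cox_genK t w0) -lmulM ?add_gen_w0 //.
rewrite [lmul (_ * w0) _]lmulM; last first.
  by rewrite -e add_gen_r rdesc_mul rdesc_longest inE.
by rewrite -mulgA e cox_genK.
Qed.

Let lmul_gen_D s p : lmul (g s) (D p) = D (lmul (g s) p).
Proof.
have [t st] := w0_conj finW s.
by rewrite /D (lmul_w0_gen _ st) (lmul_w0_gen _ (w0_gen st)).
Qed.

Let lmul_D x p : lmul x (D p) = D (lmul x p).
Proof.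
have [u ru <-] := reduced_word x; rewrite !lmul_word //.
by elim: u {ru} => //= s u ->; rewrite lmul_gen_D.
Qed.

Let lmul_iterD x n p : lmul x (iter n D p) = iter n D (lmul x p).
Proof. by elim: n => //= n <-; rewrite lmul_D. Qed.

(* An inverse generator acts as s^-1 w0^2; the number of inverse letters is recorded separately. *)
Let letter (a : T * bool) p :=
  if a.2 then lmul (g a.1) p else lmul (g a.1 * w0) (lmul w0 p).

Let act (w : seq (T * bool)) p := foldr letter p w.

Let neg (w : seq (T * bool)) := count (fun a => ~~ a.2) w.

Let act_iterD w n p : act w (iter n D p) = iter n D (act w p).
Proof.
elim: w => // -[s b] w IH.
rewrite -![act (_ :: _) _]/(letter _ (act w _)) IH /letter.
by case: b; rewrite /= !lmul_iterD.
Qed.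

(** Equality of the fractions act w / D^(neg w) and act w' / D^(neg w'), up to a further D^N as in a
    localisation, which makes transitivity formal. *)
Let equiv w w' := exists N, forall p,
  iter (N + neg w') D (act w p) = iter (N + neg w) D (act w' p).

Let equivP w w' : presentation_eq (artin_rel m) w w' -> equiv w w'.
Proof.
elim=> {w w'}.
- by move=> w; exists 0.
- by move=> w w' _ [N h]; exists N.
- move=> w1 w2 w3 _ [N h] _ [N' h'].
  exists (N + N' + neg w2)%N => p.
  have := congr1 (iter (N' + neg w3) D) (h p).
  have := congr1 (iter (N + neg w1) D) (h' p); rewrite -!iterD => e' e.
  rewrite (_ : N + N' + _ + _ = N' + neg w3 + (N + neg w2))%N; last by lia.
  rewrite e (_ : N' + neg w3 + (N + neg w1) = N + neg w1 + (N' + neg w3))%N; last by lia.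
  by rewrite e'; congr (iter _ D _); lia.
- move=> u u' v v' _ [N h] _ [N' h']; exists (N + N')%N => p.
  rewrite /neg !count_cat -/(neg _) -/(neg _) -/(neg _) -/(neg _) /act !foldr_cat -!/(act _ _).
  rewrite (_ : N + N' + (_ + _) = N' + neg v' + (N + neg u'))%N; last by lia.
  rewrite iterD h -iterD (_ : N' + neg v' + _ = N + neg u + (N' + neg v'))%N; last by lia.
  rewrite iterD -act_iterD h' act_iterD -iterD.
  by congr (iter _ D _); lia.
- move=> s b; exists 0 => p; case: b; rewrite /neg /act /letter /=.
    by rewrite lmulM ?add_gen_w0 // cox_genK.
  have [t st] := w0_conj finW s.
  rewrite (lmul_w0_gen _ st) lmulM.
    by rewrite -mulgA (w0_gen st) cox_genK.
  by rewrite -(w0_gen st) add_gen_r rdesc_mul rdesc_longest inE.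
- move=> u v [s [t [k [st mst -> ->]]]]; exists 0 => p.
  have neg0 a : neg (positive_word a) = 0 by rewrite /neg count_map; exact: count_pred0.
  have actE a : act (positive_word a) p = foldr (fun s => lmul (g s)) p a.
    by rewrite /act foldr_map.
  have r1 := alternating_reduced st mst (leqnn k).
  have r2 : reduced m (alternating_word k t s).
    by rewrite /reduced -(cox_alternating st mst) (eqP r1) !size_alternating.
  by rewrite !neg0 !actE -(lmul_word p r1) -(lmul_word p r2) (cox_alternating st mst).
Qed.

(** On a normal stream D merely puts two copies of w_0 in front, since w_0 is linked to every
    element. Reading 2N places further on undoes D^N. *)
Let iterD_normal N p i : normal p -> iter N D p (N.*2 + i)%N = p i.
Proof.
move=> np; elim: N => [//|N IH] /=.
have link0 x : link w0 x by apply/forallP => s; rewrite rdesc_longest inE implybT.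
have nD n q : normal q -> normal (iter n D q).
  by elim: n => // n IHn nq; do 2 apply: lmul_normal; exact: IHn.
rewrite /D [lmul w0 (iter N D p)]lmul_link ?lmul_link //; last exact: nD.
have := @lmul_normal _ m w0 _ (nD N p np).
by rewrite lmul_link //; exact: nD.
Qed.

(** The stream of l is the action of a positive word on [ones], and the powers of D that the
    equality in A leaves on both sides can be undone on normal streams. So positive elements that
    are equal in the group have the same normal form. *)
Lemma simples_inj l1 l2 : simples l1 = simples l2 -> stream l1 = stream l2.
Proof.
have [u1 -> e1] := simples_artin_pos l1; have [u2 -> e2] := simples_artin_pos l2.
move=> /word_classP/equivP[N h].
have neg0 a : neg (positive_word a) = 0 by rewrite /neg count_map; exact: count_pred0.
have actE a p : act (positive_word a) p = foldr (fun s => lmul (g s)) p a.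
  by rewrite /act foldr_map.
have := h (@ones _ m); rewrite !neg0 addn0 !actE -e1 -e2 => e.
apply/funext => i.
by rewrite -(iterD_normal N i (stream_normal l1)) [stream l1]/stream e iterD_normal //;
  exact: stream_normal.
Qed.

Lemma simples_normal_inj l1 l2 : normal_seq l1 -> normal_seq l2 ->
  simples l1 = simples l2 -> nth 1 l1 =1 nth 1 l2.
Proof.
by move=> n1 n2 /simples_inj; rewrite !stream_normal_seq // => ->.
Qed.

End Spherical.
End Artin.

(** * The Garside element, fractions, and the balls of the positive monoids *)

Section Balls.
Variables (T : finType) (m : coxeter_matrix T).
Local Notation W := (coxeter_group m).
Local Notation A := (artin_group m).
Local Notation g := (cox_gen m).
Implicit Types (X : {set T}) (x y z : W) (s t : T) (l : seq W).

Definition all_par X l := forall x, x \in l -> par X x.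

Lemma all_par_nil X : all_par X [::].
Proof. by []. Qed.

Lemma all_par_cons X x l : par X x -> all_par X l -> all_par X (x :: l).
Proof. by move=> xX lX y; rewrite inE => /orP[/eqP ->|/lX]. Qed.

Lemma all_par_cat X l1 l2 : all_par X l1 -> all_par X l2 -> all_par X (l1 ++ l2).
Proof. by move=> h1 h2 y; rewrite mem_cat => /orP[/h1|/h2]. Qed.

Lemma all_par_setT l : all_par [set: T] l.
Proof. by move=> x _; exact: par_setT. Qed.

Lemma all_par_consE X x l : all_par X (x :: l) -> par X x /\ all_par X l.
Proof.
move=> h; split; first by apply: h; rewrite mem_head.
by move=> y yl; apply: h; rewrite inE yl orbT.
Qed.

Lemma simple_submonoid (P : set A) X : is_submonoid P ->
  (forall s, s \in X -> P (artin_gen m s)) -> forall l, all_par X l -> P (simples l).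
Proof.
move=> [P1 PM] PX; elim=> [_|x l IH /all_par_consE[xX lX]]; first by rewrite simples_nil.
rewrite simples_cons; apply: (PM); last exact: IH.
have [u [uX ru <-]] := par_reduced xX; rewrite simple_reduced //.
elim: u uX {ru} => [|s u IHu] /=; first by rewrite artin_pos_nil.
by move=> /andP[sX uX]; rewrite artin_pos_cons; apply: (PM); [exact: PX|exact: IHu].
Qed.

Lemma positive_parabolicP X a :
  positive_parabolic m [set` X] a <-> exists2 l, all_par X l & a = simples l.
Proof.
split=> [|[l lX ->] P [Pm PX]]; last first.
  by apply: (simple_submonoid Pm _ lX) => s sX; apply: PX; exists s.
move/(_ [set a | exists2 l, all_par X l & a = simples l]%classic); apply.
split; first split.
- by exists [::]; rewrite ?simples_nil //; exact: all_par_nil.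
- move=> _ _ [l1 h1 ->] [l2 h2 ->]; exists (l1 ++ l2); rewrite ?simples_cat //.
  exact: all_par_cat.
- move=> _ [s sX <-]; exists [:: g s]; rewrite ?simples1 ?simple_gen //.
  by apply: all_par_cons; [exact: par_gen|exact: all_par_nil].
Qed.

Lemma positive_monoidP a : positive_monoid m a <-> exists l, a = simples l.
Proof.
rewrite /positive_monoid; have -> : [set: T]%classic = [set` [set: T]%SET]%classic.
  by apply/seteqP; split=> x //= _; rewrite inE.
split=> [/positive_parabolicP[l _ ->]|[l ->]]; first by exists l.
by apply/positive_parabolicP; exists l => //; exact: all_par_setT.
Qed.

Section Spherical.
Hypothesis finW : spherical m.
Local Notation w0 := (longest finW [set: T]).
Local Notation longest := (longest finW).

Lemma stream0_pre x l : pre x (stream (x :: l) 0).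
Proof. by rewrite /= preM carry_add. Qed.

Lemma head_div X x l : all_par X l -> pre x (stream l 0) ->
  exists l', [/\ all_par X l', simples l = simple x * simples l' &
    total l = (len x + total l')%N].
Proof.
move=> lX; have sX := stream_par lX; rewrite stream_normal_form in sX *.
rewrite -simples_normal_form -total_normal_form.
have nfX : all_par X (normal_form l) by move=> y /(nthP 1)[i _ <-].
case: (normal_form l) nfX => [|y r] /=.
  move=> _ /pre_1 ->; exists [::]; rewrite simple1 simples_nil mulg1 len1.
  by split=> //; exact: all_par_nil.
move=> /all_par_consE[yX rX] xy; exists (x^-1 * y :: r); split.
- by apply: all_par_cons => //; apply: par_mul => //; exact/par_inv/(par_pre xy).
- by rewrite !simples_cons (simple_pre xy) mulgA.
- by rewrite /total !big_cons addnA -(addE xy) mulVKg.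
Qed.

(** The total length is additive and depends only on the element, so A^+ has no invertible element
    but 1. This gives the uniqueness of the Garside element. *)
Lemma simples_eq1 l l' : simples l * simples l' = 1 -> simples l = 1.
Proof.
rewrite -simples_cat -(simples_nil m) => /(simples_inj finW) e.
have : total (l ++ l') = 0.
  rewrite -total_normal_form /total big_seq big1 // => x /(nthP 1)[i _ <-].
  by rewrite -stream_normal_form e len1.
rewrite /total big_cat /= => /eqP; rewrite addn_eq0 => /andP[/eqP tl _].
have : all_par finset.set0 l.
  move=> x xl; have /len_eq0 -> : len x = 0; last exact: par1.
  by move: tl; rewrite (big_rem x xl) /=; lia.
elim: l {tl e} => // x l IH /all_par_consE[].
move=> [[|s u] /=]; last by rewrite inE.
by move=> _ <- /IH; rewrite simples_cons cox_prod_nil simple1 simples_nil => ->; rewrite mulg1.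
Qed.

Lemma simple_w0 x : simple w0 = simple x * simple (x^-1 * w0).
Proof. by rewrite -simple_pre //; exact: pre_w0. Qed.

Lemma garside_elementP (s0 : T) d : is_garside_element d <-> d = simple w0.
Proof.
have gle s : prefix_le (artin_gen m s) (simple w0).
  rewrite /prefix_le (simple_w0 (g s)) simple_gen mulKg.
  by apply/positive_monoidP; exists [:: (g s)^-1 * w0]; rewrite simples1.
have least b : (forall s, prefix_le (artin_gen m s) b) -> prefix_le (simple w0) b.
  move=> hb; have /positive_monoidP[l0 bE] := hb s0.
  have {bE} [l bE] : exists l, b = simples l.
    exists (g s0 :: l0); rewrite simples_cons -bE simple_gen mulVKg //.
  (* Every generator divides b, hence the head of the normal form of b, and only w_0 has all
     generators as left descents. *)
  have desc s : ldesc (stream l 0) s.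
    have /positive_monoidP[l' e] := hb s.
    rewrite -pre_gen (_ : stream l = stream (g s :: l')) ?stream0_pre //.
    by apply: (simples_inj finW); rewrite simples_cons -e simple_gen bE mulVKg.
  have e : stream l 0 = w0.
    suff : stream l 0 * w0 = 1 by move=> /mulg1_eq h; rewrite -(longestV finW) -h invgK.
    by apply: contrapT => /ldesc_ex [s]; rewrite ldesc_w0r desc.
  have [|l' [_ lE _]] := @head_div [set: T] w0 l (@all_par_setT l).
    by rewrite e; exact: pre_refl.
  by apply/positive_monoidP; exists l'; rewrite bE lE mulKg.
split=> [[h1 h2]|->]; last by split.
have /positive_monoidP[l1 e1] := h2 _ gle.
have /positive_monoidP[l2 e2] := least _ h1.
have := @simples_eq1 l1 l2; rewrite -e1 -e2 mulgA mulgK mulVg => /(_ erefl) /mulg1_eq.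
by rewrite invgK.
Qed.

Lemma garside_setP (s0 : T) a : garside_set m a <-> exists x, a = simple x.
Proof.
split=> [[d /(garside_elementP s0) -> [/positive_monoidP[l e1] /positive_monoidP[l' e2]]]|[x ->]];
  last first.
  exists (simple w0); first exact/garside_elementP.
  split; apply/positive_monoidP; first by exists [:: x]; rewrite simples1 invg1 mul1g.
  by exists [:: x^-1 * w0]; rewrite simples1 (simple_w0 x) mulKg.
rewrite invg1 mul1g in e1; have {e2} : simples l * simples l' = simple w0.
  by rewrite -e1 -e2 mulVKg.
(* A left divisor of a simple element is simple: its first factor u is a prefix of w, and what
   remains divides u^-1 w. *)
suff claim w : simples l * simples l' = simple w -> exists2 x, simples l = simple x & pre x w.
  by rewrite e1 => /claim[x -> _]; exists x.
elim: l w {a e1} => [|u l IH] w.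
  by exists 1; rewrite ?simple1 ?simples_nil //; exact: pre1.
rewrite simples_cons -mulgA => e.
have uw : pre u w.
  have : stream (u :: l ++ l') = stream [:: w].
    by apply: (simples_inj finW); rewrite simples1 -e simples_cons simples_cat.
  by move=> /(congr1 (@^~ 0)); rewrite [stream [:: w] 0]/= carry1r mulg1 => <-;
     exact: stream0_pre.
have [] := IH (u^-1 * w); first by apply: (mulgI (simple u)); rewrite e -simple_pre.
move=> x lx xw; exists (u * x).
  by rewrite lx simpleM // (add_pre _ xw).
rewrite -[w](mulVKg u); exact: pre_mul2l.
Qed.

Lemma simples_nseq1 n : simples (nseq n (1 : W)) = 1.
Proof. by elim: n => [|n IH]; rewrite ?simples_nil //= simples_cons IH simple1 mulg1. Qed.

Lemma simples_nth l l' : nth 1 l =1 nth 1 l' -> simples l = simples l'.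
Proof.
elim: l l' => [|x l IH] l' h.
  rewrite (_ : l' = nseq (size l') 1) ?simples_nseq1 ?simples_nil //.
  apply: (@eq_from_nth _ 1); rewrite ?size_nseq // => i il.
  by rewrite -h nth_nil nth_nseq il.
case: l' h => [|y l'] h; have /= h0 := h 0; last first.
  by rewrite !simples_cons h0 (IH l') // => i; exact: (h i.+1).
rewrite simples_cons h0 (IH [::]) ?simples_nil ?simple1 ?mulg1 // => i.
by have /= -> := h i.+1; rewrite !nth_nil.
Qed.

Lemma stream_end l i : (size l <= i)%N -> stream l i = 1.
Proof. by move=> li; rewrite stream_normal_form nth_default // size_normal_form. Qed.

Lemma simples_trunc X l n : all_par X l -> (forall i, (n <= i)%N -> stream l i = 1) ->
  let l' := mkseq (stream l) n in
  [/\ normal_seq l', all_par X l' & simples l' = simples l].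
Proof.
move=> lX ln l'; have e : nth 1 l' = stream l.
  apply/funext => i; have [il|il] := ltnP i n; first by rewrite nth_mkseq.
  by rewrite nth_default ?size_mkseq // ln.
split.
- by move=> i; rewrite e; exact: stream_normal.
- by move=> x /(nthP 1)[i _ <-]; rewrite e; exact: stream_par.
- by rewrite -[RHS]simples_normal_form; apply: simples_nth; rewrite e stream_normal_form.
Qed.

(** Word length in the simple elements of A is the length of the normal form, whose factors stay in
    W_X for elements of A_X^+. Shorter normal forms are padded by 1, so sequences of length exactly
    n describe the whole ball. *)
Lemma positive_ballP (s0 : T) X n a :
  ball_in (positive_parabolic m [set` X]) (garside_set m) n a <->
  exists l, [/\ normal_seq l, size l = n, all_par X l & a = simples l].
Proof.
split=> [|[l [nl ln lX ->]]]; last first.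
  split; first by apply/positive_parabolicP; exists l.
  exists [seq simple x | x <- l]; rewrite size_map ln big_map; split=> // x.
  by move=> /mapP[y _ ->]; apply/(garside_setP s0); exists y.
move=> [/positive_parabolicP[l lX ->] [w [wn wS we]]].
have [l2 [l2n l2E]] : exists l2, (size l2 <= n)%N /\ simples l = simples l2.
  rewrite -we; elim: w n wn wS {we} => [|x w IH] n wn wS.
    by exists [::]; rewrite simples_nil big_nil.
  case: n wn => // n wn; have [y yw|l2 [l2n e]] := IH n wn.
    by apply: wS; rewrite inE yw orbT.
  have /(garside_setP s0)[y xE] := wS x (mem_head _ _).
  by exists (y :: l2); rewrite simples_cons big_cons e xE.
have [|nl pl e] := @simples_trunc X l n lX.
  by move=> i ni; rewrite (simples_inj finW l2E) stream_end // (leq_trans l2n).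
by exists (mkseq (stream l) n); split=> //; rewrite size_mkseq.
Qed.

(** w_X is a common left multiple: w_X = (w_X x^-1) x = (w_X y^-1) y, both products being reduced.
    This turns right fractions into left ones without leaving W_X. *)
Lemma swap1 X x y : par X x -> par X y -> exists x' y', [/\ par X x', par X y' &
  simple x * (simple y)^-1 = (simple y')^-1 * simple x'].
Proof.
move=> xX yX; have dX := longest_par finW X.
exists (longest X * y^-1), (longest X * x^-1).
split; [by apply: par_mul => //; exact: par_inv..|].
have hx := simpleM (longest_suffix finW xX); rewrite mulgVK in hx.
have hy := simpleM (longest_suffix finW yX); rewrite mulgVK in hy.
apply: (mulgI (simple (longest X * x^-1))); rewrite mulVKg mulgA -hx hy.
by rewrite mulgK.
Qed.

Lemma swapl X x l : par X x -> all_par X l -> exists x' l',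
  [/\ par X x', all_par X l', size l' = size l &
  simple x * (simples l)^-1 = (simples l')^-1 * simple x'].
Proof.
elim: l x => [|y l IH] x xX.
  move=> _; exists x, [::]; rewrite simples_nil invg1 mulg1 mul1g.
  by split=> //; exact: all_par_nil.
move=> /all_par_consE[yX lX]; have [x1 [l' [x1X lX' sl e]]] := IH x xX lX.
have [x2 [y' [x2X yX' e']]] := swap1 x1X yX.
exists x2, (y' :: l'); split=> //=; [exact: all_par_cons|by rewrite sl|].
by rewrite !simples_cons !invgM mulgA e -mulgA e' mulgA.
Qed.

Lemma swap X l1 l2 : all_par X l1 -> all_par X l2 -> exists l1' l2',
  [/\ all_par X l1', all_par X l2', size l1' = size l1, size l2' = size l2 &
  simples l1 * (simples l2)^-1 = (simples l2')^-1 * simples l1'].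
Proof.
elim: l1 l2 => [|x l1 IH] l2.
  move=> _ h2; exists [::], l2; split=> //.
  by rewrite simples_nil mulg1 mul1g.
move=> /all_par_consE[xX h1] h2; have [a [b [aX bX sa sb e]]] := IH l2 h1 h2.
have [x' [b' [xX' bX' sb' e']]] := swapl xX bX.
exists (x' :: a), b'; split=> //=; [exact: all_par_cons|by rewrite sa|by rewrite sb'|].
by rewrite !simples_cons -mulgA e mulgA e' mulgA.
Qed.

Lemma parabolicP X a : parabolic m [set` X] a <->
  exists l1 l2, [/\ all_par X l1, all_par X l2 & a = (simples l1)^-1 * simples l2].
Proof.
split=> [|[l1 [l2 [h1 h2 ->]]] P [[Pm Pv] PX]]; last first.
  have PS l : all_par X l -> P (simples l).
    by move=> lX; apply: (simple_submonoid Pm _ lX) => s sX; apply: PX; exists s.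
  by have [_ PM] := Pm; apply: (PM); [exact/Pv/PS|exact: PS].
move/(_ [set a | exists l1 l2,
  [/\ all_par X l1, all_par X l2 & a = (simples l1)^-1 * simples l2]]%classic).
apply; split; first split; first split.
- by exists [::], [::]; rewrite simples_nil mulVg; split=> //; exact: all_par_nil.
- move=> _ _ [a1 [b1 [h1 h2 ->]]] [a2 [b2 [h3 h4 ->]]].
  have [b1' [a2' [bX aX _ _ e]]] := swap h2 h3.
  exists (a2' ++ a1), (b1' ++ b2); split; [exact: all_par_cat..|].
  by rewrite !simples_cat invgM -mulgA [simples b1 * _]mulgA e !mulgA.
- move=> _ [a1 [b1 [h1 h2 ->]]]; exists b1, a1; split=> //.
  by rewrite invgM invgK.
- move=> _ [s sX <-]; exists [::], [:: g s].
  rewrite simples_nil invg1 mul1g simples1 simple_gen; split=> //.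
  by apply: all_par_cons; [exact: par_gen|exact: all_par_nil].
Qed.

Lemma fraction a : exists l1 l2, a = (simples l1)^-1 * simples l2 :> A.
Proof.
suff /parabolicP[l1 [l2 [_ _ ->]]] : parabolic m [set` [set: T]%SET] a by exists l1, l2.
move=> P [[[P1 PM] Pv] PX]; elim/presented_ind: a => // s b y Py; apply: (PM) => //.
have Ps : P (artin_gen m s) by apply: PX; exists s => //=; rewrite inE.
by case: b => //; rewrite word_class_neg; exact: Pv.
Qed.

End Spherical.
End Balls.

(** * Reduced fractions and the balls of the groups *)

Section GroupBalls.
Variables (T : finType) (m : coxeter_matrix T).
Local Notation W := (coxeter_group m).
Local Notation A := (artin_group m).
Local Notation g := (cox_gen m).
Implicit Types (X : {set T}) (x y z : W) (s t : T) (l : seq W).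

Lemma lmul_one x p i : lmul x p i = 1 -> p i = 1.
Proof.
elim: i x p => [|i IH] x p /=; last exact: IH.
move=> h; have := carry_add x (p 0); rewrite /add h len1 eq_sym addn_eq0.
by case/andP => /eqP/len_eq0 x1 _; move: h; rewrite x1 carry1l mul1g.
Qed.

Lemma stream_suffix_end l1 l2 n : (forall i, (n <= i)%N -> stream (l1 ++ l2) i = 1) ->
  forall i, (n <= i)%N -> stream l2 i = 1.
Proof. by elim: l1 => //= x l1 IH h; apply: IH => i /h; exact: lmul_one. Qed.

Hypothesis finW : spherical m.
Variable s0 : T.
Local Notation longest := (longest finW).

(** Minimality of reduced fractions: if la^-1 lb = c^-1 d, then e = c la^-1 = d lb^-1 is positive.
    Write e = f1^-1 f; the first factor of f1 divides both f la and f lb, hence f by [coprime_head],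
    and cancels. *)
Lemma coprime_fraction la lb lc ld (e : A) :
  (forall s, ldesc (stream la 0) s -> ~~ ldesc (stream lb 0) s) ->
  e * simples la = simples lc -> e * simples lb = simples ld ->
  exists l, e = simples l.
Proof.
move=> cop; have [f1 [f ->]] := fraction finW e => {e}.
elim: f1 f lc ld => [|x f1 IH] f lc ld ea eb.
  by exists f; rewrite simples_nil invg1 mul1g.
have [u fu _] := simples_artin_pos f; rewrite artin_pos_simples in fu.
have pre_x l l' : (simples (x :: f1))^-1 * simples f * simples l = simples l' ->
    pre x (stream (map g u ++ l) 0).
  move=> h; suff -> : stream (map g u ++ l) = stream (x :: f1 ++ l') by exact: stream0_pre.
  apply: (simples_inj finW); rewrite -cat_cons !simples_cat -h -fu.
  by rewrite !mulgA mulgV mul1g.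
have px := coprime_head cop (pre_x _ _ ea) (pre_x _ _ eb).
have [f' [_ fE _]] := head_div (@all_par_setT _ _ (map g u)) px.
have eE : (simples (x :: f1))^-1 * simples f = (simples f1)^-1 * simples f'.
  by rewrite fu fE simples_cons invgM -mulgA mulKg.
by rewrite eE in ea eb *; exact: IH ea eb.
Qed.

Lemma coprime_rep X a : parabolic m [set` X] a -> exists la lb,
  [/\ all_par X la, all_par X lb, a = (simples la)^-1 * simples lb &
   forall s, ldesc (stream la 0) s -> ~~ ldesc (stream lb 0) s].
Proof.
move=> /(parabolicP finW)[la [lb [h1 h2 ->]]].
move: {2}(total lb) (leqnn (total lb)) => n; elim: n la lb h1 h2 => [|n IH] la lb h1 h2 ln.
  exists la, lb; split=> // s _; apply/negP; rewrite -pre_gen => /(head_div h2)[l' [_ _]].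
  by rewrite len_gen; lia.
have [[s [sa sb]]|none] := pselect (exists s, ldesc (stream la 0) s /\ ldesc (stream lb 0) s).
  rewrite -!pre_gen in sa sb.
  have [la' [h1' ea _]] := head_div h1 sa; have [lb' [h2' eb tb]] := head_div h2 sb.
  rewrite ea eb invgM -mulgA mulKg; apply: IH => //.
  by move: tb ln; rewrite len_gen; lia.
exists la, lb; split=> // s sa; apply/negP => sb; apply: none.
by exists s.
Qed.

Lemma simple_longest_conj X x : par X x -> exists2 y, par X y &
  simple (longest X) * simple x = simple y * simple (longest X).
Proof.
move=> xX; have dX := longest_par finW X.
pose z := longest X * x^-1.
have zX : par X z by apply: par_mul => //; exact: par_inv.
have e1 := simpleM (longest_suffix finW xX); rewrite mulgVK -/z in e1.
have zy : par X (longest X * z^-1) by apply: par_mul => //; exact: par_inv.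
have e2 := simpleM (longest_suffix finW zX); rewrite mulgVK in e2.
exists (longest X * z^-1) => //.
by rewrite {1}e2 e1 mulgA.
Qed.

Lemma simples_longest_conj X l : all_par X l -> exists l',
  [/\ all_par X l', size l' = size l &
  simple (longest X) * simples l = simples l' * simple (longest X)].
Proof.
elim: l => [_|x l IH /all_par_consE[xX lX]].
  by exists [::]; rewrite simples_nil mulg1 mul1g.
have [y yX e] := simple_longest_conj xX; have [l' [lX' sl e']] := IH lX.
exists (y :: l'); split=> /=; [exact: all_par_cons|by rewrite sl|].
by rewrite !simples_cons mulgA e -mulgA e' mulgA.
Qed.

(** Conjugation by w_X preserves W_X, so the copies of w_X can be moved next to the factors of l and
    divided by them one at a time. *)
Lemma longest_pow_div X l : all_par X l -> exists l',
  [/\ all_par X l', size l' = size l &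
  simple (longest X) ^+ size l * (simples l)^-1 = simples l'].
Proof.
elim: l => [_|x l IH /all_par_consE[xX lX]].
  by exists [::]; rewrite simples_nil invg1 mulg1.
have [l1 [h1 s1 e1]] := IH lX; have [l2 [h2 s2 e2]] := simples_longest_conj h1.
have e := simpleM (longest_suffix finW xX); rewrite mulgVK in e.
exists (rcons l2 (longest X * x^-1)); split.
- move=> y; rewrite mem_rcons inE => /orP[/eqP ->|/h2 //].
  by apply: par_mul; [exact: longest_par|exact: par_inv].
- by rewrite size_rcons s2 s1.
rewrite [size _]/= simples_cons invgM expgS -mulgA [_ * ((simples l)^-1 * _)]mulgA e1.
rewrite mulgA e2 -cats1 simples_cat simples1 {1}e -!mulgA; congr (_ * _).
by rewrite mulgV mulg1.
Qed.

Lemma pm_fraction (w : seq A) : (forall a, a \in w -> garside_set_pm m a) ->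
  exists c d, (size c + size d = size w)%N /\ \prod_(a <- w) a = (simples c)^-1 * simples d :> A.
Proof.
elim: w => [|a w IH] wS.
  by exists [::], [::]; rewrite !simples_nil big_nil mulVg.
have [b bw|c [d [sz e]]] := IH; first by apply: wS; rewrite inE bw orbT.
have : garside_set_pm m a by apply: wS; rewrite mem_head.
rewrite big_cons e.
case=> [/(garside_setP finW s0)[x ->]|[_ /(garside_setP finW s0)[x ->] <-]].
  have [x' [c' [_ _ sc e']]] := swapl finW (par_setT x) (@all_par_setT _ _ c).
  exists c', (x' :: d); split; first by rewrite /= sc addnS sz.
  by rewrite mulgA e' simples_cons mulgA.
exists (rcons c x), d; split; first by rewrite size_rcons /= addSn sz.
by rewrite -cats1 simples_cat simples1 invgM mulgA.
Qed.

(** The word may leave A_X, but the reduced fraction la^-1 lb of a stays in A_X and divides the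
    fraction c^-1 d read off the word, so la and lb have at most size c and size d nontrivial
    factors. Multiplication by the power size c of w_X turns la^-1 into a positive element. Besides
    a normal sequence only the exponent k <= n is left, whence the factor n + 1 in [card_ball]. *)
Lemma pm_ballP X n a :
  ball_in (parabolic m [set` X]) (garside_set_pm m) n a ->
  exists k l, [/\ (k <= n)%N, normal_seq l, size l = n, all_par X l &
    a = simple (longest X) ^- k * simples l].
Proof.
case=> aX [w [wn wS wE]]; have [c [d [sz e]]] := pm_fraction wS.
rewrite wE in e; have [la [lb [h1 h2 aE cop]]] := coprime_rep aX.
pose x := simples c * (simples la)^-1.
have xa : x * simples la = simples c by rewrite /x mulgVK.
have xb : x * simples lb = simples d.
  by rewrite /x -mulgA -aE e mulVKg.
have [f fE] := coprime_fraction cop xa xb.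
have endl l1 l2 : x * simples l1 = simples l2 -> forall i, (size l2 <= i)%N -> stream l1 i = 1.
  move=> h; apply: (@stream_suffix_end f) => i; rewrite (_ : stream (f ++ l1) = stream l2).
    exact: stream_end.
  by apply: (simples_inj finW); rewrite simples_cat -fE h.
have [_ la'X laE] := simples_trunc h1 (endl _ _ xa).
have [_ lb'X lbE] := simples_trunc h2 (endl _ _ xb).
have [l1 [l1X sl1 l1E]] := longest_pow_div la'X.
rewrite size_mkseq in l1E sl1.
have lX := all_par_cat l1X lb'X.
have [|nl pl le] := @simples_trunc _ _ X _ n lX.
  by move=> i ni; apply: stream_end; rewrite size_cat sl1 size_mkseq sz; exact: leq_trans ni.
exists (size c), (mkseq (stream (l1 ++ mkseq (stream lb) (size d))) n); split=> //.
- by apply: leq_trans wn; rewrite -sz leq_addr.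
- by rewrite size_mkseq.
by rewrite le simples_cat -l1E laE lbE aE mulgA mulKg.
Qed.

Lemma ball_sub X n a :
  ball_in (positive_parabolic m [set` X]) (garside_set m) n a ->
  ball_in (parabolic m [set` X]) (garside_set_pm m) n a.
Proof.
case=> aX [w [wn wS wE]]; split; last by exists w; split=> // x /wS; left.
move/positive_parabolicP: aX => [l lX ->]; apply/(parabolicP finW).
by exists [::], l; rewrite simples_nil invg1 mul1g.
Qed.

End GroupBalls.

Lemma card_fset_set_le (G : choiceType) (B : set G) (r : seq G) :
  (forall x, B x -> x \in r) -> (#|` fset_set B|%fset <= size r)%N.
Proof.
move=> Br; have finB : finite_set B.
  by apply: (@sub_finite_set _ _ [set` r]%classic) => //; exact: finite_seq.
by apply: uniq_leq_size => // x; rewrite in_fset_set // inE => /Br.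
Qed.

Lemma card_fset_set_ge (G : choiceType) (B : set G) (r r' : seq G) : uniq r ->
  (forall x, x \in r -> B x) -> (forall x, B x -> x \in r') ->
  (size r <= #|` fset_set B|%fset)%N.
Proof.
move=> ur rB Br; have finB : finite_set B.
  by apply: (@sub_finite_set _ _ [set` r']%classic) => //; exact: finite_seq.
by apply: uniq_leq_size => // x /rB Bx; rewrite in_fset_set // inE.
Qed.

(** * Counting normal paths *)

Section Paths.
Variables (T : finType) (m : coxeter_matrix T).
Local Notation W := (coxeter_group m).
Local Notation A := (artin_group m).
Implicit Types (X Y I J : {set T}) (x y z : W) (s t : T) (l : seq W).
Hypothesis finW : spherical m.

Definition elements : seq W := sval (cid (cox_enum finW)).

Lemma elements_uniq : uniq elements.
Proof. by have [] := svalP (cid (cox_enum finW)). Qed.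

Lemma mem_elements x : x \in elements.
Proof. by have [_] := svalP (cid (cox_enum finW)); exact. Qed.

Definition ldescs x : {set T} := [set s | ldesc x s].
Definition rdescs x : {set T} := [set s | rdesc x s].

Lemma linkE x y : link x y = (ldescs y \subset rdescs x).
Proof.
apply/forallP/fintype.subsetP => [h s|h s].
  by rewrite !inE; exact/implyP.
by apply/implyP; have := h s; rewrite !inE.
Qed.

(** I bounds the left descents of the first vertex: what precedes a path matters only through the
    right descents of its last element, here called a state. *)
Fixpoint paths X (n : nat) I : seq (seq W) := if n is n'.+1 then
  [seq x :: l | x <- [seq x <- elements | `[< par X x >] && (ldescs x \subset I)],
                l <- paths X n' (rdescs x)]
  else [:: [::]].

Definition npaths X n I := size (paths X n I).

Lemma npathsE X n I : npaths X n I = size (paths X n I).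
Proof. by []. Qed.

Fixpoint path_from I l : bool :=
  if l is x :: l' then (ldescs x \subset I) && path_from (rdescs x) l' else true.

Lemma pathsP X n I l :
  reflect [/\ size l = n, all_par X l & path_from I l] (l \in paths X n I).
Proof.
elim: n I l => [|n IH] I l.
  apply: (iffP idP); first by rewrite inE => /eqP ->.
  by case=> /size0nil ->.
apply: (iffP allpairsPdep) => [[x [l' [+ /IH[sl pl fl] ->]]]|[]].
  rewrite mem_filter => /andP[/andP[/asboolP xX xI] _].
  by split=> /=; [rewrite sl|exact: all_par_cons|rewrite xI].
case: l => // x l [sl] /all_par_consE[xX lX] /= /andP[xI fl].
exists x, l; split=> //; last by apply/IH.
by rewrite mem_filter mem_elements andbT xI andbT; exact/asboolP.
Qed.

Lemma paths_uniq X n I : uniq (paths X n I).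
Proof.
elim: n I => [//|n IH] I; apply: allpairs_uniq_dep => //.
- by apply: filter_uniq; exact: elements_uniq.
- by move=> [x l] [y l'] _ _ /= [-> ->].
Qed.

Lemma ldescs1 : ldescs 1 = finset.set0.
Proof. by apply/finset.setP => s; rewrite !inE /ldesc mulg1 len_gen len1. Qed.

Lemma path_from_normal l : path_from [set: T] l <-> normal_seq l.
Proof.
have E x l0 : path_from (rdescs x) l0 <-> normal_seq (x :: l0).
  elim: l0 x => [|y l0 IH] x /=.
    split=> // _ [|i]; first by rewrite linkE ldescs1 finset.sub0set.
    by rewrite /= nth_nil linkE ldescs1 finset.sub0set.
  split=> [/andP[xy /IH h] [|i]|h]; first by rewrite linkE.
    exact: h.
  apply/andP; split; first by rewrite -linkE; exact: (h 0).
  by apply/IH => i; exact: (h i.+1).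
case: l => [|x l] /=.
  by split=> // _ i; rewrite !nth_nil linkE ldescs1 finset.sub0set.
by rewrite finset.subsetT; exact: E.
Qed.

Lemma path_fromS I J l : I \subset J -> path_from I l -> path_from J l.
Proof.
by case: l => //= x l IJ /andP[xI ->]; rewrite (fintype.subset_trans xI IJ).
Qed.

Lemma npathsS X Y n I J : X \subset Y -> I \subset J -> (npaths X n I <= npaths Y n J)%N.
Proof.
move=> XY IJ; apply: uniq_leq_size; first exact: paths_uniq.
move=> l /pathsP[sl lX lI]; apply/pathsP; split=> //; last exact: path_fromS IJ lI.
by move=> x /lX; exact: par_sub.
Qed.

Lemma npaths_gt0 X n I : (0 < npaths X n I)%N.
Proof.
rewrite /npaths -has_predT; apply/hasP; exists (nseq n 1) => //; apply/pathsP.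
split; first by rewrite size_nseq.
  by move=> x; rewrite mem_nseq => /andP[_ /eqP ->]; exact: par1.
by elim: n I => //= n IH I; rewrite ldescs1 finset.sub0set IH.
Qed.

Lemma path_from_cat I l1 l2 :
  path_from I (l1 ++ l2) = path_from I l1 && path_from (foldl (fun _ x => rdescs x) I l1) l2.
Proof. by elim: l1 I => //= x l1 IH I; rewrite IH andbA. Qed.

Lemma npathsD X n k I : (npaths X (n + k) I <= npaths X n I * npaths X k [set: T])%N.
Proof.
pose cut l := (take n l, drop n l).
have u : uniq [seq cut l | l <- paths X (n + k) I].
  rewrite map_inj_in_uniq ?paths_uniq // => l l' _ _ [e1 e2].
  by rewrite -(cat_take_drop n l) e1 e2 cat_take_drop.
pose r := [seq (l1, l2) | l1 <- paths X n I, l2 <- paths X k [set: T]].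
have -> : (npaths X n I * npaths X k [set: T])%N = size r by rewrite size_allpairs.
rewrite /npaths -(size_map cut); apply: uniq_leq_size => //.
move=> p /mapP[l /pathsP[sl lX fl] ->]; apply: allpairs_f.
    apply/pathsP; split; first by rewrite size_take sl; case: ltnP => //; lia.
      by move=> x /mem_take/lX.
    by move: fl; rewrite -{1}(cat_take_drop n l) path_from_cat => /andP[].
  apply/pathsP; split; first by rewrite size_drop sl addKn.
    by move=> x /mem_drop/lX.
  move: fl; rewrite -{1}(cat_take_drop n l) path_from_cat => /andP[_].
by apply: path_fromS; exact: finset.subsetT.
Qed.

Variable s0 : T.

Definition path_simples X n : seq A := [seq simples l | l <- paths X n [set: T]].

Lemma path_simples_uniq X n : uniq (path_simples X n).
Proof.
rewrite map_inj_in_uniq ?paths_uniq // => l l'.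
move=> /pathsP[sl _ /path_from_normal nl] /pathsP[sl' _ /path_from_normal nl'] e.
apply: (@eq_from_nth _ 1); first by rewrite sl sl'.
by move=> i _; exact: (simples_normal_inj finW nl nl' e).
Qed.

Lemma mem_path_simples X n a : a \in path_simples X n <->
  exists l, [/\ normal_seq l, size l = n, all_par X l & a = simples l].
Proof.
split=> [/mapP[l /pathsP[sl lX /path_from_normal nl] ->]|[l [nl sl lX ->]]].
  by exists l.
by apply: map_f; apply/pathsP; split=> //; apply/path_from_normal.
Qed.

Lemma card_positive_ball X n :
  #|` fset_set (ball_in (positive_parabolic m [set` X]) (garside_set m) n)|%fset =
  npaths X n [set: T].
Proof.
rewrite /npaths -(size_map (@simples _ m)) -/(path_simples X n).
have memP a : ball_in (positive_parabolic m [set` X]) (garside_set m) n a <->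
    a \in path_simples X n.
  by split=> [/(positive_ballP finW s0)/mem_path_simples|
              /mem_path_simples/(positive_ballP finW s0)].
apply/eqP; rewrite eqn_leq; apply/andP; split.
  by apply: card_fset_set_le => a /memP.
exact: (card_fset_set_ge (path_simples_uniq X n)
  (fun a => proj2 (memP a)) (fun a => proj1 (memP a))).
Qed.

Lemma card_ball X n :
  let c := #|` fset_set (ball_in (parabolic m [set` X]) (garside_set_pm m) n)|%fset in
  (npaths X n [set: T] <= c <= n.+1 * npaths X n [set: T])%N.
Proof.
pose r := [seq simple (longest finW X) ^- k * a | k <- iota 0 n.+1, a <- path_simples X n].
have Br a : ball_in (parabolic m [set` X]) (garside_set_pm m) n a -> a \in r.
  move=> /(pm_ballP finW s0)[k [l [kn nl sl lX ->]]]; apply: allpairs_f.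
    by rewrite mem_iota.
  by apply/mem_path_simples; exists l.
apply/andP; split; last first.
  by apply: leq_trans (card_fset_set_le Br) _; rewrite size_allpairs size_iota size_map.
rewrite /npaths -(size_map (@simples _ m)) -/(path_simples X n).
apply: (card_fset_set_ge (path_simples_uniq X n) _ Br) => a.
by move=> /mem_path_simples/(positive_ballP finW s0)/(ball_sub finW).
Qed.

End Paths.

(** * Growth rates of submultiplicative sequences *)

Section GrowthRate.
Local Open Scope classical_set_scope.
Local Open Scope ring_scope.
Variable R : realType.
Implicit Types (a x : nat -> nat) (mu : R).

Lemma expr_ge_linear (d : R) n : 0 <= d -> 1 + n%:R * d <= (1 + d) ^+ n.
Proof.
move=> d0; elim: n => [|n IH]; first by rewrite mul0r addr0 expr0.
rewrite exprS -natr1; have h : 0 <= n%:R * (d * d) by rewrite !mulr_ge0.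
apply: le_trans (_ : (1 + d) * (1 + n%:R * d) <= _); first by nra.
by apply: ler_wpM2l => //; rewrite addr_ge0.
Qed.

Lemma linear_le_expr (C q : R) : 1 < q ->
  exists N, forall n, (N <= n)%N -> n.+1%:R * C <= q ^+ n.
Proof.
(* With q = (1 + d)^2 Bernoulli's inequality gives q^n >= (n d)^2, and a quadratic function exceeds
   a linear one. *)
move=> q1; pose d := Num.sqrt q - 1.
have s1 : 1 < Num.sqrt q by rewrite -sqrtr1 ltr_sqrt // (lt_trans ltr01).
have d0 : 0 < d by rewrite subr_gt0.
pose b := 2 * `|C| / d ^+ 2.
have b0 : 0 <= b by rewrite !mulr_ge0 // invr_ge0 sqr_ge0.
exists (Num.bound b).+1 => n Nn.
have nb : b <= n%:R.
  apply: le_trans (ltW (archi_boundP b0)) _.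
  by rewrite ler_nat ltnW.
have n1 : 1 <= n%:R :> R by rewrite ler1n (leq_trans _ Nn).
have -> : q = (1 + d) ^+ 2 by rewrite addrC subrK sqr_sqrtr // ltW // (lt_trans ltr01).
rewrite -exprM mulnC exprM.
have h := expr_ge_linear n (ltW d0).
have h2 : (n%:R * d) ^+ 2 <= ((1 + d) ^+ n) ^+ 2.
  have : 0 <= n%:R * d by rewrite mulr_ge0 ?(ltW d0).
  move: h; rewrite !expr2; move: (n%:R * d) ((1 + d) ^+ n) => u v; nra.
apply: le_trans h2; rewrite exprMn.
have h3 : 2 * `|C| <= n%:R * d ^+ 2 by rewrite -ler_pdivrMr ?exprn_gt0.
have hC : C <= `|C| := ler_norm C.
have C0 : 0 <= `|C| by [].
rewrite -natr1; move: h3 hC C0; set D := d ^+ 2; move: n%:R `|C| n1 => y c y1 h3 hC c0.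
nra.
Qed.

Lemma rootrK (mu : R) n : 0 <= mu -> (0 < n)%N -> (mu ^+ n) `^ n%:R^-1 = mu.
Proof.
move=> mu0 n0; rewrite -powR_mulrn // -powRrM mulfV ?powRr1 //.
by rewrite pnatr_eq0 -lt0n.
Qed.

Lemma growth_criterion x (lam : R) : 0 <= lam ->
  (forall n, lam ^+ n <= (x n)%:R) ->
  (forall mu, lam < mu -> exists N, forall n, (N <= n)%N -> (x n)%:R <= mu ^+ n) ->
  (x n)%:R `^ n%:R^-1 @[n --> \oo] --> lam.
Proof.
move=> lam0 lo up; apply/cvgrPdist_le => e e0.
have [|N hN] := up (lam + e); first by rewrite ltrDl.
near=> n.
have n0 : (0 < n)%N by near: n; exact: nbhs_infty_gt.
have nN : (N <= n)%N by near: n; exact: nbhs_infty_ge.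
have h1 : lam <= (x n)%:R `^ n%:R^-1.
  rewrite -{1}(rootrK lam0 n0); apply: ge0_ler_powR; rewrite ?nnegrE ?exprn_ge0 //.
have h2 : (x n)%:R `^ n%:R^-1 <= lam + e.
  rewrite -(@rootrK (lam + e) n) ?addr_ge0 ?(ltW e0) //.
  apply: ge0_ler_powR; rewrite ?nnegrE ?exprn_ge0 ?addr_ge0 ?(ltW e0) //.
  exact: hN.
by rewrite distrC ger0_norm ?subr_ge0 // lerBlDl.
Unshelve. all: by end_near. Qed.

(** By Fekete's lemma the roots of a submultiplicative sequence converge to their infimum. The
    infimum moreover gives lam^n <= a n for all n, without a constant. *)
Definition growth_rate a : R := inf [set r | exists2 n, (0 < n)%N & r = (a n)%:R `^ n%:R^-1].

Section Submultiplicative.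
Variable a : nat -> nat.
Hypothesis a_gt0 : forall n, (0 < a n)%N.
Hypothesis a_mul : forall n k, (a (n + k) <= a n * a k)%N.
Local Notation lam := (growth_rate a).

Let root_ge1 n : 1 <= (a n)%:R `^ n%:R^-1 :> R.
Proof.
rewrite -{1}(powRr0 (1 : R)).
apply: le_trans (_ : 1 `^ n%:R^-1 <= _); first by rewrite !powR1.
by apply: ge0_ler_powR; rewrite ?nnegrE // ler1n.
Qed.

Let roots := [set r : R | exists2 n, (0 < n)%N & r = (a n)%:R `^ n%:R^-1].

Let roots_inf : has_inf roots.
Proof.
split; first by exists ((a 1)%:R `^ 1%:R^-1), 1%N.
by exists 1 => r [n _ ->].
Qed.

Lemma growth_rate_ge1 : 1 <= lam.
Proof. by apply: lb_le_inf; [case: roots_inf|move=> r [n _ ->]]. Qed.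

Lemma growth_rate_le n : lam ^+ n <= (a n)%:R.
Proof.
case: n => [|n]; first by rewrite expr0 ler1n.
have h : lam <= (a n.+1)%:R `^ n.+1%:R^-1.
  by apply: ge_inf; [case: roots_inf|exists n.+1].
have -> : (a n.+1)%:R = ((a n.+1)%:R `^ n.+1%:R^-1) ^+ n.+1 :> R.
  by rewrite -powR_mulrn ?powR_ge0 // -powRrM mulVf ?powRr1.
rewrite lerXn2r ?nnegrE ?powR_ge0 //.
by apply: le_trans growth_rate_ge1.
Qed.

Lemma growth_rate_bound mu : lam < mu -> exists2 C : R, 0 < C &
  forall n, (a n)%:R <= C * mu ^+ n.
Proof.
move=> lmu; have [_ [k k0 ->] hk] := inf_lt (proj1 roots_inf) lmu.
have mu1 : 1 <= mu by apply: le_trans growth_rate_ge1 (ltW lmu).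
have mu0 : 0 <= mu by apply: le_trans mu1.
have ak : (a k)%:R <= mu ^+ k.
  have -> : (a k)%:R = ((a k)%:R `^ k%:R^-1) ^+ k :> R.
    by rewrite -powR_mulrn ?powR_ge0 // -powRrM mulVf ?powRr1 // pnatr_eq0 -lt0n.
  by rewrite lerXn2r ?nnegrE ?powR_ge0 // ltW.
pose C := (\sum_(r < k) a r)%N.
have aC r : (r < k)%N -> (a r <= C)%N.
  by move=> rk; rewrite /C (bigD1 (Ordinal rk)) //= leq_addr.
have C0 : (0 < C)%N by apply: leq_trans (aC 0%N k0).
exists C%:R; first by rewrite ltr0n.
move=> n; have [q [r [rk ->]]] : exists q r, (r < k)%N /\ n = (q * k + r)%N.
  by exists (n %/ k)%N, (n %% k)%N; rewrite ltn_mod k0 -divn_eq.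
elim: q => [|q IH].
  rewrite mul0n add0n; apply: le_trans (_ : C%:R <= _); first by rewrite ler_nat aC.
  by rewrite ler_peMr // exprn_ege1.
rewrite mulSn -addnA exprD mulrCA.
apply: le_trans (_ : (a k)%:R * (a (q * k + r)%N)%:R <= _).
  by rewrite -natrM ler_nat.
by apply: ler_pM.
Qed.

Lemma growth_rate_eventually mu : lam < mu ->
  exists N, forall n, (N <= n)%N -> (n.+1 * a n)%:R <= mu ^+ n.
Proof.
(* The room between nu and mu absorbs both the constant C and the factor n + 1. *)
move=> lmu; pose nu := (lam + mu) / 2.
have l1 := growth_rate_ge1.
have [|C C0 hC] := @growth_rate_bound nu; first by rewrite /nu; lra.
have nu0 : 0 < nu by rewrite /nu; lra.
have q1 : 1 < mu / nu by rewrite ltr_pdivlMr // mul1r /nu; lra.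
have [N hN] := linear_le_expr C q1.
exists N => n /hN h; rewrite natrM.
apply: le_trans (_ : n.+1%:R * (C * nu ^+ n) <= _); first exact: ler_wpM2l.
by rewrite mulrA -ler_pdivlMr ?exprn_gt0 // -expr_div_n.
Qed.

Lemma growth_rate_cvg x : (forall n, (a n <= x n <= n.+1 * a n)%N) ->
  (x n)%:R `^ n%:R^-1 @[n --> \oo] --> lam.
Proof.
move=> ax; apply: growth_criterion.
- by apply: le_trans growth_rate_ge1.
- move=> n; apply: le_trans (growth_rate_le n) _; rewrite ler_nat.
  by case/andP: (ax n).
- move=> mu /growth_rate_eventually[N hN]; exists N => n /hN; apply: le_trans.
  by rewrite ler_nat; case/andP: (ax n).
Qed.

Lemma growth_rate_lower (K d : R) P : 0 < K -> 0 <= d -> (0 < P)%N ->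
  (forall n, K * d ^+ (n * P) <= (a (n * P)%N)%:R) -> d <= lam.
Proof.
move=> K0 d0 P0 h; rewrite leNgt; apply/negP => dl.
pose mu := (lam + d) / 2; have l1 := growth_rate_ge1.
have [|C C0 hC] := @growth_rate_bound mu; first by rewrite /mu; lra.
have mu0 : 0 < mu by rewrite /mu; lra.
have q1 : 1 < d / mu by rewrite ltr_pdivlMr // mul1r /mu; lra.
have [N hN] := @linear_le_expr (C / K) _ q1.
pose n := N.+1.
have nP : (N <= n * P)%N by rewrite (leq_trans (leqnSn N)) // leq_pmulr.
have h1 := hN _ nP; have h2 := le_trans (h n) (hC (n * P)%N).
rewrite expr_div_n ler_pdivlMr ?exprn_gt0 // in h1.
have : (n * P).+1%:R * (C / K) * mu ^+ (n * P) <= C / K * mu ^+ (n * P).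
  apply: le_trans h1 _; rewrite mulrAC ler_pdivlMr // mulrC.
  exact: h2.
rewrite ler_pM2r ?exprn_gt0 // ger_pMl ?divr_gt0 // -natr1.
have : 1 <= (n * P)%:R :> R by rewrite ler1n muln_gt0 P0.
by lra.
Qed.

End Submultiplicative.
End GrowthRate.

(** * Strict monotonicity *)

Section Connectors.
Variables (T : finType) (m : coxeter_matrix T).
Local Notation W := (coxeter_group m).
Local Notation g := (cox_gen m).
Implicit Types (X I J K : {set T}) (x y z : W) (s t u v : T) (l : seq W) (b : bool).
Hypothesis finW : spherical m.
Local Notation w0 := (longest finW [set: T]).
Local Notation longest := (longest finW).

Definition coxeter_edge : rel T := fun s t => (s != t) && (m s t != Some 2).
Local Notation edge := coxeter_edge.

Lemma coxeter_edge_sym : symmetric edge.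
Proof. by move=> s t; rewrite /edge eq_sym coxeter_sym. Qed.

Hypothesis connected : forall s t, connect edge s t.
Hypothesis T2 : (1 < #|T|)%N.

(* The parity of the distance to a root. *)
Lemma colouring_exists : exists c : T -> bool,
  forall s t, connect (fun u v => edge u v && (c u != c v)) s t.
Proof.
have /card_gt0P[root _] : (0 < #|T|)%N by apply: ltnW.
have ex v : exists n, `[< exists p, [/\ path edge root p, last root p = v & size p = n] >].
  have /connectP[p pp pv] := connected root v.
  by exists (size p); apply/asboolP; exists p.
pose d v := ex_minn (ex v).
have dP v : exists p, [/\ path edge root p, last root p = v & size p = d v].
  by rewrite /d; case: ex_minnP => n /asboolP.
have d_le p : path edge root p -> (d (last root p) <= size p)%N.
  by move=> pp; rewrite /d; case: ex_minnP => n _; apply; apply/asboolP; exists p.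
pose c v := odd (d v); exists c; pose e u v := edge u v && (c u != c v).
have e_sym : connect_sym e.
  by apply: sym_connect_sym => u v; rewrite /e coxeter_edge_sym eq_sym.
suff root_e v : connect e root v.
  by move=> s t; apply: connect_trans (root_e t); rewrite e_sym.
have [n] := ubnP (d v); elim: n v => // n IH v; rewrite ltnS => dn.
have [p [pp pv sp]] := dP v; case: (lastP p) pp pv sp => [_ <- _|q w].
  exact: connect0.
rewrite rcons_path last_rcons size_rcons => /andP[pq qw] wv sq.
rewrite {w}wv in qw.
have dq := d_le _ pq; set u := last root q in dq qw.
have dv : (d v <= (d u).+1)%N.
  have [p' [pp' pu sp']] := dP u; rewrite -sp' -(size_rcons p' v).
  rewrite -{1}(last_rcons root p' v); apply: d_le.
  by rewrite rcons_path pp' pu.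
apply: connect_trans (IH u _) _; first by move: dn; rewrite -sq; exact: leq_trans.
apply: connect1; rewrite /e qw /c (_ : d v = (d u).+1) /=; last by lia.
by case: (odd _).
Qed.

Section Colouring.
Variable c : T -> bool.
Let bedge : rel T := fun u v => edge u v && (c u != c v).
Hypothesis c_connected : forall s t, connect bedge s t.

Let bedge_sym : symmetric bedge.
Proof. by move=> u v; rewrite /bedge coxeter_edge_sym eq_sym. Qed.

Definition nbrs I : {set T} := [set v | [exists u in I, bedge u v]].
Definition colour_class b : {set T} := [set v | c v == b].

Definition step I J := exists z : W, ldescs z \subset I /\ J \subset rdescs z.

Lemma step_disjoint I J : [disjoint I & J] ->
  {in J, forall u, exists2 s, s \in I & m s u != Some 2} -> step I J.
Proof.
move=> dIJ nc; exists (longest I * longest J); split; apply/fintype.subsetP => s.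
  by rewrite inE; exact: longest_mul_ldesc.
by rewrite inE; exact: longest_mul_rdesc.
Qed.

Lemma nbrs_colour I b : I \subset colour_class b -> nbrs I \subset colour_class (~~ b).
Proof.
move=> /fintype.subsetP Ib; apply/fintype.subsetP => v; rewrite !inE.
move=> /existsP[u /andP[/Ib]]; rewrite inE => /eqP ub /andP[_].
by rewrite ub; case: (b); case: (c v).
Qed.

Lemma step_nbrs I b : I \subset colour_class b -> step I (nbrs I).
Proof.
move=> Ib; apply: step_disjoint.
  rewrite -finset.setI_eq0; apply/eqP/finset.setP => v; rewrite !inE.
  apply/andP => -[vI vN]; have := fintype.subsetP (nbrs_colour Ib) v.
  rewrite inE vN => /(_ isT); rewrite inE => /eqP vb.
  by have := fintype.subsetP Ib v vI; rewrite inE vb; case: (b).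
move=> v; rewrite inE => /existsP[u /andP[uI /andP[/andP[_ muv] _]]].
by exists u.
Qed.

Lemma nbr_ex v : exists u, bedge v u.
Proof.
have [w vw] : exists w, w != v.
  have := T2; rewrite (cardD1 v) inE add1n ltnS => /card_gt0P[w].
  by rewrite !inE andbT => wv; exists w.
have /connectP[[|u p] /= ] := c_connected v w; first by move=> _ e; rewrite e eqxx in vw.
by case/andP => vu _ _; exists u.
Qed.

Lemma nbrs2 I : I \subset nbrs (nbrs I).
Proof.
apply/fintype.subsetP => v vI; have [u vu] := nbr_ex v.
rewrite inE; apply/existsP; exists u; rewrite inE bedge_sym vu andbT.
by apply/existsP; exists v; rewrite vI.
Qed.

(** Two steps along [nbrs] return to the same colour, and over two steps the conjugations by w_0
    that come with duality cancel. *)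
Definition step2 I J := exists2 K, step I K & step K J.

Inductive reach2 I : {set T} -> Prop :=
| reach2_refl : reach2 I I
| reach2_step J K : reach2 I J -> step2 J K -> reach2 I K.

Lemma reach2_trans J I K : reach2 I J -> reach2 J K -> reach2 I K.
Proof. by move=> IJ; elim=> // L M _ h; exact: reach2_step. Qed.

Lemma reach2_one I J : step2 I J -> reach2 I J.
Proof. by apply: reach2_step; exact: reach2_refl. Qed.

(** I is contained in the set of neighbours of its neighbours, which has the same colour. When the
    two agree, I and its neighbours together are closed under the coloured edges, so they are
    everything, and I is the whole class. *)
Lemma reach2_class I b : I != finset.set0 -> I \subset colour_class b ->
  reach2 I (colour_class b).
Proof.
have [n] := ubnP #|colour_class b :\: I|; elim: n I => // n IH I; rewrite ltnS => dn I0 Ib.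
have Nb := nbrs_colour Ib; have NNb := nbrs_colour Nb; rewrite negbK in NNb.
have [e|ne] := eqVneq (nbrs (nbrs I)) I.
  suff -> : colour_class b = I by exact: reach2_refl.
  apply/eqP; rewrite finset.eqEsubset Ib andbT; apply/fintype.subsetP => v.
  rewrite inE => vb; have /finset.set0Pn[r rI] := I0.
  have clo : fingraph.closed bedge (mem (I :|: nbrs I)).
    apply: fingraph.intro_closed; first exact: sym_connect_sym.
    move=> u w uw; rewrite !inE => /orP[uI|uN].
      by apply/orP; right; apply/existsP; exists u; rewrite uI.
    apply/orP; left; rewrite -e inE; apply/existsP; exists u.
    by rewrite inE uN.
  have := closed_connect clo (c_connected r v).
  rewrite !inE rI /= => /esym/orP[//|h].
  have := fintype.subsetP Nb v; rewrite inE h => /(_ isT).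
  by rewrite inE (eqP vb); case: (b).
apply: (@reach2_trans (nbrs (nbrs I))).
  by apply: reach2_one; exists (nbrs I); [exact: step_nbrs Ib|exact: step_nbrs Nb].
have ss : I \proper nbrs (nbrs I) by rewrite finset.properEneq eq_sym ne nbrs2.
apply: IH => //; last first.
  by apply: contraNneq I0 => h; have := nbrs2 I; rewrite h finset.subset0.
apply: leq_trans dn; apply: proper_card; apply/properP; split.
  by apply: finset.setDS; exact: nbrs2.
have /properP[_ [v vN vI]] := ss; exists v.
  by have := fintype.subsetP NNb v vN; rewrite finset.in_setD vI.
by rewrite finset.in_setD vN.
Qed.

Lemma ldesc_w0l x s t : w0 * g s = g t * w0 -> ldesc (w0 * x) s = ~~ ldesc x t.
Proof.
move=> e; have e' : g s * w0 = w0 * g t.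
  by rewrite -[LHS]mul1g -(longest2 finW [set: T]) -mulgA [w0 * (g s * w0)]mulgA e
    -mulgA longest2 mulg1.
rewrite /ldesc mulgA e' -mulgA.
have := len_w0l finW x; have := len_w0l finW (g t * x).
have := ldesc_mul x t; rewrite /ldesc cox_genK.
move: (len (g t * x)) (len x) (len (w0 * (g t * x))) (len (w0 * x)) => i j k n.
case: (ltnP j i) => ij /esym h1 h2 h3; apply/idP/idP; move: h1; case: ltnP => //; lia.
Qed.

Lemma rdesc_w0r x s t : w0 * g s = g t * w0 -> rdesc (x * w0) s = ~~ rdesc x t.
Proof.
by move=> e; rewrite -ldescV invgM longestV (ldesc_w0l _ e) ldescV.
Qed.

(* Duality: z |-> z^-1 w0 reverses steps and complements descent sets, up to conjugation by w0. *)
Lemma step2_dual I J : step2 I J -> step2 (~: J) (~: I).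
Proof.
move=> [K [z1 [h1 h1']] [z2 [h2 h2']]].
exists (rdescs (z2^-1 * w0)).
  exists (z2^-1 * w0); split; last by [].
  apply/fintype.subsetP => s; rewrite !inE ldesc_w0r ldescV.
  by apply: contraNN => /(fintype.subsetP h2'); rewrite inE.
exists (w0 * z1^-1); split; apply/fintype.subsetP => s; rewrite !inE; last first.
  rewrite rdesc_w0l rdescV.
  by apply: contraNN => /= h; apply: (fintype.subsetP h1); rewrite inE.
have [t e] := w0_conj finW s.
rewrite (ldesc_w0l _ e) (rdesc_w0r _ e) ldescV rdescV; apply: contraNN => h.
have : t \in K by apply: (fintype.subsetP h2); rewrite inE.
by move=> /(fintype.subsetP h1'); rewrite inE.
Qed.

Lemma reach2_dual I J : reach2 I J -> reach2 (~: J) (~: I).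
Proof.
elim=> [|K L _ IH h]; first exact: reach2_refl.
by apply: reach2_trans IH; apply: reach2_one; exact: step2_dual.
Qed.

Lemma step_path I J : step I J -> exists l : seq W,
  path_from I l /\ J \subset foldl (fun _ x => rdescs x) I l.
Proof. by move=> [z [h1 h2]]; exists [:: z]; rewrite /= h1. Qed.

Definition reach I J := exists l : seq W,
  path_from I l /\ J \subset foldl (fun _ x => rdescs x) I l.

Lemma foldl_rdescsS I J l : I \subset J ->
  foldl (fun _ (x : W) => rdescs x) I l \subset foldl (fun _ x => rdescs x) J l.
Proof. by case: l. Qed.

Lemma reach_trans J I K : reach I J -> reach J K -> reach I K.
Proof.
move=> [z [h1 h2]] [z' [h1' h2']]; exists (z ++ z'); rewrite path_from_cat h1 /=.
rewrite foldl_cat (path_fromS h2 h1'); split=> //.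
by apply: fintype.subset_trans h2' _; exact: foldl_rdescsS.
Qed.

Lemma reach2_reach I J : reach2 I J -> reach I J.
Proof.
elim=> [|K L _ IH [M /step_path h1 /step_path h2]]; first by exists [::].
by apply: reach_trans IH _; apply: reach_trans h2.
Qed.

(** {r} grows to a full colour class, and the dual of the same fact for {t} leads from the class of
    the other colour than t to the complement of t. If r has the colour of t, one step to its
    neighbours changes the colour first. *)
Lemma reach_compl_coloured r t : reach [set r] (~: [set t]).
Proof.
have single s : [set s] \subset colour_class (c s) by rewrite finset.sub1set inE.
have ne s : [set s] != finset.set0 by apply/finset.set0Pn; exists s; rewrite inE.
have compl b : ~: colour_class b = colour_class (~~ b).
  by apply/finset.setP => v; rewrite !inE; case: (b); case: (c v).
have /reach2_dual := reach2_class (ne t) (single t); rewrite compl => /reach2_reach h.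
apply: reach_trans h; have [e|e] := eqVneq (c r) (c t).
  have Nr := nbrs_colour (single r).
  apply: (@reach_trans (nbrs [set r])); first exact/step_path/step_nbrs.
  apply: reach2_reach; rewrite -e; apply: reach2_class => //.
  have [u ru] := nbr_ex r; apply/finset.set0Pn; exists u; rewrite inE.
  by apply/existsP; exists r; rewrite inE eqxx.
have -> : ~~ c t = c r by move: e; case: (c r); case: (c t).
exact/reach2_reach/reach2_class.
Qed.

End Colouring.

Lemma reach_compl r t : reach [set r] (~: [set t]).
Proof. by have [c cP] := colouring_exists; exact: (reach_compl_coloured cP). Qed.

End Connectors.

(** * Leaving a parabolic subgroup, and the renewal inequality *)

Section Strict.
Variables (T : finType) (m : coxeter_matrix T).
Local Notation W := (coxeter_group m).
Implicit Types (X I J K : {set T}) (x y z : W) (s u v : T) (l : seq W).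
Hypothesis finW : spherical m.
Local Notation longest := (longest finW).
Local Notation npaths := (npaths finW).
Local Notation paths := (paths finW).
Hypothesis connected : forall s t, connect (coxeter_edge m) s t.
Hypothesis T2 : (1 < #|T|)%N.
Variable t : T.
Local Notation Y := (~: [set t]).
Local Notation final := (foldl (fun _ (x : W) => rdescs x)).

Lemma longest_edge_ldescs s u : coxeter_edge m s u ->
  ldescs (longest [set s] * longest [set u]) \subset [set s].
Proof.
move=> /andP[su msu]; apply/fintype.subsetP => v; rewrite [v \in ldescs _]inE.
apply: longest_mul_ldesc.
  by rewrite disjoints1 inE.
by move=> w; rewrite inE => /eqP ->; exists s => //; rewrite inE.
Qed.

Lemma longest_edge_rdescs s u : coxeter_edge m s u ->
  [set u] \subset rdescs (longest [set s] * longest [set u]).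
Proof.
move=> /andP[su msu]; rewrite finset.sub1set inE; apply: longest_mul_rdesc; rewrite ?inE //.
by rewrite disjoints1 inE.
Qed.

Definition exit_path r (n : nat) l := exists l' z, [/\ l = rcons l' z, size l = n, all_par Y l',
  ~ par Y z & path_from [set r] l /\ t \in rdescs z].

(** Along a path of the Coxeter graph from r to t, the product of two successive vertices leads from
    the state of the first to a state containing the second. Such a product leaves W_Y only when t
    is reached. *)
Lemma exit_path_ex r : r \in Y -> exists n l, exit_path r n l.
Proof.
have /connectP[p pp pt] := connected r t.
elim: p r pp pt => [|v p IH] r /=; first by move=> _ ->; rewrite !inE eqxx.
move=> /andP[rv pp] pt rY; have ld := longest_edge_ldescs rv; have rd := longest_edge_rdescs rv.
rewrite finset.sub1set in rd.
have [e|vY] := eqVneq v t.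
  subst v; exists 1%N, [:: longest [set r] * longest [set t]].
  exists [::], (longest [set r] * longest [set t]); split=> //.
    by move=> /par_rdesc /(_ (_ : rdesc _ t)); move: rd; rewrite inE => -> /(_ isT); rewrite !inE eqxx.
  by rewrite /= ld.
have vY' : v \in Y by rewrite !inE.
have [n [l [l' [z [lE sl lY zY [pl zt]]]]]] := IH v pp pt vY'.
exists n.+1, (longest [set r] * longest [set v] :: l).
exists (longest [set r] * longest [set v] :: l'), z; split=> //.
- by rewrite lE.
- by rewrite /= sl.
- apply: all_par_cons => //; apply: par_mul.
    by apply: par_sub (longest_par finW _); rewrite finset.sub1set.
  by apply: par_sub (longest_par finW _); rewrite finset.sub1set.
split=> //=; rewrite ld /=; apply: path_fromS pl.
by rewrite finset.sub1set.
Qed.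

Lemma ldescs_longest X : ldescs (longest X) = X.
Proof. by apply/finset.setP => s; rewrite inE ldesc_longest. Qed.

Lemma rdescs_longest X : rdescs (longest X) = X.
Proof. by apply/finset.setP => s; rewrite inE rdesc_longest. Qed.

(** The generator r leads from the state {r} to itself, so exit paths can be lengthened in front
    until they have the same length for all r. *)
Lemma exit_pathS r n l : r \in Y -> exit_path r n l -> exit_path r n.+1 (longest [set r] :: l).
Proof.
move=> rY [l' [z [-> sl lY zY [pl zt]]]]; exists (longest [set r] :: l'), z; split=> //=.
- by rewrite sl.
- apply: all_par_cons => //; apply: par_sub (longest_par finW _).
  by rewrite finset.sub1set.
by rewrite ldescs_longest rdescs_longest subxx.
Qed.

Lemma exit_path_uniform : exists d, forall r, r \in Y -> exists l, exit_path r d l.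
Proof.
have ex r : exists n, r \in Y -> exists l, exit_path r n l.
  have [rY|rY] := boolP (r \in Y); last by exists 0%N.
  by have [n h] := exit_path_ex rY; exists n.
pose n r := sval (cid (ex r)).
exists (\max_r n r)%N => r rY.
have nr : (n r <= \max_r n r)%N by exact: leq_bigmax.
have : exists l, exit_path r (n r) l by exact: (svalP (cid (ex r))) rY.
rewrite -(subnK nr); elim: (_ - _)%N => [//|k IH] /IH[l h].
by exists (longest [set r] :: l); exact: exit_pathS.
Qed.

(* The position d of the first element outside of the parabolic subgroup does not depend on r: this
   is what makes the concatenations in [renewal] decodable. *)
Lemma connectors : exists d c (k : T -> seq W), forall r, r \in Y ->
  [/\ size (k r) = c, path_from [set r] (k r), Y \subset final [set r] (k r) &
   exists l1 z l2, [/\ k r = l1 ++ z :: l2, size l1 = d, all_par Y l1 & ~ par Y z]].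
Proof.
have [d hd] := exit_path_uniform.
have [b [bp bY]] := reach_compl finW connected T2 t t.
have ex r : exists l, r \in Y -> exit_path r d l.
  have [rY|rY] := boolP (r \in Y); last by exists [::].
  by have [l h] := hd r rY; exists l.
pose k r := sval (cid (ex r)).
have kP r : r \in Y -> exit_path r d (k r) by exact: (svalP (cid (ex r))).
exists d.-1, (d + size b)%N, (fun r => k r ++ b) => r rY.
have [l' [z [kE sk lY zY [pk zt]]]] := kP r rY.
have tb : [set t] \subset final [set r] (k r).
  by rewrite kE -cats1 foldl_cat /= finset.sub1set.
split.
- by rewrite size_cat sk.
- by rewrite path_from_cat pk; exact: path_fromS tb bp.
- rewrite foldl_cat; apply: fintype.subset_trans bY _.
  exact: foldl_rdescsS.
- exists l', z, b; split=> //; first by rewrite kE cat_rcons.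
  by rewrite -sk kE size_rcons.
Qed.

(** After the element 1, which has no right descent, a path continues with 1 only and offers no
    state from which a connector could start. *)
Definition reduced_paths n := [seq l <- paths Y n [set: T] | 1 \notin l].
Definition nreduced n := size (reduced_paths n).

Lemma nreducedE n : nreduced n = size (reduced_paths n).
Proof. by []. Qed.

Lemma reduced_pathsP n l : reflect [/\ size l = n, all_par Y l, path_from [set: T] l & 1 \notin l]
  (l \in reduced_paths n).
Proof.
rewrite mem_filter; apply: (iffP andP) => [[h /pathsP[]]|[]] //.
by move=> sl lY pl l1; split=> //; apply/pathsP.
Qed.

Lemma rdescs_ne1 x : x != 1 -> rdescs x != finset.set0.
Proof.
move=> x1; have /ldesc_ex[s sx] : x^-1 <> 1 by apply/eqP; rewrite invg_eq1.
by apply/finset.set0Pn; exists s; rewrite inE -ldescV.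
Qed.

Lemma final_ne l I : I != finset.set0 -> 1 \notin l -> final I l != finset.set0.
Proof.
elim: l I => //= x l IH I _; rewrite inE negb_or eq_sym => /andP[x1].
by apply: IH; exact: rdescs_ne1.
Qed.

Lemma final_par X l I : all_par X l -> I \subset X -> final I l \subset X.
Proof.
elim: l I => //= x l IH I /all_par_consE[xX lX] IX; apply: IH => //.
by apply/fintype.subsetP => s; rewrite inE; exact: par_rdesc.
Qed.

Lemma path_from_par X l : all_par X l -> path_from [set: T] l -> path_from X l.
Proof.
case: l => //= x l /all_par_consE[xX _] /andP[_ ->]; rewrite andbT.
by apply/fintype.subsetP => s; rewrite inE; exact: par_ldesc.
Qed.

(** Each term counts concatenations of a block l in W_Y, a connector and a path q. The connector
    starts from a right descent of the last element of l and ends in a state containing Y, from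
    which q may start. The first element outside W_Y stands at position n + d; this determines n,
    then l and q, so all these paths are distinct. *)
Lemma renewal : exists c, forall M N, (M + c <= N)%N ->
  (\sum_(1 <= n < M.+1) nreduced n * npaths [set: T] (N - n - c) Y
   <= npaths [set: T] N Y)%N.
Proof.
have [d [c [k kP]]] := connectors; exists c => M N MN.
pose pairs n := [seq (l, q) | l <- reduced_paths n, q <- paths [set: T] (N - n - c) Y].
pose idx := [seq lq | n <- iota 1 M, lq <- pairs n].
pose junction l := odflt t [pick r in final Y l].
pose f (lq : seq W * seq W) := lq.1 ++ k (junction lq.1) ++ lq.2.
have -> : (\sum_(1 <= n < M.+1) nreduced n * npaths [set: T] (N - n - c) Y)%N = size idx.
  rewrite /idx size_allpairs_dep sumnE big_map /index_iota subn1.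
  by apply: eq_bigr => n _; rewrite size_allpairs.
have idxP lq : lq \in idx -> exists n, [/\ (1 <= n <= M)%N, lq.1 \in reduced_paths n &
    lq.2 \in paths [set: T] (N - n - c) Y].
  move=> /allpairsPdep[n [p [nM /allpairsP[[l q] /= [lr qp ->]] ->]]].
  by exists n; rewrite mem_iota add1n ltnS in nM.
have junctionP n l : (1 <= n)%N -> l \in reduced_paths n ->
    junction l \in Y /\ junction l \in final Y l.
  move=> n1 /reduced_pathsP[sl lY _ l1]; have fY := final_par lY (subxx Y).
  have : final Y l != finset.set0.
    case: l sl lY l1 {fY} => [|x l] sl lY; first by rewrite -sl in n1.
    rewrite inE negb_or eq_sym => /andP[x1 l1] /=.
    by apply: final_ne => //; exact: rdescs_ne1.
  rewrite /junction; case: pickP => [r rf _|h /finset.set0Pn[r]]; last by rewrite h.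
  by split=> //; exact: (fintype.subsetP fY).
have decode n l q : (1 <= n)%N -> l \in reduced_paths n ->
    find (fun x => ~~ `[< par Y x >]) (f (l, q)) = (n + d)%N.
  move=> n1 lr; have [jY _] := junctionP _ _ n1 lr.
  have [_ _ _ [l1 [z [l2 [kE sl1 l1Y zY]]]]] := kP _ jY.
  have /reduced_pathsP[sl lY _ _] := lr.
  have no l0 : all_par Y l0 -> ~~ has (fun x => ~~ `[< par Y x >]) l0.
    by move=> h; apply/hasPn => x /h xY; rewrite negbK; exact/asboolP.
  rewrite /f /= kE -!catA find_cat (negPf (no _ lY)) sl find_cat (negPf (no _ l1Y)) sl1.
  by rewrite /= (introN (asboolP _) zY) /= addn0.
have finj : {in idx &, injective f}.
  move=> [l q] [l' q'] /idxP[n [/andP[n1 _] lr _]] /idxP[n' [/andP[n1' _] lr' _]] e.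
  have nn : n = n'.
    have h1 := decode n l q n1 lr; have h2 := decode n' l' q' n1' lr'.
    by rewrite e h2 in h1; apply/esym/eqP; rewrite -(eqn_add2r d) h1.
  subst n'; have /reduced_pathsP[sl _ _ _] := lr; have /reduced_pathsP[sl' _ _ _] := lr'.
  have ll : l = l'.
    by have := congr1 (take n) e; rewrite /f /= !take_size_cat.
  subst l'; congr (_, _); move: e; rewrite /f /= => /eqP.
  by rewrite !eqseq_cat // !eqxx /= => /eqP.
have uidx : uniq idx.
  apply: allpairs_uniq_dep; first exact: iota_uniq.
    move=> n _; apply: allpairs_uniq; [|exact: paths_uniq|].
      by apply: filter_uniq; exact: paths_uniq.
    by move=> [a b] [a' b'] _ _ /= [-> ->].
  move=> [n p] [n' p'] /allpairsPdep[n1 [p1 [_ h ->]]] /allpairsPdep[n1' [p1' [_ h' ->]]] /= e.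
  subst p1'; case/allpairsP: h => [[l q] /= [/reduced_pathsP[sl _ _ _] _ pE]].
  case/allpairsP: h' => [[l' q'] /= [/reduced_pathsP[sl' _ _ _] _ pE']].
  by move: pE'; rewrite pE => -[ll _]; rewrite -sl -sl' ll.
rewrite -(size_map f) npathsE; apply: uniq_leq_size.
  by rewrite map_inj_in_uniq.
move=> w /mapP[[l q] /idxP[n [/andP[n1 nM] lr qp]] ->].
have [jY jf] := junctionP _ _ n1 lr; have [sk pk Yk _] := kP _ jY.
have /reduced_pathsP[sl lY pl l1] := lr; have /pathsP[sq _ pq] := qp.
apply/pathsP; split.
- by rewrite /f /= !size_cat sl sk sq; move: nM MN; clear; lia.
- exact: all_par_setT.
rewrite /f /= !path_from_cat (path_from_par lY pl) /=.
have jl : [set junction l] \subset final Y l by rewrite finset.sub1set.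
rewrite (path_fromS jl pk) /=; apply: path_fromS pq.
by apply: fintype.subset_trans Yk _; exact: foldl_rdescsS.
Qed.

End Strict.

Section PolynomialFactor.
Local Open Scope ring_scope.
Variable R : realType.

Lemma growth_rate_mono (a b : nat -> nat) :
  (forall n, 0 < a n)%N -> (forall n k, a (n + k) <= a n * a k)%N ->
  (forall n, 0 < b n)%N -> (forall n k, b (n + k) <= b n * b k)%N ->
  (forall n, a n <= n.+1 * b n)%N -> growth_rate R a <= growth_rate R b.
Proof.
move=> a0 am b0 bm ab; rewrite leNgt; apply/negP => lt.
pose mu := (growth_rate R a + growth_rate R b) / 2.
have bmu : growth_rate R b < mu by rewrite /mu; lra.
have mua : mu < growth_rate R a by rewrite /mu; lra.
have [N hN] := growth_rate_eventually b0 bm bmu.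
have h1 := growth_rate_le R a0 N.+1.
have h2 : (a N.+1)%:R <= mu ^+ N.+1.
  by apply: le_trans (hN _ (leqnSn N)); rewrite ler_nat.
have b1 := growth_rate_ge1 R b0.
have : mu ^+ N.+1 < growth_rate R a ^+ N.+1.
  by rewrite ltrXn2r ?nnegrE //; lra.
by rewrite ltNge (le_trans h1 h2).
Qed.

End PolynomialFactor.

Section Strict.
Local Open Scope group_scope.
Variables (T : finType) (m : coxeter_matrix T).
Local Notation W := (coxeter_group m).
Implicit Types (X I J K : {set T}) (x y z : W) (s u v : T) (l : seq W).
Hypothesis finW : spherical m.
Local Notation longest := (longest finW).
Local Notation npaths := (npaths finW).
Hypothesis connected : forall s t, connect (coxeter_edge m) s t.
Hypothesis T2 : (1 < #|T|)%N.
Variable t : T.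
Local Notation Y := (~: [set t]).
Local Notation final := (foldl (fun _ (x : W) => rdescs x)).
Local Notation nreduced := (nreduced finW t).
Local Notation reduced_pathsP := (reduced_pathsP finW t).

Lemma nreducedD n k : (nreduced (n + k) <= nreduced n * nreduced k)%N.
Proof.
pose cut l := (take n l, drop n l).
have u : uniq [seq cut l | l <- reduced_paths finW t (n + k)].
  rewrite map_inj_in_uniq => [|l l' _ _ [e1 e2]].
    by apply: filter_uniq; exact: paths_uniq.
  by rewrite -(cat_take_drop n l) e1 e2 cat_take_drop.
pose r := [seq (l1, l2) | l1 <- reduced_paths finW t n, l2 <- reduced_paths finW t k].
have -> : (nreduced n * nreduced k)%N = size r by rewrite size_allpairs.
rewrite nreducedE -(size_map cut); apply: uniq_leq_size => //.
move=> p /mapP[l /reduced_pathsP[sl lX fl l1] ->].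
move: fl l1; rewrite -{1 2}(cat_take_drop n l) path_from_cat mem_cat negb_or.
move=> /andP[f1 f2] /andP[n1 n2]; apply: allpairs_f; apply/reduced_pathsP; split=> //.
- by rewrite size_take sl; case: ltnP => //; lia.
- by move=> x /mem_take/lX.
- by rewrite size_drop sl addKn.
- by move=> x /mem_drop/lX.
by apply: path_fromS f2; exact: finset.subsetT.
Qed.

Lemma compl_ne : Y != finset.set0.
Proof.
have := T2; rewrite (cardD1 t) inE add1n ltnS => /card_gt0P[w].
by rewrite !inE andbT => wv; apply/finset.set0Pn; exists w; rewrite !inE.
Qed.

Lemma longest_ne1 s : longest [set s] != 1.
Proof.
apply/eqP => e; have := ldesc_longest finW [set s] s.
by rewrite e inE eqxx /ldesc mulg1 len_gen len1.
Qed.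

Lemma path_from_nseq I r n : r \in I -> path_from I (nseq n (longest [set r])).
Proof.
elim: n I => //= n IH I rI; rewrite ldescs_longest finset.sub1set rI /=.
by apply: IH; rewrite rdescs_longest inE.
Qed.

Lemma nreduced_gt0 n : (0 < nreduced n)%N.
Proof.
have /finset.set0Pn[r rY] := compl_ne.
rewrite nreducedE -has_predT; apply/hasP; exists (nseq n (longest [set r])) => //.
apply/reduced_pathsP; split.
- by rewrite size_nseq.
- move=> x; rewrite mem_nseq => /andP[_ /eqP ->].
  by apply: par_sub (longest_par finW _); rewrite finset.sub1set.
- by apply: path_from_nseq; rewrite inE.
- by rewrite mem_nseq negb_and eq_sym longest_ne1 orbT.
Qed.

Lemma path_from_set0 l : path_from finset.set0 l -> l = nseq (size l) 1.
Proof.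
elim: l => //= x l IH /andP[x0 pl]; have x1 : x = 1.
  apply: contrapT => /ldesc_ex[s sx].
  by have := fintype.subsetP x0 s; rewrite !inE sx => /(_ isT).
subst x; congr (_ :: _); apply: IH; apply: path_fromS pl.
apply/fintype.subsetP => s; rewrite !inE /rdesc mul1g len_gen len1.
by [].
Qed.

Lemma path_from_index l I : path_from I l ->
  l = take (index 1 l) l ++ nseq (size l - index 1 l) 1.
Proof.
elim: l I => //= x l IH I /andP[_ pl].
have [x1|x1] := eqVneq x 1; last by rewrite subSS /= -(IH _ pl).
rewrite subn0 /= x1; congr (_ :: _); apply: path_from_set0; apply: path_fromS pl.
apply/fintype.subsetP => s; rewrite x1 !inE /rdesc mul1g len_gen len1.
by [].
Qed.

Let first1 l := index 1 l.

(** The 1s of a path form its tail. Replace the tail by repetitions of one generator, a right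
    descent of the element before it, and record where the tail began: there are n + 1 possible
    positions. *)
Lemma npaths_nreduced n : (npaths Y n [set: T] <= n.+1 * nreduced n)%N.
Proof.
have /finset.set0Pn[r0 r0Y] := compl_ne.
pose ext l := let p := take (first1 l) l in
  p ++ nseq (n - size p) (longest [set odflt r0 [pick r in final Y p]]).
pose f l := (first1 l, ext l).
pose r := [seq (i, l) | i <- iota 0 n.+1, l <- reduced_paths finW t n].
have -> : (n.+1 * nreduced n)%N = size r by rewrite size_allpairs size_iota.
have no1 l : 1 \notin take (first1 l) l.
  by rewrite /first1; elim: l => //= x l IH; case: eqVneq => [//|x1]; rewrite /= inE negb_or eq_sym x1.
rewrite npathsE -(size_map f); apply: uniq_leq_size.
  rewrite map_inj_in_uniq ?paths_uniq // => l l' /pathsP[sl _ pl] /pathsP[sl' _ pl'] [ei ee].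
  have st (l0 : seq W) : size l0 = n -> (first1 l0 <= n)%N ->
      size (take (first1 l0) l0) = first1 l0.
    by move=> s0 h; rewrite size_takel // s0.
  have il : (first1 l <= n)%N by rewrite -sl /first1 index_size.
  have il' : (first1 l' <= n)%N by rewrite -sl' index_size.
  have et : take (first1 l) l = take (first1 l') l'.
    have := congr1 (take (first1 l)) ee; rewrite /ext take_size_cat ?st //.
    by rewrite ei take_size_cat // st.
  rewrite (path_from_index pl) (path_from_index pl') sl sl'.
  by rewrite -/(first1 l) -/(first1 l') et ei.
move=> p /mapP[l /pathsP[sl lY pl] ->].
have il : (first1 l <= n)%N by rewrite -sl /first1 index_size.
apply: allpairs_f; first by rewrite mem_iota.
have tY : all_par Y (take (first1 l) l) by move=> x /mem_take/lY.
have pt : path_from [set: T] (take (first1 l) l).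
  by move: pl; rewrite -{1}(cat_take_drop (first1 l) l) path_from_cat => /andP[].
have fY := final_par tY (subxx Y); have f0 := final_ne compl_ne (no1 l).
have [jY jf] : odflt r0 [pick r in final Y (take (first1 l) l)] \in Y /\
    odflt r0 [pick r in final Y (take (first1 l) l)] \in final Y (take (first1 l) l).
  case: pickP => [a af|h] /=; first by split=> //; exact: (fintype.subsetP fY).
  by have /finset.set0Pn[a] := f0; rewrite h.
rewrite /ext; set j := odflt _ _ in jY jf *; apply/reduced_pathsP; split.
- by rewrite size_cat size_nseq size_takel ?sl // subnKC.
- apply: all_par_cat => // x; rewrite mem_nseq => /andP[_ /eqP ->].
  by apply: par_sub (longest_par finW _); rewrite finset.sub1set.
- rewrite path_from_cat pt /=; apply: path_from_nseq.
  by apply: (fintype.subsetP _ _ jf); apply: foldl_rdescsS; exact: finset.subsetT.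
- by rewrite mem_cat negb_or no1 mem_nseq negb_and eq_sym longest_ne1 orbT.
Qed.

Variable R : realType.

Theorem growth_rate_lt :
  (growth_rate R (fun n => npaths Y n [set: T]) <
   growth_rate R (fun n => npaths [set: T] n [set: T]))%R.
Proof.
set lam := growth_rate R _; set a := fun n => npaths [set: T] n [set: T].
have [c hc] := renewal finW connected T2 t.
have eq_le_ring (x y : R) : x = y -> (x <= y)%R by move=> ->.
have pY0 n : (0 < npaths Y n [set: T])%N by exact: npaths_gt0.
have pYm n k : (npaths Y (n + k) [set: T] <= npaths Y n [set: T] * npaths Y k [set: T])%N.
  exact: npathsD.
have lam1 : (1 <= lam)%R by exact: growth_rate_ge1.
have lamr n : (lam ^+ n <= (nreduced n)%:R :> R)%R.
  apply: le_trans (growth_rate_le R nreduced_gt0 n).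
  rewrite lerXn2r ?nnegrE ?(le_trans _ lam1) //.
    by apply: (le_trans _ (growth_rate_ge1 R nreduced_gt0)).
  exact: (growth_rate_mono R pY0 pYm nreduced_gt0 nreducedD npaths_nreduced).
(* With M >= 2 lam^c, the M terms of the renewal sum, each of order lam^(N - c), amount to twice
   lam^N. So B N / lam^N doubles about every K = M + c steps, and the growth rate is at least
   2^(1/K) lam. *)
have [M hM] : exists M : nat, (2 * lam ^+ c <= M%:R :> R)%R.
  exists (Num.bound (2 * lam ^+ c)%R); apply/ltW/archi_boundP.
  by rewrite mulr_ge0 // exprn_ge0 // (le_trans _ lam1).
have M0 : (0 < M)%N.
  have : (0 < M%:R :> R)%R.
    by apply: lt_le_trans hM; rewrite mulr_gt0 // exprn_gt0 // (lt_le_trans _ lam1).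
  by rewrite ltr0n.
pose K := (M + c)%N; have K0 : (0 < K)%N by rewrite addn_gt0 M0.
have lam0 : (0 < lam)%R by apply: lt_le_trans lam1.
(* C lam^N <= 1 <= B N for N < K, which starts the induction. *)
pose C : R := (lam ^- K)%R; have C0 : (0 < C)%R by rewrite invr_gt0 exprn_gt0.
pose B N := npaths [set: T] N Y.
(* B N / lam ^ N is at least twice its minimum over the K preceding terms. *)
have low N : (C * (2 ^+ (N %/ K) * lam ^+ N) <= (B N)%:R)%R.
  have [n] := ubnP N; elim: n N => // n IH N; rewrite ltnS => Nn.
  have [NK|KN] := ltnP N K.
    rewrite divn_small // expr0 mul1r; apply: (@le_trans _ _ 1%R); last first.
      by rewrite ler1n; exact: npaths_gt0.
    rewrite /C mulrC ler_pdivrMr ?exprn_gt0 // mul1r ler_weXn2l //; exact: ltnW.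
  apply: (@le_trans _ _ (\sum_(1 <= i < M.+1) nreduced i * B (N - i - c))%N%:R)%R; last first.
    by rewrite ler_nat; exact: hc.
  rewrite natr_sum.
  apply: (@le_trans _ _ (\sum_(1 <= i < M.+1) C * (2 ^+ (N %/ K).-1 * lam ^+ (N - c)))%R).
    rewrite sumr_const_nat subn1 /= -[X in (_ <= X)%R]mulr_natl.
    have e1 : (N %/ K = (N %/ K).-1.+1)%N by rewrite prednK // divn_gt0.
    rewrite {1}e1 exprS; have -> : (lam ^+ N = lam ^+ (N - c) * lam ^+ c)%R.
      by rewrite -exprD subnK //; move: KN; rewrite /K; lia.
    have p0 : (0 <= C * (2 ^+ (N %/ K).-1 * lam ^+ (N - c)))%R.
      by rewrite !mulr_ge0 ?exprn_ge0 ?(ltW C0) ?(ltW lam0).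
    apply: (le_trans _ (ler_wpM2r p0 hM)); apply: eq_le_ring.
    by move: (2 ^+ _)%R (lam ^+ _)%R (lam ^+ c)%R => u v w; ring.
  apply: ler_sum_nat => i /andP[i1 iM].
  rewrite natrM; have iN : (i + c <= N)%N by move: KN; rewrite /K; lia.
  apply: (@le_trans _ _ (lam ^+ i * (C * (2 ^+ ((N - i - c) %/ K) * lam ^+ (N - i - c))))%R); last first.
    apply: ler_pM; rewrite ?exprn_ge0 ?mulr_ge0 ?exprn_ge0 ?(ltW C0) ?(ltW lam0) //.
    by apply: IH; move: i1 Nn; lia.
  have -> : (lam ^+ (N - c) = lam ^+ i * lam ^+ (N - i - c))%R.
    by rewrite -exprD; congr (_ ^+ _)%R; lia.
  have le2 : (2 ^+ (N %/ K).-1 <= 2 ^+ ((N - i - c) %/ K) :> R)%R.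
    rewrite ler_weXn2l ?ler1n //.
    have -> : ((N %/ K).-1 = (N - K) %/ K)%N.
      by rewrite -[in LHS](subnK KN) divnDr ?dvdnn // divnn K0 addn1.
    by apply: leq_div2r; rewrite /K; lia.
  have p1 : (0 <= C * (lam ^+ i * lam ^+ (N - i - c)))%R.
    by rewrite !mulr_ge0 ?exprn_ge0 ?(ltW C0) ?(ltW lam0).
  have := ler_wpM2l p1 le2; set x := (2 ^+ _)%R; set y := (2 ^+ _)%R => h.
  move: x y (lam ^+ _)%R (lam ^+ _)%R h => x y u v h.
  by apply: (le_trans _ (le_trans h _)); apply: eq_le_ring; ring.
pose th : R := (2 `^ K%:R^-1)%R.
have thK : (th ^+ K = 2)%R.
  rewrite /th -powR_mulrn ?powR_ge0 // -powRrM mulVf ?powRr1 //.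
  by rewrite pnatr_eq0 -lt0n.
have th0 : (0 <= th)%R by exact: powR_ge0.
have th1 : (1 < th)%R.
  rewrite ltNge; apply/negP => h; have : (th ^+ K <= 1)%R by exact: exprn_ile1.
  by rewrite thK; lra.
apply: (@lt_le_trans _ _ (th * lam)%R); first by rewrite ltr_pMl.
apply: (@growth_rate_lower R a _ _ C _ K) => //.
- by move=> n; exact: npaths_gt0.
- by move=> n k; exact: npathsD.
- by rewrite mulr_ge0 // ltW.
move=> n; apply: (@le_trans _ _ (B (n * K)%N)%:R%R); last first.
  by rewrite ler_nat; apply: npathsS; exact: finset.subsetT.
have thn : (th ^+ (n * K) = 2 ^+ n)%R by rewrite mulnC exprM thK.
by apply: (le_trans _ (low _)); rewrite mulnK // exprMn thn.
Qed.

End Strict.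

(** * Subdiagrams of a Coxeter graph *)

Section Embedding.
Variables (T T' : finType) (m : coxeter_matrix T) (m' : coxeter_matrix T').
Variable i : T' -> T.
Hypothesis i_inj : injective i.
Hypothesis i_m : forall s t, m (i s) (i t) = m' s t.
Local Notation W := (coxeter_group m).
Local Notation W' := (coxeter_group m').

Lemma map_eq_cat (u : seq T') (v1 v2 : seq T) : map i u = v1 ++ v2 ->
  exists u1 u2, [/\ u = u1 ++ u2, map i u1 = v1 & map i u2 = v2].
Proof.
move=> e; exists (take (size v1) u), (drop (size v1) u).
by rewrite cat_take_drop map_take map_drop e take_size_cat // drop_size_cat.
Qed.

Lemma braid_map_inv (u0 v : seq T) : braid m u0 v -> forall u, u0 = map i u ->
  exists2 u', v = map i u' & braid m' u u'.
Proof.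
elim=> {u0 v} [u0 u ->|u0 u1 v _ IH1 _ IH2 u uE|v1 v2 a b].
- by exists u => //; exact: braid_refl.
- have [u' e b] := IH1 u uE; have [u'' e' b'] := IH2 u' e.
  by exists u'' => //; exact: braid_trans b b'.
move=> [s [t [k [st mst -> ->]]]] u /esym/map_eq_cat[w1 [w [-> <-]]].
move=> /map_eq_cat[w2 [w3 [-> e <-]]].
have k2 := coxeter_off_diag st mst.
have [s' [t' [sE tE]]] : exists s' t', s = i s' /\ t = i t'.
  case: k k2 {mst} e => [|[|k]] // _; case: w2 => [|s' [|t' w2]] //= [<- <- _].
  by exists s', t'.
subst s t; rewrite -alternating_map in e.
exists (w1 ++ alternating_word k t' s' ++ w3).
  by rewrite !map_cat !alternating_map.
rewrite (inj_map i_inj e); apply: braid_rel; exists s', t', k; split=> //.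
  by apply: contraNneq st => ->.
by rewrite -i_m.
Qed.

(** A braid move on a word with letters in the image of i stays in the image and lifts. If the image
    of u were not reduced, braid moves would lead to a word with two equal adjacent letters, and
    lifting them would contradict that u is reduced. *)
Lemma reduced_map (u : seq T') : reduced m' u -> reduced m (map i u).
Proof.
move=> ru; apply/negPn/negP => /not_reduced_braid[u1 [s [u2 b]]].
have [u' e b'] := braid_map_inv b erefl.
have r : reduced m' u' by rewrite /reduced -(braid_prod b') (eqP ru) (braid_size b').
have [a [w [uE _ wE]]] := map_eq_cat (esym e).
case: w wE uE => [|x [|y w]] //= [xs ys _] uE.
move: r; rewrite uE => /reduced_cat[_].
rewrite -(i_inj (etrans ys (esym xs))) !reduced_cons cox_prod_cons ldesc_mul negbK.
by case: (ldesc _ _); rewrite ?andbF.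
Qed.

Lemma embedding_rel u v : coxeter_rel m' u v ->
  \prod_(s <- u) cox_gen m (i s) = \prod_(s <- v) cox_gen m (i s).
Proof.
case=> [[s [t [k [st mst -> ->]]]]|[s [-> ->]]]; last first.
  by rewrite !big_cons !big_nil mulg1 cox_gen2.
have E a b : \prod_(s <- alternating_word k a b) cox_gen m (i s) =
    cox_prod m (alternating_word k (i a) (i b)).
  by rewrite -alternating_map /cox_prod big_map.
by rewrite !E (cox_alternating (k := k)) ?i_m // (inj_eq i_inj).
Qed.

Definition embedding : W' -> W := presented_lift (fun s => cox_gen m (i s)).

Lemma embeddingM x y : embedding (x * y) = embedding x * embedding y.
Proof. exact: (liftM embedding_rel). Qed.

Lemma embedding_word u : embedding (cox_prod m' u) = cox_prod m (map i u).
Proof. by rewrite cox_prodE /embedding (lift_positive embedding_rel) /cox_prod big_map. Qed.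

Lemma embedding_gen s : embedding (cox_gen m' s) = cox_gen m (i s).
Proof. by rewrite -!cox_prod1 embedding_word. Qed.

Lemma embedding_len x : len (embedding x) = len x.
Proof.
have [u ru <-] := reduced_word x.
by rewrite embedding_word (eqP ru) (eqP (reduced_map ru)) size_map.
Qed.

Lemma embedding_inj : injective embedding.
Proof.
move=> x y e; apply: (mulgI x^-1); rewrite mulVg; apply/esym/len_eq0.
rewrite -embedding_len embeddingM -e -embeddingM mulVg.
by rewrite embedding_len len1.
Qed.

Lemma embedding_rdesc x s : rdesc (embedding x) (i s) = rdesc x s.
Proof. by rewrite /rdesc -embedding_gen -embeddingM !embedding_len. Qed.

Lemma embedding_ldesc x s : ldesc (embedding x) (i s) = ldesc x s.
Proof. by rewrite /ldesc -embedding_gen -embeddingM !embedding_len. Qed.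

Lemma embedding_par x : par (i @: [set: T']) (embedding x).
Proof.
have [u <-] := cox_prod_surj x; rewrite embedding_word; exists (map i u) => //.
by apply/allP => s /mapP[s' _ ->] /=; apply: imset_f; rewrite inE.
Qed.

Hypothesis finW : spherical m.

Lemma spherical_sub : spherical m'.
Proof.
apply: (@sub_finite_set _ _ (embedding @^-1` [set: W])%classic) => //.
by apply: finite_preimage => // x y _ _; exact: embedding_inj.
Qed.

Lemma npaths_embedding (finW' : spherical m') n :
  (npaths finW' [set: T'] n [set: T'] <= npaths finW (i @: [set: T']) n [set: T])%N.
Proof.
rewrite /npaths -(size_map (map embedding)); apply: uniq_leq_size.
  by rewrite map_inj_uniq; [exact: paths_uniq|exact/inj_map/embedding_inj].
move=> l' /mapP[l /pathsP[sl _ /path_from_normal nl] ->]; apply/pathsP; split.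
- by rewrite size_map.
- by move=> x /mapP[y _ ->]; exact: embedding_par.
apply/path_from_normal => k; have nth_e j : nth 1 (map embedding l) j = embedding (nth 1 l j).
  have [jl|jl] := ltnP j (size l); first by rewrite (nth_map 1).
  rewrite !nth_default ?size_map //; apply/esym/len_eq0.
  by rewrite embedding_len len1.
rewrite !nth_e; apply/forallP => s; apply/implyP => sd.
have /imsetP[s' _ e] := par_ldesc (embedding_par _) sd.
move: sd; rewrite e embedding_ldesc embedding_rdesc; exact/implyP/(forallP (nl k)).
Qed.

End Embedding.

(** * Types A, B and D *)

Section TypeB.
Variables (G : groupType) (N : nat) (s : nat -> G).
Hypothesis s2 : forall i, (i < N)%N -> s i * s i = 1.
Hypothesis s_comm : forall i j, (i.+1 < j < N)%N -> s i * s j = s j * s i.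
Hypothesis s_braid : forall i, (0 < i)%N -> (i.+1 < N)%N ->
  s i * s i.+1 * s i = s i.+1 * s i * s i.+1.
Hypothesis s_braid4 : (1 < N)%N -> s 0 * s 1 * s 0 * s 1 = s 1 * s 0 * s 1 * s 0.

Let sKr i x : (i < N)%N -> x * s i * s i = x.
Proof. by move=> iN; rewrite -mulgA s2 // mulg1. Qed.

Definition below n x := exists2 u : seq nat, all (fun i => i < n)%N u & x = \prod_(i <- u) s i.

Let below1 n : below n 1.
Proof. by exists [::]; rewrite ?big_nil. Qed.

Let belowM n x y : below n x -> below n y -> below n (x * y).
Proof.
move=> [u un ->] [v vn ->]; exists (u ++ v); last by rewrite big_cat.
by rewrite all_cat un.
Qed.

Let below_gen n i : (i < n)%N -> below n (s i).
Proof. by move=> i_n; exists [:: i]; rewrite ?big_seq1 //= i_n. Qed.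

Let belowS n k x : (n <= k)%N -> below n x -> below k x.
Proof.
move=> nk [u un ->]; exists u => //; apply: sub_all un => i i_n.
exact: leq_trans nk.
Qed.

Let below_comm n x y : (forall i, (i < n)%N -> commute y (s i)) -> below n x -> commute y x.
Proof.
move=> ys [u un ->]; elim: u un => [_|i u IH /=]; first by rewrite big_nil; exact: commute1.
move=> /andP[i_n un]; rewrite big_cons; apply: commuteM; [exact: ys|exact: IH].
Qed.

(* The elements 1, s_n, z_n represent the double cosets of W(B_n) in W(B_(n+1)). *)
Fixpoint zB n : G := if n is n'.+1 then s n * zB n' * s n else s 0.

Let zB_below n : below n.+1 (zB n).
Proof.
elim: n => [|n IH] /=; first exact: below_gen.
by do 2?apply: belowM; [exact: below_gen|exact: belowS IH|exact: below_gen].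
Qed.

Let s_zB i n : (n.+1 < i)%N -> (i < N)%N -> commute (s i) (zB n).
Proof.
move=> ni iN; apply: below_comm (zB_below n) => j jn.
by apply: commute_sym; apply: s_comm; rewrite iN andbT; apply: leq_ltn_trans ni.
Qed.

(** In the model of signed permutations [zB n] changes the sign of one coordinate, which s_0, ...,
    s_(n-1) do not move. *)
Let zB_comm n i : (n < N)%N -> (i < n)%N -> commute (zB n) (s i).
Proof.
elim: n i => // n IH i nN; rewrite ltnS leq_eqVlt => /orP[/eqP ->{i}|i_n]; last first.
  have c : commute (s i) (s n.+1) by apply: s_comm; rewrite nN ltnS i_n.
  apply: commute_sym => /=; apply: commuteM => //; apply: commuteM => //.
  by apply: commute_sym; apply: IH => //; exact: ltnW.
case: n IH nN => [|n] IH nN.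
  by rewrite /commute /= -s_braid4 // !mulgA.
have nN' := ltnW nN; have c : commute (s n.+2) (zB n) by exact: s_zB.
rewrite /commute /=; have b := s_braid (ltn0Sn n) nN.
set a := s n.+1 in b *; set d := s n.+2 in b c *.
set z := zB n in c *.
transitivity (d * a * z * (a * d * a)); first by rewrite !mulgA.
rewrite b; transitivity (d * a * (z * d) * a * d); first by rewrite !mulgA.
rewrite -c; transitivity ((d * a * d) * z * a * d); first by rewrite !mulgA.
by rewrite -b !mulgA.
Qed.

Definition cosetsB n x := [\/ below n x,
  exists h h', [/\ below n h, below n h' & x = h * s n * h'] |
  exists2 h, below n h & x = h * zB n].

Let cosetsB_gen n i x : (forall y, below n y -> forall k, n = k.+1 -> cosetsB k y) ->
  (n < N)%N -> (i <= n)%N -> cosetsB n x -> cosetsB n (x * s i).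
Proof.
move=> IH nN; rewrite leq_eqVlt => /orP[/eqP ->{i}|i_n]; last first.
  case=> [hx|[h [h' [hh hh' ->]]]|[h hh ->]].
  - by apply: Or31; apply: belowM => //; exact: below_gen.
  - apply: Or32; exists h, (h' * s i); split=> //; last by rewrite !mulgA.
    by apply: belowM => //; exact: below_gen.
  - apply: Or33; exists (h * s i); first by apply: belowM => //; exact: below_gen.
    by rewrite -!mulgA (zB_comm nN i_n).
case=> [hx|[h [h' [hh hh' ->]]]|[h hh ->]].
- by apply: Or32; exists x, 1; rewrite mulg1.
- case: n IH nN hh hh' => [|n] IH nN hh hh'.
    have h'1 : h' = 1 by case: hh' => [[|//] _ ->]; rewrite big_nil.
    by apply: Or31; rewrite h'1 mulg1 sKr.
  have cn y : below n y -> commute (s n.+1) y.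
    apply: below_comm => j jn; apply: commute_sym; apply: s_comm.
    by rewrite nN andbT ltnS.
  (* In h s_(n+1) h' s_(n+1) the factor h' is decomposed one level down: either it commutes with
     s_(n+1), or it contains a single s_n, where the braid relation applies, or it contains z_n,
     which becomes z_(n+1). *)
  case: (IH _ hh' n erefl) => [h'n|[a [b [an bn ->]]]|[a an ->]].
  - apply: Or31; rewrite -[h * _ * h']mulgA (cn _ h'n) mulgA sKr //.
    exact: belowM.
  - have e : h * s n.+1 * (a * s n * b) * s n.+1 = h * a * (s n.+1 * s n * s n.+1) * b.
      rewrite -!mulgA; congr (h * _); rewrite [in LHS]mulgA (cn _ an) -!mulgA.
      by congr (_ * (_ * (_ * _))); rewrite (cn _ bn).
    rewrite e; case: n IH nN cn an bn hh hh' e => [|n] IH nN cn an bn hh hh' e.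
      have b1 : b = 1 by case: bn => [[|//] _ ->]; rewrite big_nil.
      apply: Or33; exists (h * a); last by rewrite b1 mulg1.
      by apply: belowM => //; exact: belowS an.
    apply: Or32; rewrite -s_braid //.
    exists (h * a * s n.+1), (s n.+1 * b); split; last by rewrite !mulgA.
      by do 2?apply: belowM => //; [exact: belowS an|exact: below_gen].
    by apply: belowM; [exact: below_gen|exact: belowS bn].
  - apply: Or33; exists (h * a); first by apply: belowM => //; exact: belowS an.
    by rewrite /= -!mulgA; congr (h * _); rewrite [in LHS]mulgA (cn _ an) -!mulgA.
- case: n IH nN hh => [|n] IH nN hh.
    by apply: Or31; rewrite /= sKr.
  apply: Or32; exists h, (zB n); split=> //.
  by rewrite /= !mulgA sKr.
Qed.

Let below_cosetsB n : (n < N)%N -> forall x, below n.+1 x -> cosetsB n x.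
Proof.
elim: n => [|n IH] nN x [u un ->].
  elim/last_ind: u un => [|u i IHu]; first by rewrite big_nil => _; apply: Or31.
  rewrite all_rcons -cats1 big_cat big_seq1 => /andP[i1 un].
  by apply: cosetsB_gen => //; exact: IHu.
elim/last_ind: u un => [|u i IHu]; first by rewrite big_nil => _; apply: Or31.
rewrite all_rcons -cats1 big_cat big_seq1 => /andP[i1 un].
apply: cosetsB_gen => //; last exact: IHu.
by move=> y yn k [<-]; apply: IH => //; exact: ltnW.
Qed.

Lemma below_finite n : (n <= N)%N -> exists r : seq G, forall x, below n x -> x \in r.
Proof.
elim: n => [|n IH] nN.
  by exists [:: 1] => x [[|//] _ ->]; rewrite big_nil inE.
have [r hr] := IH (ltnW nN).
exists (r ++ [seq h * s n * h' | h <- r, h' <- r] ++ [seq h * zB n | h <- r]) => x.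
rewrite !mem_cat => /(below_cosetsB nN)[/hr ->//|[h [h' [/hr hh /hr hh' ->]]]|[h /hr hh ->]].
  by rewrite (allpairs_f (fun h h' => h * s n * h')) // orbT.
by rewrite (map_f (fun h => h * zB n)) // !orbT.
Qed.

End TypeB.

Section Relations.
Variables (T : finType) (m : coxeter_matrix T).
Local Notation g := (cox_gen m).

Lemma cox_rel2 s t : s != t -> m s t = Some 2 -> g s * g t = g t * g s.
Proof.
by move=> st /(cox_alternating st); rewrite /cox_prod !big_cons !big_nil !mulg1.
Qed.

Lemma cox_rel3 s t : s != t -> m s t = Some 3 -> g s * g t * g s = g t * g s * g t.
Proof.
by move=> st /(cox_alternating st); rewrite /cox_prod !big_cons !big_nil !mulg1 !mulgA.
Qed.

Lemma cox_rel4 s t : s != t -> m s t = Some 4 ->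
  g s * g t * g s * g t = g t * g s * g t * g s.
Proof.
by move=> st /(cox_alternating st); rewrite /cox_prod !big_cons !big_nil !mulg1 !mulgA.
Qed.

Lemma spherical_seq (r : seq (coxeter_group m)) : (forall x, x \in r) -> spherical m.
Proof.
move=> h; apply: (@sub_finite_set _ _ [set` r]%classic); last exact: finite_seq.
by move=> x _; exact: h.
Qed.

End Relations.

Lemma spherical_B n : spherical (coxeter_B n).
Proof.
case: n => [|n]; first by apply: (@spherical_seq _ _ [:: 1]) => x;
  have [[|[]//] <-] := cox_prod_surj x; rewrite cox_prod_nil inE.
(* The numbering is reversed, so that the edge labelled 4 joins s 0 and s 1. *)
pose s k : coxeter_group (coxeter_B n.+1) := cox_gen _ (inord (n - k)).
have mE i j : (i < n.+1)%N -> (j < n.+1)%N -> (i < j)%N ->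
    (inord (n - i) != inord (n - j) :> 'I_n.+1) /\
    coxeter_B n.+1 (inord (n - i)) (inord (n - j)) =
    Some (if j == i.+1 then (if i == 0 then 4 else 3) else 2)%N.
  move=> iN jN ij; have ne : inord (n - i) != inord (n - j) :> 'I_n.+1.
    apply/eqP => /(congr1 (@nat_of_ord _)); rewrite !inordK; lia.
  split=> //; rewrite /= (negPf ne) !inordK; [|lia..].
  congr Some; rewrite /label_B; do !case: ifP; lia.
have [||||r hr] := @below_finite _ n.+1 s _ _ _ _ n.+1 (leqnn _).
- by move=> i _; exact: cox_gen2.
- move=> i j /andP[ij jn]; have [|ne e] := mE i j _ jn (ltnW ij); first by lia.
  by apply: cox_rel2 => //; rewrite e; congr Some; do !case: ifP; lia.
- move=> i i0 i_n; have [|ne e] := mE i i.+1 _ i_n (ltnSn i); first exact: ltnW.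
  by apply: cox_rel3 => //; rewrite e eqxx; case: (i) i0.
- move=> n1; have [ne e] := mE 0%N 1%N (ltn0Sn n) n1 (ltn0Sn 0).
  by apply: cox_rel4 => //; rewrite e.
apply: (spherical_seq (r := r)) => x; apply: hr; have [u <-] := cox_prod_surj x.
exists [seq (n - val i)%N | i <- u].
  by apply/allP => k /mapP[i _ ->]; lia.
rewrite big_map; apply: eq_bigr => i _; rewrite /s; congr cox_gen.
by apply: val_inj; rewrite /= inordK; have := ltn_ord i; lia.
Qed.

(** The first n vertices of B_(n+1) span a diagram of type A_n. *)
Lemma spherical_A n : spherical (coxeter_A n).
Proof.
apply: (@spherical_sub _ _ (coxeter_B n.+1) _ (widen_ord (leqnSn n))) (spherical_B n.+1).
  by move=> i j /(congr1 val) /= /val_inj.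
move=> i j /=; rewrite -val_eqE /= val_eqE; congr Some; case: ifP => // ij.
have := ltn_ord i; have := ltn_ord j; rewrite /label_A /label_B.
by do !case: ifP; lia.
Qed.

(* W(B_n) acts on W(D_n): the last generator acts by the diagram automorphism and the other ones by
   left multiplication. The action is transitive, which gives the finiteness of W(D_n). *)
Section TypeD.
Variable n : nat.
Local Notation N := n.+3.
Local Notation D := (coxeter_D N).
Local Notation B := (coxeter_B N).
Local Notation W := (coxeter_group D).
Local Notation g := (cox_gen D).

Definition swap_nat (k : nat) : nat :=
  if k == n.+1 then n.+2 else if k == n.+2 then n.+1 else k.

Lemma swap_nat_lt k : (k < N)%N -> (swap_nat k < N)%N.
Proof. by rewrite /swap_nat; do !case: ifP; lia. Qed.

Definition swapD (i : 'I_N) : 'I_N := Ordinal (swap_nat_lt (ltn_ord i)).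

Lemma swapDK : involutive swapD.
Proof. by move=> i; apply: val_inj; rewrite /= /swap_nat; do !case: ifP; lia. Qed.

Lemma swapD_m i j : D (swapD i) (swapD j) = D i j.
Proof.
rewrite /= (inj_eq (can_inj swapDK)); congr Some; case: ifP => // ij.
have ne : (i : nat) != j by rewrite -val_eqE in ij; rewrite ij.
have := ltn_ord i; have := ltn_ord j; move: (i : nat) (j : nat) ne => k l ne lN kN.
rewrite /label_D /swap_nat; do !case: ifP; lia.
Qed.

Local Notation sigma := (@embedding _ _ D D swapD).

Let sigmaM x y : sigma (x * y) = sigma x * sigma y.
Proof. exact: (embeddingM (can_inj swapDK) swapD_m). Qed.

Let sigma_gen i : sigma (g i) = g (swapD i).
Proof. exact: (embedding_gen (can_inj swapDK) swapD_m). Qed.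

Let sigmaK x : sigma (sigma x) = x.
Proof.
have [u <-] := cox_prod_surj x.
rewrite !(embedding_word (can_inj swapDK) swapD_m) -map_comp.
by rewrite (eq_map (g := id)) ?map_id // => i; exact: swapDK.
Qed.

Let F (i : 'I_N) (x : W) : W := if i == ord_max then sigma x else g i * x.

Let F_invol i x : F i (F i x) = x.
Proof.
rewrite /F; case: (i == ord_max); last exact: cox_genK.
exact: sigmaK.
Qed.

Let iter_left k (x y : W) : iter k (fun z => x * z) y = x ^+ k * y.
Proof. by elim: k => [|k IH]; rewrite ?expg0 ?mul1g //= IH expgS mulgA. Qed.

Let swapD_fix (i : 'I_N) : (i < n.+1)%N -> swapD i = i.
Proof. by move=> i_n; apply: val_inj; rewrite /= /swap_nat; do !case: ifP; lia. Qed.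

Let comm_last (i : 'I_N) : (i : nat) = n.+1 -> g i * g (swapD i) * (g i * g (swapD i)) = 1.
Proof.
move=> iE; have e : i != swapD i.
  by rewrite -val_eqE /= /swap_nat iE eqxx; lia.
rewrite -mulgA [g (swapD i) * _]mulgA -[g (swapD i) * g i](@cox_rel2 _ D i (swapD i)) //.
  by rewrite -mulgA cox_gen2 mulg1 cox_gen2.
rewrite /= (negPf e); congr Some; rewrite /= /swap_nat iE eqxx.
by rewrite /label_D; case: ifP => //; lia.
Qed.

Let F_order i j k : i != j -> B i j = Some k -> forall x, iter k (F i \o F j) x = x.
Proof.
have left_right (a b : 'I_N) : (forall x, iter k (F a \o F b) x = x) ->
    forall x, iter k (F b \o F a) x = x.
  move=> h x; have e q y : iter q (F b \o F a) (F b y) = F b (iter q (F a \o F b) y).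
    by elim: q => //= q ->.
  by rewrite -[x](F_invol b) e h.
have key (a : 'I_N) : (a < n.+2)%N -> B ord_max a = Some k ->
    forall x, iter k (F ord_max \o F a) x = x.
  move=> an; have am : a != ord_max by rewrite -val_eqE /=; lia.
  rewrite /= eq_sym (negPf am) => -[<-] x.
  have Fa y : F a y = g a * y by rewrite /F (negPf am).
  have Fm y : F ord_max y = sigma y by rewrite /F eqxx.
  (* This is the edge labelled 4. Four steps multiply by (a' a)^2, where a' is the image of a under
     the diagram automorphism, and a and a' commute. *)
  have [aE|aE] := eqVneq (a : nat) n.+1.
    have -> : label_B N (minn (@ord_max n.+2) a) (maxn (@ord_max n.+2) a) = 4%N.
      by rewrite /label_B /=; do !case: ifP; lia.
    rewrite /= !Fa !Fm !sigmaM !sigma_gen !swapDK !sigmaK.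
    have cl := comm_last aE; rewrite mulgA in cl.
    by apply: (mulgI (g a)); rewrite !mulgA cl mul1g.
  have -> : label_B N (minn (@ord_max n.+2) a) (maxn (@ord_max n.+2) a) = 2%N.
    by rewrite /label_B /=; do !case: ifP; lia.
  have af : swapD a = a by apply: swapD_fix; move: an aE; lia.
  by rewrite /= !Fa !Fm !sigmaM !sigma_gen !sigmaK !af cox_genK.
move=> ij e; have [im|im] := eqVneq i ord_max.
  subst i; apply: key => //; rewrite ltn_neqAle -ltnS ltn_ord andbT.
  by apply: contraNneq ij => jE; apply/eqP/val_inj.
have [jm|jm] := eqVneq j ord_max.
  subst j; apply: left_right; apply: key; last by rewrite coxeter_sym.
  rewrite ltn_neqAle -ltnS ltn_ord andbT.
  by apply: contraNneq ij => jE; apply/eqP/val_inj.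
move=> x; rewrite (eq_iter (f' := fun z => g i * g j * z)) => [|z]; last first.
  by rewrite /= /F (negPf im) (negPf jm) mulgA.
rewrite iter_left (cox_order_dvd ij) ?mul1g // -e /= (negPf ij); congr Some.
have := ltn_ord i; have := ltn_ord j; move: ij im jm; rewrite -!val_eqE /=.
move: (i : nat) (j : nat) => a b ab am bm aN bN.
rewrite /label_D /label_B; do !case: ifP; lia.
Qed.

Lemma spherical_D3 : spherical D.
Proof.
pose act u := foldr F 1 u.
have reach x : exists u, act u = x.
  have [v <-] := cox_prod_surj x; elim: v => [|i v [u e]].
    by exists [::]; rewrite cox_prod_nil.
  rewrite cox_prod_cons -e; have [im|im] := eqVneq i ord_max; last first.
    by exists (i :: u); rewrite /act /= {1}/F (negPf im).
  pose p : 'I_N := Ordinal (ltnW (ltnSn n.+2)).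
  have sp : swapD p = i.
    by apply: val_inj; rewrite im /= /swap_nat eqxx.
  have pm : p != ord_max by rewrite -val_eqE /=; lia.
  (* [swapD] exchanges p with the last vertex, so sigma, then p, then sigma is left multiplication
     by the last generator. *)
  exists [:: ord_max, p, ord_max & u]; rewrite /act /=.
  by rewrite {1}/F eqxx {1}/F (negPf pm) {1}/F eqxx sigmaM sigma_gen sigmaK sp.
pose th (w : coxeter_group B) := act (sval (cid (cox_prod_surj w))).
apply: (@sub_finite_set _ _ (th @` [set: coxeter_group B])%classic); last first.
  exact/finite_image/spherical_B.
move=> x _; have [u <-] := reach x; exists (cox_prod B u) => //.
rewrite /th /act; apply: (cox_action F_invol F_order).
exact: (svalP (cid (cox_prod_surj (cox_prod B u)))).
Qed.

End TypeD.

Lemma spherical_D n : (2 < n)%N -> spherical (coxeter_D n).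
Proof. by case: n => [|[|[|n]]] // _; exact: spherical_D3. Qed.

Lemma connected_from (n : nat) (m : coxeter_matrix 'I_n) :
  (forall j : 'I_n, (0 < j)%N -> exists2 i : 'I_n, (i < j)%N & coxeter_edge m i j) ->
  forall i j, connect (coxeter_edge m) i j.
Proof.
move=> h; have sym : connect_sym (coxeter_edge m).
  by apply: sym_connect_sym; exact: coxeter_edge_sym.
have root (i j : 'I_n) : (i : nat) = 0 -> connect (coxeter_edge m) i j.
  move=> i0; have [k] := ubnP (j : nat); elim: k j => // k IH j; rewrite ltnS => jk.
  have [j0|j0] := posnP j.
    have -> : j = i by apply: val_inj; rewrite /= i0 j0.
    exact: connect0.
  have [l lj e] := h j j0; apply: connect_trans (IH l _) (connect1 e).
  exact: leq_trans lj jk.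
move=> i j; have n0 : (0 < n)%N by apply: leq_ltn_trans (ltn_ord i).
pose o : 'I_n := Ordinal n0.
by apply: (@connect_trans _ _ o); [rewrite sym|]; exact: root.
Qed.

Lemma connected_A n (i j : 'I_n) : connect (coxeter_edge (coxeter_A n)) i j.
Proof.
apply: connected_from => -[k kn] /= k0; have k1 : (k.-1 < n)%N by lia.
exists (Ordinal k1); rewrite /= ?prednK // /coxeter_edge /= -val_eqE /=.
have -> : (k.-1 == k) = false by lia.
by rewrite /label_A; case: ifP => //; lia.
Qed.

Lemma connected_B n (i j : 'I_n) : connect (coxeter_edge (coxeter_B n)) i j.
Proof.
apply: connected_from => -[k kn] /= k0; have k1 : (k.-1 < n)%N by lia.
exists (Ordinal k1); rewrite /= ?prednK // /coxeter_edge /= -val_eqE /=.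
have -> : (k.-1 == k) = false by lia.
rewrite (minn_idPl (leq_pred k)) (maxn_idPr (leq_pred k)) /label_B prednK // eqxx.
by case: ifP.
Qed.

Lemma connected_D n (i j : 'I_n) : (2 < n)%N -> connect (coxeter_edge (coxeter_D n)) i j.
Proof.
move=> n2; apply: connected_from => -[k kn] /= k0.
have [e|ne] := eqVneq k.+1 n.
  have k2 : (1 < k)%N by lia.
  have k1 : (k - 2 < n)%N by lia.
  exists (Ordinal k1); rewrite /=; first by lia.
  rewrite /coxeter_edge /= -val_eqE /= (_ : (k - 2 == k)%N = false); last by lia.
  rewrite (minn_idPl (leq_subr 2 k)) (maxn_idPr (leq_subr 2 k)) /label_D.
  by rewrite (_ : (k == (k - 2).+2) = true) ?e ?eqxx ?orbT //; lia.
have k1 : (k.-1 < n)%N by lia.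
exists (Ordinal k1); rewrite /= ?prednK // /coxeter_edge /= -val_eqE /=.
have -> : (k.-1 == k) = false by lia.
rewrite (minn_idPl (leq_pred k)) (maxn_idPr (leq_pred k)) /label_D prednK // eqxx /=.
by rewrite ltn_neqAle ne kn.
Qed.

(** * Lower bounds from commuting edges *)

Section CommutingEdges.
Variables (T : finType) (m : coxeter_matrix T) (k : nat) (e : 'I_k -> bool -> T).
Local Notation W := (coxeter_group m).
Local Notation g := (cox_gen m).
Hypothesis finW : spherical m.
Hypothesis e_edge : forall i, coxeter_edge m (e i true) (e i false).
Hypothesis e_comm : forall i j b c, i != j -> e i b != e j c /\ m (e i b) (e j c) = Some 2.
Local Notation longest := (longest finW).
Local Notation states := {ffun 'I_k -> bool}.
Implicit Types f h : states.

Definition state_set f : {set T} := [set e i (f i) | i : 'I_k].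
Local Notation S := state_set.

Let e_inj i j b c : e i b = e j c -> i = j /\ b = c.
Proof.
have [<-|ij] := eqVneq i j; last by have [/eqP] := e_comm b c ij.
have := e_edge i; rewrite /coxeter_edge => /andP[/eqP ne _].
by case: b; case: c => // ee; case: ne.
Qed.

Let mem_state f i b : (e i b \in S f) = (b == f i).
Proof.
apply/imsetP/eqP => [[j _ /e_inj[<- //]]|->].
by exists i.
Qed.

(** This leads from the state S f to a state containing S h. A new element is joined to the other
    end of its edge, which lies in S f; an element common to both sets remains a right descent
    because it commutes with all new ones. *)
Let jump f h : W := longest (S f) * longest (S h :\: S f).

Let jump_disjoint f h : [disjoint S f & S h :\: S f].
Proof.
rewrite -finset.setI_eq0; apply/eqP/finset.setP => x.
by rewrite finset.in_setI finset.in_setD finset.in_set0; case: (_ \in S f); rewrite ?andbF.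
Qed.

Let jump_ldescs f h : ldescs (jump f h) \subset S f.
Proof.
apply/fintype.subsetP => x; rewrite [x \in ldescs _]inE.
apply: longest_mul_ldesc; first exact: jump_disjoint.
move=> u; rewrite finset.in_setD => /andP[uf /imsetP[i _ uE]]; exists (e i (f i)).
  by rewrite mem_state.
have := e_edge i; move: uf; rewrite uE mem_state.
by case: (h i); case: (f i) => // _ /andP[_]; rewrite // coxeter_sym.
Qed.

Let jump_rdescs f h : S h \subset rdescs (jump f h).
Proof.
apply/fintype.subsetP => x xh; rewrite inE.
have [xf|xf] := boolP (x \in S f); last first.
  by apply: longest_mul_rdesc; [exact: jump_disjoint|rewrite finset.in_setD xf].
have comm : commute (g x) (longest (S h :\: S f)).
  have [u uJ <-] := longest_par finW (S h :\: S f).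
  elim: u uJ => [_|y u IH /= /andP[yJ uJ]]; first by rewrite cox_prod_nil; exact: commute1.
  rewrite cox_prod_cons; apply: commuteM; last exact: IH.
  move: yJ; rewrite finset.in_setD => /andP[yf /imsetP[j _ yE]].
  have /imsetP[i _ xE] := xf; have ij : i != j.
    by apply: contraNneq yf => ij; move: xh; rewrite yE xE -ij !mem_state => /eqP ->.
  by rewrite xE yE; have [ne mij] := e_comm (f i) (h j) ij; exact: cox_rel2.
rewrite /rdesc /jump -mulgA -comm mulgA.
have -> : len (longest (S f) * longest (S h :\: S f)) =
    (len (longest (S f)) + len (longest (S h :\: S f)))%N.
  exact/addE/longest_disjoint_add/jump_disjoint.
apply: leq_ltn_trans (lenM _ _) _; rewrite ltn_add2r.
by rewrite -/(rdesc _ _) rdesc_longest.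
Qed.

(** S h contains exactly one end of each edge, so it is determined by its part outside S f. *)
Let jump_inj f : injective (jump f).
Proof.
move=> h h' /mulgI /(congr1 (@ldescs _ m)); rewrite !ldescs_longest => E.
apply/ffunP => i; have := congr1 (fun A : {set T} => e i (~~ f i) \in A) E.
by rewrite !finset.in_setD !mem_state; case: (f i); case: (h i); case: (h' i).
Qed.

Lemma npaths_states n f : ((2 ^ k) ^ n <= npaths finW [set: T] n (S f))%N.
Proof.
elim: n f => [|n IH] f; first by rewrite expn0 npaths_gt0.
pose r := [seq jump f h :: l | h <- enum {: states}, l <- paths finW [set: T] n (S h)].
have rE : ((2 ^ k) ^ n.+1 <= size r)%N.
  rewrite /r size_allpairs_dep sumnE big_map big_enum /=.
  apply: (@leq_trans (\sum_(h : states) (2 ^ k) ^ n)%N); last by apply: leq_sum => h _; exact: IH.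
  by rewrite sum_nat_const card_ffun card_bool card_ord expnS.
apply: leq_trans rE _; apply: uniq_leq_size.
  apply: allpairs_uniq_dep; first exact: enum_uniq.
    by move=> h _; exact: paths_uniq.
  by move=> [h l] [h' l'] _ _ /= [/jump_inj -> ->].
move=> l' /allpairsPdep[h [l [_ /pathsP[sl _ pl] ->]]]; apply/pathsP; split.
- by rewrite /= sl.
- exact: all_par_setT.
by rewrite /= jump_ldescs (path_fromS (jump_rdescs f h) pl).
Qed.

Lemma growth_rate_edges (R : realType) :
  (2 ^+ k <= growth_rate R (fun n => npaths finW [set: T] n [set: T]))%R.
Proof.
apply: (@growth_rate_lower R _ _ _ 1 _ 1%N) => //.
- by move=> n; exact: npaths_gt0.
- by move=> n j; exact: npathsD.
move=> n; rewrite muln1 mul1r -natrX -natrX ler_nat.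
apply: leq_trans (npaths_states n [ffun=> true]) _.
by apply: npathsS; exact: finset.subsetT.
Qed.

End CommutingEdges.

(** The edges {3i, 3i + 1} are separated by the vertices 3i + 2, so they commute. Labels are
    prescribed only below 3k, which leaves the special end of the diagrams B and D free. *)
Lemma growth_rate_labelled (R : realType) n lab (lab2 : forall i j, (2 <= lab i j)%N) k
    (finW : spherical (labelled_matrix n lab2)) :
  (3 * k < n)%N -> (forall i, (3 * i < 3 * k)%N -> lab (3 * i)%N (3 * i).+1 != 2) ->
  (forall i j, (i.+1 < j < 3 * k)%N -> lab i j = 2) ->
  (2 ^+ k <= growth_rate R (fun n0 => npaths finW [set: 'I_n] n0 [set: 'I_n]))%R.
Proof.
move=> kn lab_e lab_c.
have lt (i : 'I_k) (b : bool) : (3 * i + b < n)%N.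
  by have := ltn_ord i; case: b; lia.
apply: (@growth_rate_edges _ _ k (fun i b => Ordinal (lt i b))).
  move=> i; rewrite /coxeter_edge /= -val_eqE /= (_ : (3 * i + 1 == 3 * i + 0)%N = false); last by lia.
  rewrite addn0 addn1 (minn_idPr (leqnSn _)) (maxn_idPl (leqnSn _)) /=.
  by apply: contraNneq (lab_e i _) => [[->] //|]; have := ltn_ord i; lia.
move=> i j b c ij; have ne : (i : nat) != j by [].
have := ltn_ord i; have := ltn_ord j; rewrite /= -val_eqE /=.
have ne2 : (3 * i + b == 3 * j + c)%N = false by case: b; case: c; lia.
rewrite ne2 => jk ik; split=> //; congr Some; apply: lab_c.
by case: b {ne2}; case: c; lia.
Qed.

(** * Disconnected diagrams and diagrams with one vertex *)

Lemma artin_alternating (T : finType) (m : coxeter_matrix T) (s t : T) k :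
  s != t -> m s t = Some k ->
  \prod_(x <- alternating_word k s t) artin_gen m x =
  \prod_(x <- alternating_word k t s) artin_gen m x.
Proof.
move=> st mst; have E (u : seq T) :
    \prod_(x <- u) artin_gen m x = word_class (artin_rel m) (positive_word u).
  elim: u => [|x u IH]; first by rewrite big_nil.
  by rewrite big_cons IH -word_class_cat.
rewrite !E; apply/word_classP; apply: presentation_rel.
by exists s, t, k.
Qed.

Lemma artin_gen_comm (T : finType) (m : coxeter_matrix T) (s t : T) :
  s != t -> m s t = Some 2 -> commute (artin_gen m s) (artin_gen m t).
Proof.
by move=> st /(artin_alternating st); rewrite !big_cons !big_nil !mulg1.
Qed.

(** Its image in the Coxeter group has length 1. *)
Lemma artin_gen_neq1 (T : finType) (m : coxeter_matrix T) (s : T) : artin_gen m s <> 1.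
Proof.
have rel u v : artin_rel m u v -> \prod_(x <- u) cox_gen m x = \prod_(x <- v) cox_gen m x.
  by move=> [a [b [k [ab mab -> ->]]]]; exact: cox_alternating.
move=> e; have := lift_gen rel s; rewrite -[word_class _ _]/(artin_gen m s) e.
rewrite (morph_one (liftM rel)) => /(congr1 (@len _ m)).
by rewrite len1 len_gen.
Qed.

Section Restriction.
Variables (T : finType) (m : coxeter_matrix T) (P : pred T).
Let entry (s t : {x | P x}) := m (val s) (val t).

Fact restrict_sym s t : entry s t = entry t s.
Proof. exact: coxeter_sym. Qed.

Fact restrict_diag s : entry s s = Some 1%N.
Proof. exact: coxeter_diag. Qed.

Fact restrict_off_diag s t k : s != t -> entry s t = Some k -> (2 <= k)%N.
Proof. by rewrite -val_eqE; exact: coxeter_off_diag. Qed.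

Definition restrict_matrix : coxeter_matrix {x | P x} :=
  CoxeterMatrix restrict_sym restrict_diag restrict_off_diag.

Local Notation A := (artin_group m).
Local Notation A' := (artin_group restrict_matrix).

Lemma restrict_incl_rel u v : artin_rel restrict_matrix u v ->
  \prod_(x <- u) artin_gen m (val x) = \prod_(x <- v) artin_gen m (val x).
Proof.
move=> [s [t [k [st mst -> ->]]]].
have := @artin_alternating T m (val s) (val t) k st mst.
by rewrite -!alternating_map !big_map.
Qed.

Definition restrict_incl : A' -> A := presented_lift (fun x : {x | P x} => artin_gen m (val x)).

Lemma restrict_inclM : {morph restrict_incl : x y / x * y}.
Proof. exact: (liftM restrict_incl_rel). Qed.

Lemma restrict_incl_gen x : restrict_incl (artin_gen _ x) = artin_gen m (val x).
Proof. exact: (lift_gen restrict_incl_rel). Qed.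

End Restriction.

Section Disconnected.
Variables (T : finType) (m : coxeter_matrix T) (C : pred T).
Hypothesis C_comm : forall s t, C s -> ~~ C t -> m s t = Some 2.
Local Notation A := (artin_group m).
Local Notation m1 := (restrict_matrix m C).
Local Notation m2 := (restrict_matrix m (predC C)).
Local Notation B := (artin_group m1 * artin_group m2)%type.

(** C and its complement cover T, so the last default (1, 1) is never taken. *)
Let f (x : T) : B :=
  if insub x is Some y then (artin_gen m1 y, 1) else
  if insub x is Some y then (1, artin_gen m2 y) else (1, 1).

Let f1 (y : {x | C x}) : f (val y) = (artin_gen m1 y, 1).
Proof. by rewrite /f valK. Qed.

Let f2 (y : {x | predC C x}) : f (val y) = (1, artin_gen m2 y).
Proof.
rewrite /f insubN; first by rewrite valK.
exact: (valP y).
Qed.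

Let fC x y : C x -> ~~ C y -> commute (f x) (f y).
Proof.
move=> Cx Cy; rewrite -[x]/(val (exist _ x Cx : {x | C x})).
rewrite -[y]/(val (exist _ y Cy : {x | predC C x})) f1 f2.
by apply/pair_equal_spec; split; rewrite /= ?mulg1 ?mul1g.
Qed.

Let f_rel u v : artin_rel m u v -> \prod_(x <- u) f x = \prod_(x <- v) f x.
Proof.
move=> [s [t [k [st mst -> ->]]]].
have two x y : C x -> ~~ C y -> f x * f y = f y * f x by exact: fC.
have [Cs|Cs] := boolP (C s); have [Ct|Ct] := boolP (C t).
- have E (u0 : seq {x | C x}) :
      \prod_(x <- map val u0) f x = (\prod_(x <- u0) artin_gen m1 x, 1) :> B.
    elim: u0 => [|y u0 IH]; first by rewrite !big_nil.
    by rewrite /= !big_cons IH f1; apply/pair_equal_spec; split; rewrite //= mulg1.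
  rewrite -[s]/(val (exist _ s Cs : {x | C x})) -[t]/(val (exist _ t Ct : {x | C x})).
  by rewrite -!alternating_map !E (@artin_alternating _ m1).
- have := C_comm Cs Ct; rewrite mst => -[->].
  by rewrite !big_cons !big_nil !mulg1; exact: (two s t).
- have := C_comm Ct Cs; rewrite coxeter_sym mst => -[->].
  by rewrite !big_cons !big_nil !mulg1; exact/esym/(two t s).
- have E (u0 : seq {x | predC C x}) :
      \prod_(x <- map val u0) f x = (1, \prod_(x <- u0) artin_gen m2 x) :> B.
    elim: u0 => [|y u0 IH]; first by rewrite !big_nil.
    by rewrite /= !big_cons IH f2; apply/pair_equal_spec; split; rewrite //= mulg1.
  rewrite -[s]/(val (exist _ s Cs : {x | predC C x})).
  rewrite -[t]/(val (exist _ t Ct : {x | predC C x})).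
  by rewrite -!alternating_map !E (@artin_alternating _ m2).
Qed.

Local Notation i1 := (@restrict_incl _ m C).
Local Notation i2 := (@restrict_incl _ m (predC C)).

Let i12 a b : commute (i1 a) (i2 b).
Proof.
have i1V x : i1 x^-1 = (i1 x)^-1.
  by apply: (mulgI (i1 x)); rewrite -restrict_inclM !mulgV (morph_one (@restrict_inclM _ m C)).
have i2V x : i2 x^-1 = (i2 x)^-1.
  by apply: (mulgI (i2 x)); rewrite -restrict_inclM !mulgV
    (morph_one (@restrict_inclM _ m (predC C))).
elim/presented_ind: a => [|x e a IH].
  by rewrite (morph_one (@restrict_inclM _ m C)); exact/commute_sym/commute1.
rewrite restrict_inclM; apply/commute_sym/commuteM; apply/commute_sym => //.
suff h : commute (i1 (artin_gen m1 x)) (i2 b).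
  by case: e => //; rewrite word_class_neg i1V; exact/commute_sym/commuteV/commute_sym.
elim/presented_ind: b {IH} => [|y e' b IH].
  by rewrite (morph_one (@restrict_inclM _ m (predC C))); exact: commute1.
rewrite restrict_inclM; apply: commuteM => //.
suff h : commute (i1 (artin_gen m1 x)) (i2 (artin_gen m2 y)).
  by case: e' => //; rewrite word_class_neg i2V; exact: commuteV.
rewrite !restrict_incl_gen; apply: artin_gen_comm; last first.
  by apply: C_comm; [exact: valP|exact: (valP y)].
by apply: contraTneq (valP x) => ->; exact: (valP y).
Qed.

Lemma disconnected_product : isomorphic A B.
Proof.
pose phi : A -> B := presented_lift f.
have phiM x y : phi (x * y) = phi x * phi y by exact: (liftM f_rel).
have phi_gen x : phi (artin_gen m x) = f x by exact: (lift_gen f_rel).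
apply: (isomorphicI (f := phi)) => //.
exists (fun p => i1 p.1 * i2 p.2).
  apply: (@hom_ext _ _ A (fun x => i1 (phi x).1 * i2 (phi x).2) id) => //.
    move=> x y /=; rewrite phiM /= !restrict_inclM -!mulgA; congr (_ * _).
    by rewrite !mulgA (i12 _ _).
  move=> x; rewrite phi_gen.
  have [Cx|Cx] := boolP (C x).
    rewrite -[x]/(val (exist _ x Cx : {x | C x})) f1 /= (morph_one (@restrict_inclM _ m (predC C))).
    by rewrite mulg1 restrict_incl_gen.
  rewrite -[x]/(val (exist _ x Cx : {x | predC C x})) f2 /= (morph_one (@restrict_inclM _ m C)).
  by rewrite mul1g restrict_incl_gen.
have p1 a : phi (i1 a) = (a, 1).
  apply: (@hom_ext _ _ B (phi \o i1) (fun a => (a, 1))) => [x y|x y|x] /=.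
  - by rewrite restrict_inclM phiM.
  - by apply/pair_equal_spec; split; rewrite //= mulg1.
  - by rewrite restrict_incl_gen phi_gen f1.
have p2 b : phi (i2 b) = (1, b).
  apply: (@hom_ext _ _ B (phi \o i2) (fun b => (1, b))) => [x y|x y|x] /=.
  - by rewrite restrict_inclM phiM.
  - by apply/pair_equal_spec; split; rewrite //= mulg1.
  - by rewrite restrict_incl_gen phi_gen f2.
move=> [a b] /=; rewrite phiM p1 p2.
by apply/pair_equal_spec; split; rewrite /= ?mulg1 ?mul1g.
Qed.

End Disconnected.

Lemma rank1_isomorphic (T : finType) (m : coxeter_matrix T) (s0 : T) :
  (forall s, s = s0) -> isomorphic (artin_group m) (artin_group (coxeter_A 1)).
Proof.
move=> Ts; pose m' := coxeter_A 1.
have r1 u v : artin_rel m u v ->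
    \prod_(x <- u) (fun=> artin_gen m' ord0) x = \prod_(x <- v) (fun=> artin_gen m' ord0) x.
  by move=> [s [t [k [/eqP st]]]]; case: st; rewrite (Ts s) (Ts t).
have r2 u v : artin_rel m' u v ->
    \prod_(x <- u) (fun=> artin_gen m s0) x = \prod_(x <- v) (fun=> artin_gen m s0) x.
  by move=> [s [t [k [/eqP st]]]]; case: st; rewrite (ord1 s) (ord1 t).
apply: (isomorphicI (f := presented_lift (fun=> artin_gen m' ord0))); first exact: (liftM r1).
exists (presented_lift (fun=> artin_gen m s0)).
  apply: (@hom_ext _ _ _ (fun x => presented_lift _ (presented_lift _ x)) id) => // [x y|x].
    by rewrite (liftM r1) (liftM r2).
  by rewrite (lift_gen r1) (lift_gen r2) (Ts x).
apply: (@hom_ext _ _ _ (fun x => presented_lift _ (presented_lift _ x)) id) => // [x y|x].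
  by rewrite (liftM r2) (liftM r1).
by rewrite (lift_gen r2) (lift_gen r1) (ord1 x).
Qed.

Local Close Scope group_scope.
Local Open Scope classical_set_scope.
Local Open Scope ring_scope.

(** * The growth rates of parabolic subgroups and of the three families *)

Section Main.
Variable R : realType.

(** One number serves both A_X and A_X^+, since the sizes of their balls differ at most by the
    factor n + 1. *)
Definition parabolic_rate (T : finType) (m : coxeter_matrix T) (finW : spherical m)
  (X : {set T}) : R := growth_rate R (fun n => npaths finW X n [set: T]%SET).

Section Rates.
Variables (T : finType) (m : coxeter_matrix T) (finW : spherical m).
Implicit Types X Y : {set T}.
Local Notation rate := (parabolic_rate finW).

Let a_gt0 X n : (0 < npaths finW X n [set: T]%SET)%N.
Proof. exact: npaths_gt0. Qed.

Let a_mul X n k : (npaths finW X (n + k) [set: T]%SET <=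
  npaths finW X n [set: T]%SET * npaths finW X k [set: T]%SET)%N.
Proof. exact: npathsD. Qed.

Lemma parabolic_growth X (s0 : T) :
  is_growth_rate (parabolic m [set` X]) (garside_set_pm m) (rate X).
Proof.
rewrite /is_growth_rate /growth_seq /parabolic_rate.
apply: (growth_rate_cvg (a_gt0 X) (a_mul X)) => n.
exact: card_ball.
Qed.

Lemma positive_parabolic_growth X (s0 : T) :
  is_growth_rate (positive_parabolic m [set` X]) (garside_set m) (rate X).
Proof.
rewrite /is_growth_rate /growth_seq /parabolic_rate.
apply: (growth_rate_cvg (a_gt0 X) (a_mul X)) => n.
by rewrite card_positive_ball // leqnn /= leq_pmull.
Qed.

Lemma parabolic_rate_le X Y : X \subset Y -> rate X <= rate Y.
Proof.
move=> XY; apply: growth_rate_mono => // n; apply: leq_trans (leq_pmull _ _) => //.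
exact: npathsS.
Qed.

Lemma parabolic_rate_lt X : (forall s t, connect (coxeter_edge m) s t) -> (1 < #|T|)%N ->
  X != [set: T]%SET -> rate X < rate [set: T]%SET.
Proof.
move=> conn T2 XT; have /subsetPn[t _ tX] : ~~ ([set: T]%SET \subset X).
  by apply: contraNN XT => h; rewrite finset.eqEsubset finset.subsetT.
apply: le_lt_trans (growth_rate_lt finW conn T2 t R).
apply: parabolic_rate_le; apply/fintype.subsetP => s sX; rewrite !inE.
by apply: contraNneq tX => <-.
Qed.

Lemma set_mem_setT : [set` [set: T]%SET] = [set: T] :> set T.
Proof. by apply/seteqP; split=> x //= _; rewrite inE. Qed.

Lemma parabolic_setT : parabolic m [set: T] = [set: artin_group m].
Proof.
apply/seteqP; split=> // a _; rewrite -set_mem_setT.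
have [l1 [l2 ->]] := fraction finW a; apply/(parabolicP finW).
by exists l1, l2; split=> //; exact: all_par_setT.
Qed.

End Rates.

(** If s and t were not connected, the component of s and its complement would split A into two
    factors, both nontrivial because a generator is never 1. *)
Lemma connected_irreducible (T : finType) (m : coxeter_matrix T) : irreducible m ->
  forall s t, connect (coxeter_edge m) s t.
Proof.
move=> irr s t; apply/negPn/negP => st; apply: irr.
pose C : pred T := connect (coxeter_edge m) s.
exists {x | C x}, {x | predC C x}, (restrict_matrix m C), (restrict_matrix m (predC C)).
split.
- by exists (artin_gen _ (exist _ s (connect0 _ s))); exact: artin_gen_neq1.
- by exists (artin_gen _ (exist _ t st)); exact: artin_gen_neq1.
apply: disconnected_product => x y Cx Cy; apply/eqP/negPn/negP => mxy.
move: (Cy) => /negP; apply; apply: (connect_trans (Cx) (connect1 _)).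
rewrite /coxeter_edge mxy andbT; apply: contraNneq Cy => <-.
exact: Cx.
Qed.

Lemma rank_gt1 (T : finType) (m : coxeter_matrix T) (t : T) :
  ~ isomorphic (artin_group m) (artin_group (coxeter_A 1)) -> (1 < #|T|)%N.
Proof.
move=> niso; rewrite ltnNge; apply/negP => T1; apply: niso.
by apply: (@rank1_isomorphic _ _ t) => s; apply: (fintype_le1P T1).
Qed.

Section Family.
Variables (m : forall n, coxeter_matrix 'I_n) (k0 : nat).
Hypothesis k0_gt0 : (0 < k0)%N.
Hypothesis m_spherical : forall n, (k0 <= n)%N -> spherical (m n).
Hypothesis m_connected : forall n, (k0 <= n)%N ->
  forall i j, connect (coxeter_edge (m n)) i j.
Hypothesis m_incl : forall n, (k0 <= n)%N -> exists i : 'I_n -> 'I_n.+1,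
  injective i /\ forall a b, m n.+1 (i a) (i b) = m n a b.
Hypothesis m_edges : forall k, exists2 n, (k0 <= n)%N &
  forall finW : spherical (m n), 2 ^+ k <= parabolic_rate finW [set: 'I_n]%SET.

(** The default 0 can only occur for n < k0. *)
Let w (n : nat) : R := if pselect (spherical (m n)) is left finW
  then parabolic_rate finW [set: 'I_n]%SET else 0.

Let wE n : (k0 <= n)%N -> exists finW : spherical (m n), w n = parabolic_rate finW [set: 'I_n]%SET.
Proof.
move=> /m_spherical h; rewrite /w; case: pselect => // finW.
by exists finW.
Qed.

(** The paths of rank n embed into those of a proper parabolic subgroup of rank n + 1, to which
    strict monotonicity applies. *)
Let w_ltS n : (k0 <= n)%N -> w n < w n.+1.
Proof.
move=> kn; have [finW ->] := wE kn; have [finW' ->] := wE (leqW kn).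
have [i [i_inj i_m]] := m_incl kn.
apply: (@le_lt_trans _ _ (parabolic_rate finW' (i @: [set: 'I_n])%SET)).
  apply: growth_rate_mono => [n0|n0 k|n0|n0 k|n0].
  - exact: npaths_gt0.
  - exact: npathsD.
  - exact: npaths_gt0.
  - exact: npathsD.
  - by apply: leq_trans (leq_pmull _ _) => //; exact: npaths_embedding.
apply: parabolic_rate_lt; first by apply: m_connected; exact: leqW.
  by rewrite card_ord ltnS (leq_trans k0_gt0 kn).
apply/eqP => /(congr1 (fun A : {set 'I_n.+1} => #|A|)).
by rewrite card_imset // !cardsT !card_ord; lia.
Qed.

Let w_lt n n' : (k0 <= n < n')%N -> w n < w n'.
Proof.
case/andP=> kn; elim: n' => // n' IH; rewrite ltnS leq_eqVlt => /orP[/eqP <-|nn'].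
  exact: w_ltS.
by apply: lt_trans (IH nn') _; apply: w_ltS; apply: leq_trans kn (ltnW nn').
Qed.

Let w_unbounded (b : R) : exists2 n, (k0 <= n)%N & b < w n.
Proof.
have [k hk] : exists k : nat, b < 2 ^+ k.
  have [N hN] := @linear_le_expr R (`|b| + 1) 2 (ltr1n _ 2).
  exists N; apply: lt_le_trans (hN N (leqnn N)).
  apply: (@lt_le_trans _ _ (`|b| + 1)); last by rewrite ler_peMl ?ler1n // addr_ge0.
  by apply: le_lt_trans (ler_norm b) _; rewrite ltrDl.
have [n kn hn] := m_edges k; exists n => //; have [finW ->] := wE kn.
exact: lt_le_trans hk (hn finW).
Qed.

Lemma family_growth :
  growth_increasing_unbounded R k0 (fun n => [set: artin_group (m n)])
    (fun n => garside_set_pm (m n)) /\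
  growth_increasing_unbounded R k0 (fun n => positive_monoid (m n))
    (fun n => garside_set (m n)).
Proof.
split; exists w; split=> //.
  move=> n kn; have [finW ->] := wE kn; rewrite -parabolic_setT // -set_mem_setT.
  by apply: parabolic_growth; exact: (Ordinal (leq_trans k0_gt0 kn)).
move=> n kn; have [finW ->] := wE kn; rewrite /positive_monoid -set_mem_setT.
by apply: positive_parabolic_growth; exact: (Ordinal (leq_trans k0_gt0 kn)).
Qed.

End Family.
End Main.

Theorem corollary4 (R : realType) :
  (forall (T : finType) (m : coxeter_matrix T),
     irreducible m -> spherical m ->
     ~ isomorphic (artin_group m) (artin_group (coxeter_A 1)) ->
     forall X : set T, X `<` [set: T] ->
       (exists wX w : R,
          [/\ is_growth_rate (parabolic m X) (garside_set_pm m) wX,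
              is_growth_rate [set: artin_group m] (garside_set_pm m) w &
              wX < w]) /\
       (exists wX w : R,
          [/\ is_growth_rate (positive_parabolic m X) (garside_set m) wX,
              is_growth_rate (positive_monoid m) (garside_set m) w &
              wX < w])) /\
  ([/\ growth_increasing_unbounded R 1
         (fun n => [set: artin_group (coxeter_A n)])
         (fun n => garside_set_pm (coxeter_A n)),
       growth_increasing_unbounded R 2
         (fun n => [set: artin_group (coxeter_B n)])
         (fun n => garside_set_pm (coxeter_B n)) &
       growth_increasing_unbounded R 3
         (fun n => [set: artin_group (coxeter_D n)])
         (fun n => garside_set_pm (coxeter_D n))] /\
   [/\ growth_increasing_unbounded R 1
         (fun n => positive_monoid (coxeter_A n))
         (fun n => garside_set (coxeter_A n)),
       growth_increasing_unbounded R 2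
         (fun n => positive_monoid (coxeter_B n))
         (fun n => garside_set (coxeter_B n)) &
       growth_increasing_unbounded R 3
         (fun n => positive_monoid (coxeter_D n))
         (fun n => garside_set (coxeter_D n))]).
Proof.
split.
  move=> T m irr finW niso X [XT /existsNP[t /existsNP[_ tX]]].
  pose Y : {set T} := [set s | `[< X s >]]%SET.
  have YX : [set` Y] = X.
    by apply/seteqP; split=> s /=; rewrite inE => /asboolP.
  have lt : parabolic_rate R finW Y < parabolic_rate R finW [set: T]%SET.
    apply: parabolic_rate_lt; [exact: connected_irreducible|exact: rank_gt1 t niso|].
    by apply/eqP => /finset.setP /(_ t); rewrite !inE => /asboolP.
  split; exists (parabolic_rate R finW Y), (parabolic_rate R finW [set: T]%SET); split=> //.
  - by rewrite -YX; exact: parabolic_growth.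
  - by rewrite -(parabolic_setT finW) -set_mem_setT; exact: parabolic_growth.
  - by rewrite -YX; exact: positive_parabolic_growth.
  - by rewrite /positive_monoid -set_mem_setT; exact: positive_parabolic_growth.
(* In types B and D the special end carries the largest indices, so the smaller diagram is included
   by adding a vertex at the front. *)
have shift n : exists i : 'I_n -> 'I_n.+1, injective i /\ forall a, (i a : nat) = a.+1.
  exists (fintype.lift ord0); split; first exact: fintype.lift_inj.
  by move=> a; rewrite /= /bump.
have [A1 A2] : growth_increasing_unbounded R 1
    (fun n => [set: artin_group (coxeter_A n)]) (fun n => garside_set_pm (coxeter_A n)) /\
  growth_increasing_unbounded R 1
    (fun n => positive_monoid (coxeter_A n)) (fun n => garside_set (coxeter_A n)).
  apply: family_growth => //.
  - by move=> n _; exact: spherical_A.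
  - by move=> n _; exact: connected_A.
  - move=> n _; exists (widen_ord (leqnSn n)); split=> [a b /(congr1 val) /= /val_inj //|a b].
    by rewrite /= -!val_eqE /=.
  - move=> k; exists (3 * k).+1 => // finW; apply: growth_rate_labelled => //.
      by move=> i _; rewrite /label_A eqxx.
    by move=> i j /andP[ij _]; rewrite /label_A; case: ifP => //; lia.
have [B1 B2] : growth_increasing_unbounded R 2
    (fun n => [set: artin_group (coxeter_B n)]) (fun n => garside_set_pm (coxeter_B n)) /\
  growth_increasing_unbounded R 2
    (fun n => positive_monoid (coxeter_B n)) (fun n => garside_set (coxeter_B n)).
  apply: family_growth => //.
  - by move=> n _; exact: spherical_B.
  - by move=> n _; exact: connected_B.
  - move=> n _; have [i [i_inj iE]] := shift n; exists i; split=> // a b.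
    rewrite /= (inj_eq i_inj) !iE; congr Some; case: ifP => // _.
    by rewrite minnSS maxnSS.
  - move=> k; exists (3 * k).+2 => // finW; apply: growth_rate_labelled => //.
      by move=> i _; rewrite /label_B eqxx; case: ifP.
    by move=> i j /andP[ij _]; rewrite /label_B; case: ifP => //; lia.
have [D1 D2] : growth_increasing_unbounded R 3
    (fun n => [set: artin_group (coxeter_D n)]) (fun n => garside_set_pm (coxeter_D n)) /\
  growth_increasing_unbounded R 3
    (fun n => positive_monoid (coxeter_D n)) (fun n => garside_set (coxeter_D n)).
  apply: family_growth => //.
  - by move=> n n2; exact: spherical_D.
  - by move=> n n2 i j; exact: connected_D.
  - move=> n _; have [i [i_inj iE]] := shift n; exists i; split=> // a b.
    rewrite /= (inj_eq i_inj) !iE; congr Some; case: ifP => // _.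
    by rewrite minnSS maxnSS.
  (* With this rank the fork occupies the vertices 3k, 3k + 1 and 3k + 2, beyond the k chosen
     edges. *)
  - move=> k; exists (3 * k).+3 => // finW; apply: growth_rate_labelled => //.
    + by lia.
    + by move=> i ik; rewrite /label_D eqxx /= (_ : (_ < _)%N = true) //; lia.
    + by move=> i j /andP[ij jk]; rewrite /label_D; case: ifP => //; lia.
by [].
Qed.
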